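(* Let $\mathcal{G}_0$ be the regular hexagonal lattice graph, and for $n\geq1$ let $\mathcal{G}_n$ be the $3$-regular planar lattice graph obtained from $\mathcal{G}_{n-1}$ by truncation (replacing every vertex by a triangle while preserving each edge). For $n\geq0$ let $\mathcal{G}'_n$ be the ($4$-regular) medial graph of $\mathcal{G}_n$. Then for all $n\geq0$, $$\nu^{\lozenge}(\mathcal{G}'_n)<2\pi z_{\mathcal{G}'_n}<\overline{\nu}(\mathcal{G}'_n).$$
   Context: A planar lattice graph $\mathcal{G}$ is a connected locally finite planar graph embedded in $\mathbb{R}^2$ that is invariant under the translation action of a lattice $\Lambda\cong\mathbb{Z}^2$; $G=\mathcal{G}/\Lambda$ is the quotient graph on the torus $T^2=\mathbb{R}^2/\Lambda$, with vertex, edge and face sets $VG,EG,FG$, and $G^*$ is its dual graph on $T^2$. The regular hexagonal lattice graph is the $1$-skeleton of the tiling of the plane by regular hexagons. Truncation: each vertex $v$ of a $3$-regular planar lattice graph is replaced by a triangle (a complete graph $K_3$ bounding a face), whose three vertices are the new endpoints of the three edges at $v$, one each; the result is again $3$-regular. Medial graph: the medial graph of $\mathcal{G}$ has one vertex for each edge of $\mathcal{G}$, and for each corner of each face of $\mathcal{G}$ an edge joining the two vertices corresponding to the two consecutive edges at that corner. Spanning tree entropy: $z_{\mathcal{G}}=\lim_{m\to\infty}\frac{\log\tau(\Gamma_m)}{|V\Gamma_m|}$, where $\Gamma_m$ is the exhaustive nested sequence of finite connected planar graphs given by $m\times m$ copies of the $\Lambda$-fundamental domain of $\mathcal{G}$,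 $\tau$ is the number of spanning trees, and $V\Gamma_m$ is the vertex set. Bipyramid volume: Let $L(\theta)=-\int_0^\theta\log|2\sin t|\,dt$, and let $B_k$ ($k\ge 2$) be the hyperbolic regular ideal bipyramid over a $k$-gon, with $\mathrm{vol}(B_k)=2k\,L(\pi/k)$ (so $\mathrm{vol}(B_2)=0$). With $|f|$ the degree of a face $f$, $\mathrm{vol}^{\lozenge}(G)=\sum_{f\in FG}\mathrm{vol}(B_{|f|})$, and $\nu^{\lozenge}(\mathcal{G})=\frac{\mathrm{vol}^{\lozenge}(G)+\mathrm{vol}^{\lozenge}(G^* )}{|VG|}$. Upper quantity: $v_{\mathrm{oct}}=\mathrm{vol}(B_4)\approx 3.66386$ is the volume of the hyperbolic regular ideal octahedron, and $\overline{\nu}(\mathcal{G})=\frac{|EG|\,v_{\mathrm{oct}}}{|VG|}$. *)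

(* Defs.v *)
(* MathComp / MathComp-Analysis. *)
From HB Require Import structures.
From mathcomp Require Import all_boot all_order all_algebra all_fingroup.
From mathcomp Require Import all_classical all_reals all_analysis.

Set Implicit Arguments.
Unset Strict Implicit.
Unset Printing Implicit Defensive.

Import Order.TTheory GRing.Theory Num.Theory.
Import numFieldTopology.Exports numFieldNormedType.Exports.

Local Open Scope ring_scope.

(* Finite multigraphs (loops and multiple edges allowed) in the style of
   Serre: an edge is a pair {a, rev a} of opposite arcs. *)
Record multigraph := Multigraph {
  vertex : finType;
  arc : finType;
  src : arc -> vertex;
  rev : arc -> arc;
  revK : involutive rev;
  rev_neq : forall a, rev a != a }.

Definition tgt (H : multigraph) (a : arc H) : vertex H := src (rev a).

(* A set of edges is represented by a set of arcs closed under [rev]. *)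
Definition rev_closed (H : multigraph) (T : {set arc H}) : Prop :=
  forall a, a \in T -> rev a \in T.

Definition adjacent_in (H : multigraph) (T : {set arc H}) : rel (vertex H) :=
  fun u v => [exists a in T, (src a == u) && (tgt a == v)].

Definition spanning_connected (H : multigraph) (T : {set arc H}) : Prop :=
  forall u v : vertex H, connect (adjacent_in T) u v.

(* A nonempty closed walk using every edge at most once. *)
Definition closed_trail (H : multigraph) (s : seq (arc H)) : bool :=
  [&& s != [::], path.cycle (fun a b => tgt a == src b) s, uniq s
    & all (fun a => rev a \notin s) s].

Definition acyclic (H : multigraph) (T : {set arc H}) : Prop :=
  forall s : seq (arc H), closed_trail s -> ~ {subset s <= T}.

Definition spanning_tree (H : multigraph) (T : {set arc H}) : Prop :=
  [/\ rev_closed T, spanning_connected T & acyclic T].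

Definition num_spanning_trees (H : multigraph) : nat :=
  #|[pred T : {set arc H} | `[< spanning_tree T >]]|.

Definition connected_graph (H : multigraph) : Prop :=
  spanning_connected [set: arc H]%SET.

(* A planar lattice graph with lattice Z^2 is encoded by its periodic rotation
   system.  [dart] is the set of Z^2-orbits of darts (oriented edges), so that
   the darts of the lattice graph itself are the pairs (d, x) with x : Z^2, and
   (d, x) is the translate of (d, 0) by x.  The equivariant permutations
     (d, x) |-> (edge d, x + edge_shift d)   reversal of a dart,
     (d, x) |-> (node d, x + node_shift d)   next dart, counterclockwise,
                                             at the same source vertex
   determine the lattice graph with its embedding; [edge] and [node] alone form
   the combinatorial map of the quotient graph on the torus. *)
Record periodic_map := PeriodicMap {
  dart : finType;
  edge : {perm dart};
  node : {perm dart};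
  edge_shift : dart -> int * int;
  node_shift : dart -> int * int;
  edgeK : involutive edge;
  edge_neq : forall d, edge d != d;
  edge_shiftN : forall d, edge_shift (edge d) = - edge_shift d }.

(* (d, x) |-> (node^-1 d, x + node_shiftV d) is the previous dart. *)
Definition node_shiftV (G : periodic_map) (d : dart G) : int * int :=
  - node_shift ((node G)^-1%g d).

(* The face on the left of d: cross d, then turn clockwise.  Products of
   permutations are read from left to right. *)
Definition face (G : periodic_map) : {perm dart G} :=
  (edge G * (node G)^-1)%g.

(* The sets VG, EG and FG of the toroidal quotient graph. *)
Definition vertices (G : periodic_map) : {set {set dart G}} := porbits (node G).
Definition edges (G : periodic_map) : {set {set dart G}} := porbits (edge G).
Definition faces (G : periodic_map) : {set {set dart G}} := porbits (face G).

(* The dual of a dart crosses it from the face on its left. *)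
Definition dual_map (G : periodic_map) : periodic_map :=
  @PeriodicMap (dart G) (edge G) (face G) (@edge_shift G)
    (fun d => edge_shift d + node_shiftV (edge G d))
    (@edgeK G) (@edge_neq G) (@edge_shiftN G).

Section Truncation.
Variable G : periodic_map.

(* The vertices of the truncation are the darts d of G (the vertex d lies on
   the dart d close to its source).  The three darts there are, in
   counterclockwise order: (d, 0), the remainder of the edge of d; (d, 1), the
   side of the new face going to the vertex [node d]; (d, 2), the side going to
   the vertex [node^-1 d]. *)
Definition trunc_dart := (dart G * 'I_3)%type.

Definition trunc_edge_fun (a : trunc_dart) : trunc_dart :=
  let: (d, k) := a in
  match val k with
  | 0%N => (edge G d, inord 0)
  | 1%N => (node G d, inord 2)
  | _ => ((node G)^-1%g d, inord 1)
  end.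

Definition trunc_edge_shift (a : trunc_dart) : int * int :=
  let: (d, k) := a in
  match val k with
  | 0%N => edge_shift d
  | 1%N => node_shift d
  | _ => node_shiftV d
  end.

Definition trunc_node_fun (a : trunc_dart) : trunc_dart := (a.1, ordS a.2).

Lemma trunc_edge_funK : involutive trunc_edge_fun.
Proof.
case=> d [[|[|[|k]]] hk] //; rewrite /trunc_edge_fun /= inordK //=.
- by rewrite edgeK; congr (_, _); apply: val_inj; rewrite /= inordK.
- by rewrite permK; congr (_, _); apply: val_inj; rewrite /= inordK.
- by rewrite permKV; congr (_, _); apply: val_inj; rewrite /= inordK.
Qed.

Lemma trunc_node_fun_inj : injective trunc_node_fun.
Proof.
apply: (can_inj (g := fun a => (a.1, ord_pred a.2))) => -[d k].
by rewrite /trunc_node_fun /= ordSK.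
Qed.

Definition trunc_edge : {perm trunc_dart} :=
  perm (can_inj trunc_edge_funK).
Definition trunc_node : {perm trunc_dart} := perm trunc_node_fun_inj.

Lemma trunc_edgeK : involutive trunc_edge.
Proof. by move=> a; rewrite !permE trunc_edge_funK. Qed.

Lemma trunc_edge_neq a : trunc_edge a != a.
Proof.
rewrite permE; case: a => d [[|[|[|k]]] hk] //=; rewrite xpair_eqE negb_and.
- by rewrite edge_neq.
- by apply/orP; right; rewrite -val_eqE /= inordK.
- by apply/orP; right; rewrite -val_eqE /= inordK.
Qed.

Lemma trunc_edge_shiftN a :
  trunc_edge_shift (trunc_edge a) = - trunc_edge_shift a.
Proof.
rewrite permE; case: a => d [[|[|[|k]]] hk] //=; rewrite inordK //=.
- exact: edge_shiftN.
- by rewrite /node_shiftV permK.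
- by rewrite /node_shiftV opprK.
Qed.

Definition truncation : periodic_map :=
  @PeriodicMap trunc_dart trunc_edge trunc_node trunc_edge_shift (fun=> 0)
    trunc_edgeK trunc_edge_neq trunc_edge_shiftN.

End Truncation.

Section Medial.
Variable G : periodic_map.

(* The corner between d and [node d] at their source is named d; its medial
   edge joins the midpoints of the edges of d and of [node d].  The dart
   (d, false) is based at the midpoint of d, the dart (d, true) at the midpoint
   of [node d].  The four darts around the midpoint of d are, counterclockwise,
   (d, false), (node^-1 d, true), (edge d, false), (node^-1 (edge d), true). *)
Definition medial_dart := (dart G * bool)%type.

Definition medial_edge_fun (a : medial_dart) : medial_dart := (a.1, ~~ a.2).

Definition medial_node_fun (a : medial_dart) : medial_dart :=
  if a.2 then (edge G (node G a.1), false) else ((node G)^-1%g a.1, true).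

Definition medial_node_shift (a : medial_dart) : int * int :=
  if a.2 then node_shift a.1 + edge_shift (node G a.1) else node_shiftV a.1.

Lemma medial_edge_funK : involutive medial_edge_fun.
Proof. by case=> d b; rewrite /medial_edge_fun /= negbK. Qed.

Lemma medial_node_fun_inj : injective medial_node_fun.
Proof.
move=> [d [|]] [d' [|]] //= [].
- by move/perm_inj/perm_inj ->.
- by move/perm_inj ->.
Qed.

Definition medial_edge : {perm medial_dart} :=
  perm (can_inj medial_edge_funK).
Definition medial_node : {perm medial_dart} := perm medial_node_fun_inj.

Lemma medial_edgeK : involutive medial_edge.
Proof. by move=> a; rewrite !permE medial_edge_funK. Qed.

Lemma medial_edge_neq a : medial_edge a != a.
Proof. by rewrite permE; case: a => d [|]; rewrite xpair_eqE andbF. Qed.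

Lemma medial_edge_shiftN (a : medial_dart) : (0 : int * int) = - 0.
Proof. by rewrite oppr0. Qed.

Definition medial : periodic_map :=
  @PeriodicMap medial_dart medial_edge medial_node (fun=> 0) medial_node_shift
    medial_edgeK medial_edge_neq medial_edge_shiftN.

End Medial.

(* The regular hexagonal lattice graph has two orbits of vertices, the black
   ones A + x and the white ones B + x (x in the lattice).  Let u0, u1, u2 be
   the vectors of edge length at angles 90, 210 and 330 degrees, B = A + u0, and
   take (u1 - u0, u2 - u0) as the basis of the lattice.  The dart (true, k) goes
   from A in direction u_k, the dart (false, k) from B in direction - u_k; both
   around A and around B, counterclockwise order is increasing k modulo 3. *)
Section Hexagonal.

Definition hex_dart := (bool * 'I_3)%type.

Definition hex_edge_fun (a : hex_dart) : hex_dart := (~~ a.1, a.2).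
Definition hex_node_fun (a : hex_dart) : hex_dart := (a.1, ordS a.2).

(* A + u_k = B + hex_vec k. *)
Definition hex_vec (k : 'I_3) : int * int :=
  match val k with 0%N => 0 | 1%N => (1, 0) | _ => (0, 1) end.

Definition hex_edge_shift (a : hex_dart) : int * int :=
  if a.1 then hex_vec a.2 else - hex_vec a.2.

Lemma hex_edge_funK : involutive hex_edge_fun.
Proof. by case=> b k; rewrite /hex_edge_fun /= negbK. Qed.

Lemma hex_node_fun_inj : injective hex_node_fun.
Proof.
apply: (can_inj (g := fun a => (a.1, ord_pred a.2))) => -[d k].
by rewrite /hex_node_fun /= ordSK.
Qed.

Definition hex_edge : {perm hex_dart} := perm (can_inj hex_edge_funK).
Definition hex_node : {perm hex_dart} := perm hex_node_fun_inj.

Lemma hex_edgeK : involutive hex_edge.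
Proof. by move=> a; rewrite !permE hex_edge_funK. Qed.

Lemma hex_edge_neq a : hex_edge a != a.
Proof. by rewrite permE; case: a => [[|] k]. Qed.

Lemma hex_edge_shiftN a : hex_edge_shift (hex_edge a) = - hex_edge_shift a.
Proof. by rewrite permE; case: a => [[|] k] //=; rewrite /hex_edge_shift opprK. Qed.

Definition hexagonal : periodic_map :=
  @PeriodicMap hex_dart hex_edge hex_node hex_edge_shift (fun=> 0)
    hex_edgeK hex_edge_neq hex_edge_shiftN.

End Hexagonal.

Definition truncated_hexagonal (n : nat) : periodic_map :=
  iter n truncation hexagonal.

Definition medial_truncated_hexagonal (n : nat) : periodic_map :=
  medial (truncated_hexagonal n).

(* A choice of a Z^2-fundamental domain for the vertices: the source vertex of
   the dart (d, x) lies in the copy x + c d of the domain. *)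
Definition fundamental_domain (G : periodic_map) (c : dart G -> int * int) :
  Prop := forall d, c d = node_shift d + c (node G d).

Section Block.
Variables (G : periodic_map) (c : dart G -> int * int) (m : nat).

Definition cell := ('I_m * 'I_m)%type.
Definition vec (p : cell) : int * int := (Posz p.1, Posz p.2).

(* A dart with source in the copy p has its target in the copy
   p + displacement. *)
Definition displacement (d : dart G) : int * int :=
  edge_shift d + c (edge G d) - c d.

Definition block_vertex := ({v | v \in vertices G} * cell)%type.

(* ((d, p), q) is the translate of d from the copy p to the copy q. *)
Definition in_block (a : dart G * cell * cell) : bool :=
  vec a.2 == vec a.1.2 + displacement a.1.1.

Definition block_arc := {a : dart G * cell * cell | in_block a}.

Lemma porbit_vertices (d : dart G) : porbit (node G) d \in vertices G.
Proof. exact: imset_f. Qed.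

Definition block_src (a : block_arc) : block_vertex :=
  (Sub (porbit (node G) (val a).1.1) (porbit_vertices _), (val a).1.2).

Lemma block_rev_subproof (a : block_arc) :
  in_block ((edge G (val a).1.1, (val a).2), (val a).1.2).
Proof.
case: a => [[[d p] q]]; rewrite /in_block /displacement /= => /eqP ->.
have -> : edge_shift (edge G d) + c (edge G (edge G d)) - c (edge G d)
          = - (edge_shift d + c (edge G d) - c d).
  by rewrite edgeK edge_shiftN opprB opprD [RHS]addrC addrAC.
by rewrite addrK.
Qed.

Definition block_rev (a : block_arc) : block_arc :=
  Sub ((edge G (val a).1.1, (val a).2), (val a).1.2) (block_rev_subproof a).

Lemma block_revK : involutive block_rev.
Proof. by case=> [[[d p] q] h]; apply: val_inj; rewrite /= edgeK. Qed.

Lemma block_rev_neq a : block_rev a != a.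
Proof.
by case: a => [[[d p] q] h]; rewrite -val_eqE /= !xpair_eqE (negbTE (edge_neq d)).
Qed.

(* The subgraph induced on the vertices of m x m copies of the fundamental
   domain. *)
Definition block_graph : multigraph :=
  Multigraph block_src block_revK block_rev_neq.

End Block.

Section Invariants.
Variable R : realType.
Implicit Type G : periodic_map.

(* The fundamental domain is only required to make all the finite graphs
   connected; the limit must be the same for all such domains. *)
Definition admissible_domain G (c : dart G -> int * int) : Prop :=
  fundamental_domain c /\
  forall m, (0 < m)%N -> connected_graph (block_graph c m).

Definition is_spanning_tree_entropy G (z : R) : Prop :=
  (exists c : dart G -> int * int, admissible_domain c) /\
  forall c : dart G -> int * int, admissible_domain c ->
    ((fun m : nat => ln (num_spanning_trees (block_graph c m))%:R
                     / #|vertex (block_graph c m)|%:R : R) @ \oo --> z)%classic.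

Definition lobachevsky (theta : R) : R :=
  - (\int[lebesgue_measure]_(t in `[0%R, theta]%classic) ln `|2 * sin t|)%R.

Definition vol_bipyramid (k : nat) : R := 2 * k%:R * lobachevsky (pi / k%:R).

Definition v_oct : R := vol_bipyramid 4.

Definition vol_lozenge G : R :=
  \sum_(f in faces G) vol_bipyramid #|f|.

Definition nu_lozenge G : R :=
  (vol_lozenge G + vol_lozenge (dual_map G)) / #|vertices G|%:R.

Definition nu_bar G : R := #|edges G|%:R * v_oct / #|vertices G|%:R.

End Invariants.

(* Main.v *)
(** Spanning trees of tori are counted by determinants of Laplacians, and
    passing from the m x m torus to the m x m block changes their number by a
    factor exp (O (m log m)) only.  For a cubic graph H with incidence matrix B,
    6 - Lap_H = B B^T, while 6 - Lap_M = B^T B for the medial graph M; for the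
    truncation T, Lap_T = 4 - eps - N^T N, where eps is the edge involution on
    the arcs of H and N sends an arc to its source.  As det (1 - X Y) =
    det (1 - Y X), this gives tau(M) = 2/3 6^(|E|-|V|) tau(H) and
    9 tau(T)^2 = 25 15^|V| tau(H)^2, so that the entropies of all the medial
    graphs follow from the number L, the entropy per cell of the hexagonal
    lattice: z_n = (L + (3^n - 1) / 2 ln 15 + 3^n ln 6) / 3^(n+1).

    Diagonalising the Laplacian of the hexagonal torus and evaluating the product
    over one of the two frequencies shows that L is the mean over [0, pi] of a
    concave function with equal values at 0 and pi.  Its left Riemann sums are
    then at most L, and its midpoint sums at least L.

    Truncation doubles the degrees of the faces and adds a triangle per vertex.
    Since vol(B_k) <= 2 pi (C + ln k), with C explicit by the Taylor expansion of
    ln sin, both sides of the two inequalities are bounded by affine functions of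
    3^n, which are compared numerically; only n = 0 in the lower inequality needs
    a sharper estimate of vol(B_6). *)

From HB Require Import structures.
From mathcomp Require Import all_boot all_order all_algebra all_fingroup.
From mathcomp Require Import all_classical all_reals all_analysis.
From mathcomp Require Import measurable_realfun complex.
From mathcomp Require Import ring lra zify.
Require Import Defs.

Set Implicit Arguments.
Unset Strict Implicit.
Unset Printing Implicit Defensive.

Import Order.TTheory GRing.Theory Num.Theory.

Local Open Scope ring_scope.

(** * The matrix-tree theorem *)

(** A Laplacian is singular, and passing to its minors would break the symmetry on which the
    factorisations rest. Tree counts are therefore read off from the Laplacian plus a rank one
    matrix: constant weights are compatible with the incidence matrices of regular graphs, and
    weights on one colour class with the bipartite hexagonal torus. Tori are needed because the
    factorisations and the Fourier transform require every vertex to keep its full degree, which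
    fails at the boundary of a block. The entropy is a limit over every admissible domain, so the
    formula for the medial torus is proved for an arbitrary fundamental domain, and explicit domains
    only serve to prove existence. The number L is never evaluated: Lipschitz continuity makes it a
    limit with a rate, and concavity brackets it by finite sums at multiples of pi / 6, where the
    growth factor is algebraic. For n = 0 the certified margin of the lower inequality is only about
    0.01 out of 3.4, which fixes the precision of the constants used there. *)

Section Determinants.
Variable F : fieldType.

(** Both sides are the determinant of the block matrix with rows (1, A) and (B, 1), eliminated in
    two ways. It trades determinants indexed by vertices for determinants indexed by edges or
    arcs. *)
Lemma det_1subC m n (A : 'M[F]_(m, n)) (B : 'M[F]_(n, m)) :
  \det (1%:M - A *m B) = \det (1%:M - B *m A).
Proof.
have e1 : block_mx 1%:M A B 1%:M
   = block_mx 1%:M 0 B 1%:M *m block_mx 1%:M A 0 (1%:M - B *m A).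
  rewrite mulmx_block !mul1mx !mulmx1 !mul0mx !addr0.
  by rewrite addrC subrK.
have e2 : block_mx 1%:M A B 1%:M
   = block_mx 1%:M A 0 1%:M *m block_mx (1%:M - A *m B) 0 B 1%:M.
  by rewrite mulmx_block !mul1mx !mulmx1 !mul0mx !add0r subrK.
have := congr1 determinant e2; rewrite e1 !det_mulmx.
by rewrite !det_lblock !det_ublock !det1 !mul1r !mulr1 => ->.
Qed.

Lemma det_row0 n (A : 'M[F]_n) i : (forall j, A i j = 0) -> \det A = 0.
Proof.
move=> A0; rewrite /determinant big1 // => s _.
by rewrite (bigD1 i) //= A0 mul0r mulr0.
Qed.

(** Indexing by finite types spares a numbering of vertices, arcs and cells; each type is enumerated
    in its canonical order. *)
Definition fmx (U W : finType) (f : U -> W -> F) : 'M[F]_(#|U|, #|W|) :=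
  \matrix_(i, j) f (enum_val i) (enum_val j).

Lemma eq_fmx (U W : finType) (f g : U -> W -> F) :
  (forall u w, f u w = g u w) -> fmx f = fmx g.
Proof. by move=> e; apply/matrixP => i j; rewrite !mxE e. Qed.

Lemma fmx_mul (U W T : finType) (f : U -> W -> F) (g : W -> T -> F) :
  fmx f *m fmx g = fmx (fun u t => \sum_w f u w * g w t).
Proof.
apply/matrixP => i j; rewrite !mxE.
rewrite [RHS](reindex (@enum_val W W)) /=; last first.
  by exists enum_rank => x _; [exact: enum_valK | exact: enum_rankK].
by apply: eq_bigr => k _; rewrite !mxE.
Qed.

Lemma fmx1 (U : finType) : fmx (fun u v : U => (u == v)%:R) = 1%:M.
Proof. by apply/matrixP => i j; rewrite !mxE (inj_eq enum_val_inj). Qed.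

Lemma fmxD (U W : finType) (f g : U -> W -> F) :
  fmx f + fmx g = fmx (fun u w => f u w + g u w).
Proof. by apply/matrixP => i j; rewrite !mxE. Qed.

Lemma fmxN (U W : finType) (f : U -> W -> F) :
  - fmx f = fmx (fun u w => - f u w).
Proof. by apply/matrixP => i j; rewrite !mxE. Qed.

(** The matrix determinant lemma: by [det_1subC] the determinant shrinks to size one, with [unit] as
    index type. *)
Lemma det_fmx_rank1 (U : finType) (f g : U -> F) :
  \det (fmx (fun u v => (u == v)%:R + f u * g v)) = 1 + \sum_u g u * f u.
Proof.
have -> : fmx (fun u v => (u == v)%:R + f u * g v)
  = 1%:M - fmx (fun u (_ : unit) => - f u) *m fmx (fun (_ : unit) v => g v).
  rewrite fmx_mul -fmx1 fmxN fmxD; apply: eq_fmx => u v.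
  by rewrite big_const card_unit /= addr0 mulNr opprK.
rewrite det_1subC fmx_mul -fmx1 fmxN fmxD.
have cu : #|{: unit}| = 1%N by rewrite card_unit.
set M := fmx _; have -> : \det M = \sum_(i < #|{: unit}|) M i i.
  move: M; rewrite cu => M; rewrite big_ord_recl big_ord0 addr0.
  by rewrite (expand_det_row _ ord0) big_ord_recl big_ord0 addr0 /cofactor
     det_mx00 /= addn0 expr0 !mulr1.
under eq_bigr => i _ do rewrite mxE eqxx.
rewrite sumr_const card_ord card_unit mulr1n; congr (_ + _).
by rewrite -sumrN; apply: eq_bigr => u _; rewrite mulrN opprK.
Qed.

(** Multilinearity in the rows. In its application the summands of a row are the arcs leaving a
    vertex, so that the choices [f] are functional graphs. *)
Lemma det_fmx_rowsum (U K : finType) (G : U -> K -> U -> F) :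
  \det (fmx (fun u v => \sum_k G u k v))
  = \sum_(f : {ffun U -> K}) \det (fmx (fun u v => G u (f u) v)).
Proof.
rewrite /determinant exchange_big /=; apply: eq_bigr => s _.
rewrite -big_distrr /=; congr (_ * _).
under eq_bigr => i _ do rewrite mxE.
under [RHS]eq_bigr => f _ do under eq_bigr => i _ do rewrite mxE.
rewrite bigA_distr_bigA /=.
rewrite (reindex (fun f : {ffun U -> K} => [ffun i => f (enum_val i)])) /=.
  by apply: eq_bigr => f _; apply: eq_bigr => i _; rewrite ffunE.
exists (fun f : {ffun 'I_#|U| -> K} => [ffun u => f (enum_rank u)]) => f _.
  by apply/ffunP => u; rewrite !ffunE enum_rankK.
by apply/ffunP => u; rewrite !ffunE enum_valK.
Qed.

End Determinants.

(** * Arborescences and the Laplacian *)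

Section Arborescences.
Variable H : multigraph.
Local Notation V := (vertex H).
Implicit Type f : {ffun V -> option (arc H)}.

(** A vertex without a chosen arc stays put; for a valid choice this is the root alone. *)
Definition step f (v : V) : V := if f v is Some a then tgt a else v.

Definition valid_choice (r : V) f : bool :=
  [forall v, if f v is Some a then (v != r) && (src a == v) else v == r].

Definition arborescence (r : V) f : bool :=
  valid_choice r f && `[< forall v, exists k, iter k (step f) v = r >].

(** The depth is the least number of iterations leading to [r]. Its strict decrease replaces every
    later argument about the absence of cycles. *)
Lemma iter_depth (T : eqType) (g : T -> T) (r : T) :
  (forall v, exists k, iter k g v = r) ->
  exists d : T -> nat, forall v, v != r -> (d (g v) < d v)%N.
Proof.
move=> h.
have h' v : exists k, iter k g v == r by have [k <-] := h v; exists k.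
exists (fun v => ex_minn (h' v)) => v vr.
case: (ex_minnP (h' v)) => -[|k] /eqP; first by move=> /= /eqP; rewrite (negbTE vr).
rewrite iterSr => kr _; case: ex_minnP => m _; apply.
by apply/eqP.
Qed.

Section Laplacian.
Variable F : numFieldType.

(** Summing the difference arc by arc makes loops cancel and counts multiple edges with
    multiplicity. *)
Definition laplacian (u v : V) : F :=
  \sum_(a | src a == u) ((u == v)%:R - (tgt a == v)%:R).

Lemma sum_delta (T : finType) (g : T -> F) (x : T) :
  \sum_y (y == x)%:R * g y = g x.
Proof.
rewrite (bigD1 x) //= eqxx mul1r big1 ?addr0 // => y /negbTE ->.
by rewrite mul0r.
Qed.

Lemma sum_delta1 (T : finType) (x : T) : \sum_y (x == y)%:R = 1 :> F.
Proof.
by rewrite (bigD1 x) //= eqxx big1 ?addr0 // => y; rewrite eq_sym => /negbTE ->.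
Qed.

Lemma laplacian_row u : \sum_v laplacian u v = 0.
Proof.
rewrite exchange_big /= big1 // => a _.
by rewrite sumrB !sum_delta1 subrr.
Qed.

Lemma laplacian_sym u v : laplacian u v = laplacian v u.
Proof.
rewrite /laplacian !sumrB; congr (_ - _).
  by case: (eqVneq u v) => [->//|uv]; rewrite !big1 // => a _; rewrite eq_sym (negbTE uv).
have e (x y : V) : \sum_(a | src a == x) (tgt a == y)%:R
   = \sum_a ((src a == x) && (tgt a == y))%:R :> F.
  by rewrite big_mkcond; apply: eq_bigr => a _; case: (src a == x).
rewrite !e (reindex_inj (inv_inj (@revK H))) /=.
by apply: eq_bigr => a _; rewrite /tgt revK andbC.
Qed.

(** The contribution of one option to the row of [u]: an arc leaving [u] if [u] is not the root, the
    row [w] at the root. An option that is not allowed at [u] contributes zero, so invalid choices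
    have zero determinant. *)
Definition choice_row (r : V) (w : V -> F) (u : V) (k : option (arc H)) (v : V) :=
  if k is Some a then ((u != r) && (src a == u))%:R * ((u == v)%:R - (tgt a == v)%:R)
  else (u == r)%:R * w v.

Definition rooted_laplacian (r : V) (w : V -> F) (u v : V) : F :=
  if u == r then w v else laplacian u v.

Lemma rooted_laplacianE r w u v :
  rooted_laplacian r w u v = \sum_k choice_row r w u k v.
Proof.
rewrite /rooted_laplacian /choice_row.
rewrite (bigD1 None) //=.
have -> : \sum_(i | i != None) choice_row r w u i v
  = \sum_a choice_row r w u (Some a) v.
  rewrite (reindex_omap Some id) /=; last by case.
  by apply: eq_bigl => a; rewrite eqxx.
case: (eqVneq u r) => [->|ur] /=.
  by rewrite mul1r big1 ?addr0 // => a _; rewrite /= eqxx mul0r.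
rewrite mul0r add0r /laplacian big_mkcond; apply: eq_bigr => a _ /=.
by rewrite ur; case: (src a == u); rewrite ?mul1r ?mul0r.
Qed.

Lemma det_choice_invalid r w f : ~~ valid_choice r f ->
  \det (fmx (fun u v => choice_row r w u (f u) v)) = 0.
Proof.
rewrite /valid_choice negb_forall => /existsP [u hu].
apply: (@det_row0 _ _ _ (enum_rank u)) => j; rewrite mxE enum_rankK /choice_row.
by case: (f u) hu => [a|] /negbTE ->; rewrite mul0r.
Qed.

Lemma choice_row_valid r w f u v : valid_choice r f ->
  choice_row r w u (f u) v =
  if u == r then w v else (u == v)%:R - (step f u == v)%:R.
Proof.
move/forallP/(_ u); rewrite /step; case: (f u) => [a|] /=.
  by case/andP => ur /eqP ->; rewrite eqxx ur (negbTE ur) mul1r.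
by move/eqP => ->; rewrite eqxx mul1r.
Qed.

(** A kernel vector is the indicator of the set [S] of vertices that never reach [r], shifted by a
    constant to be orthogonal to [w]. It is constant along [step] away from the root, which kills
    the other rows, and it is nonzero because the weights [w] do not sum to zero. *)
Lemma det_choice_cyclic r w f : \sum_v w v != 0 ->
  valid_choice r f -> ~~ arborescence r f ->
  \det (fmx (fun u v => choice_row r w u (f u) v)) = 0.
Proof.
move=> w0 vf; rewrite /arborescence vf /= => /asboolPn /existsNP [v0 hv0].
pose S v := `[< forall k, iter k (step f) v <> r >].
have Sr : S r = false by apply/asboolPn => /(_ 0%N).
have Sv0 : S v0 by apply/asboolP => k e; apply: hv0; exists k.
have Sn u : u != r -> S (step f u) = S u.
  move=> ur; apply/asboolP/asboolP => h k.
    by case: k => [|k]; [move/eqP; apply/negP | rewrite iterSr; apply: h].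
  by have := h k.+1; rewrite iterSr.
pose x v : F := (\sum_v w v) * (S v)%:R - (\sum_v w v * (S v)%:R).
apply/eqP; rewrite -det_tr; apply/det0P.
exists (\row_i x (enum_val i)).
  apply/eqP => /rowP x0.
  have xr := x0 (enum_rank r); have xv := x0 (enum_rank v0).
  move: xr xv; rewrite !mxE !enum_rankK /x Sr Sv0 mulr0 mulr1 sub0r => /eqP.
  by rewrite oppr_eq0 => /eqP ->; rewrite subr0 => /eqP; rewrite (negbTE w0).
apply/rowP => i; rewrite !mxE.
transitivity (\sum_v x v * choice_row r w (enum_val i) (f (enum_val i)) v).
  rewrite [RHS](reindex (@enum_val V V)) /=; last first.
    by exists enum_rank => y _; [exact: enum_valK | exact: enum_rankK].
  by apply: eq_bigr => k _; rewrite !mxE.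
move: (enum_val i) => u.
under eq_bigr => v _ do rewrite (choice_row_valid _ _ _ vf).
case: (eqVneq u r) => [_|ur].
  under eq_bigr => v _ do rewrite mulrBl -mulrA [_%:R * _]mulrC.
  by rewrite sumrB -!mulr_sumr [X in _ - X]mulrC subrr.
under eq_bigr => v _ do
  rewrite mulrC mulrBl (eq_sym u) (eq_sym (step f u)).
by rewrite sumrB !sum_delta /x Sn // subrr.
Qed.

(** Multiplication by [U] adds all columns to the column of [r]; since the other rows sum to zero,
    only the total of [w] survives there. The resulting matrix [N] is triangular for the order by
    depth. *)
Lemma det_choice_arborescence r w f : arborescence r f ->
  \det (fmx (fun u v => choice_row r w u (f u) v)) = \sum_v w v.
Proof.
case/andP => vf /asboolP /iter_depth [d dP].
set M := fmx _.
pose U := fmx (fun u v => (u == v)%:R + (u != r)%:R * (v == r)%:R : F).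
have detU : \det U = 1.
  by rewrite det_fmx_rank1 sum_delta eqxx addr0.
rewrite -[LHS]mulr1 -detU -det_mulmx fmx_mul.
pose N u v : F := if u == r then (if v == r then \sum_v w v else w v)
   else if v == r then 0 else (u == v)%:R - (step f u == v)%:R.
have -> : fmx (fun u t => \sum_v choice_row r w u (f u) v *
     ((v == t)%:R + (v != r)%:R * (t == r)%:R)) = fmx N.
  apply: eq_fmx => u t.
  under eq_bigr => v _ do rewrite (choice_row_valid _ _ _ vf).
  rewrite /N; case: (eqVneq t r) => [->|tr] /=.
    transitivity (\sum_v (if u == r then w v else (u == v)%:R - (step f u == v)%:R)).
      by apply: eq_bigr => v _; case: (v == r); rewrite /= ?mulr0 ?mulr1 ?addr0 ?add0r mulr1.
    by case: (eqVneq u r) => // ur; rewrite sumrB !sum_delta1 subrr.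
  under eq_bigr => v _ do rewrite mulr0 addr0 mulrC.
  by rewrite sum_delta.
rewrite /determinant (bigD1 1%g) //= [X in _ + X]big1 ?addr0; last first.
  move=> s s1; apply/eqP; rewrite mulf_eq0; apply/orP; right.
  apply: contraR s1 => p0; apply/eqP.
  have nz i : N (enum_val i) (enum_val (s i)) != 0.
    apply: contraNneq p0 => Ni0; apply/prodf_eq0; exists i => //.
    by rewrite mxE Ni0.
  pose ri := enum_rank r.
  have sr : s ri = ri.
    apply/eqP/negPn/negP => sri.
    have := nz ((s^-1)%g ri); rewrite permKV /N enum_rankK eqxx.
    case: (_ =P r) => [e|_]; last by rewrite eqxx.
    have : (s^-1)%g ri = ri by rewrite -[LHS]enum_valK e.
    by move/(congr1 s); rewrite permKV => e'; rewrite -e' eqxx in sri.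
  have sle i : (d (enum_val (s i)) <= d (enum_val i) ?= iff (s i == i))%N.
    have := nz i; rewrite /N; case: (enum_val i =P r) => [e|/eqP ir].
      have -> : i = ri by rewrite -[LHS]enum_valK e.
      by rewrite sr => _; split; rewrite ?eqxx.
    case: (_ =P r) => _; first by rewrite eqxx.
    case: (eqVneq (enum_val i) (enum_val (s i))) => [e _|_].
      by have -> : s i = i by [apply: enum_val_inj]; split; rewrite ?eqxx.
    case: (eqVneq (step f (enum_val i)) (enum_val (s i))) => [e1 _|_]; last first.
      by rewrite subrr eqxx.
    have lt := dP _ ir; rewrite e1 in lt; split; first exact: ltnW.
    rewrite (ltn_eqF lt); apply/esym/eqP => e.
    by rewrite e ltnn in lt.
  (* A permutation preserves the total depth, so an inequality between depths that holds termwise is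
     a termwise equality, and [s] is the identity. *)
  have := leqif_sum (fun i (_ : true) => sle i).
  rewrite [X in leqif _ X](reindex_inj (@perm_inj _ s)) /= => -[_].
  rewrite eqxx => /esym/forallP h.
  by apply/permP => i; rewrite perm1; apply/eqP; apply: h.
rewrite odd_perm1 expr0 mul1r (bigD1 (enum_rank r)) //= mxE perm1 enum_rankK.
rewrite {1}/N eqxx [X in _ * X]big1 ?mulr1 // => i ir; rewrite mxE perm1 /N.
case: (enum_val i =P r) => [e|/eqP ev]; first by rewrite -e enum_valK eqxx in ir.
rewrite eqxx; case: (_ =P enum_val i) => [e|_]; last by rewrite subr0.
by have := dP _ ev; rewrite e ltnn.
Qed.

Lemma det_rooted_laplacian r w : \sum_v w v != 0 ->
  \det (fmx (rooted_laplacian r w))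
  = #|[set f | arborescence r f]|%:R * \sum_v w v.
Proof.
move=> w0; rewrite (eq_fmx (rooted_laplacianE r w)).
rewrite (det_fmx_rowsum (choice_row r w)) -sum1_card natr_sum big_distrl /=.
rewrite [RHS]big_mkcond; apply: eq_bigr => f _; rewrite inE mul1r.
case: ifP => [|/negbT naf]; first exact: det_choice_arborescence.
have [vf|nvf] := boolP (valid_choice r f); last exact: det_choice_invalid.
exact: det_choice_cyclic.
Qed.

(** One matrix obtained in two ways. Adding all rows of the perturbed Laplacian to row [r] leaves
    the total of [u] times [w] there, since the columns of a Laplacian sum to zero. The same matrix
    comes from the rooted Laplacian by scaling its row [w] by the total of [u] and adding [u x]
    times that row to every other row [x]. *)
Lemma det_laplacian_rank1 r (u w : V -> F) :
  \sum_v w v != 0 ->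
  \det (fmx (fun x y => laplacian x y + u x * w y))
  = #|[set f | arborescence r f]|%:R * (\sum_v u v) * (\sum_v w v).
Proof.
move=> w0.
pose U := fmx (fun x y => (x == y)%:R + (x == r)%:R * (y != r)%:R : F).
pose P := fmx (fun x y => (x == y)%:R
   + (if x == r then \sum_v u v - 1 else u x) * (y == r)%:R : F).
have detU : \det U = 1.
  rewrite det_fmx_rank1; under eq_bigr => x _ do rewrite mulrC.
  by rewrite sum_delta eqxx addr0.
have detP : \det P = \sum_v u v.
  by rewrite det_fmx_rank1 sum_delta eqxx addrC subrK.
rewrite [RHS]mulrAC -(det_rooted_laplacian r w0) -detP.
transitivity (\det (U *m fmx (fun x y => laplacian x y + u x * w y))).
  by rewrite det_mulmx detU mul1r.
rewrite [RHS]mulrC -det_mulmx !fmx_mul; congr (\det _).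
apply: eq_fmx => x y.
under eq_bigr => z _ do rewrite mulrDl (eq_sym x).
under [RHS]eq_bigr => z _ do rewrite mulrDl (eq_sym x) -mulrA mulrCA.
rewrite !big_split /= !sum_delta /rooted_laplacian eqxx.
case: (eqVneq x r) => [->|xr]; last first.
  by rewrite big1 ?addr0 // => z _; rewrite mul0r mul0r.
transitivity ((\sum_v u v) * w y); last by rewrite mulrBl mul1r addrC subrK.
transitivity (\sum_z (laplacian z y + u z * w y)).
  rewrite [RHS](bigD1 r) //=; congr (_ + _); rewrite [RHS]big_mkcond /=.
  by apply: eq_bigr => z _; case: (z == r); rewrite /= mul1r ?mul0r ?mul1r.
rewrite big_split /= -mulr_suml.
by under eq_bigr => z _ do rewrite laplacian_sym; rewrite laplacian_row add0r.
Qed.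

End Laplacian.

Definition tree_of f : {set arc H} :=
  [set a | (f (src a) == Some a) || (f (tgt a) == Some (rev a))].

Lemma tgt_rev (a : arc H) : tgt (rev a) = src a.
Proof. by rewrite /tgt revK. Qed.

Lemma adjacent_sym (T : {set arc H}) : rev_closed T -> symmetric (adjacent_in T).
Proof.
move=> rT u v; apply/idP/idP => /existsP [a /and3P [aT /eqP <- /eqP <-]];
  by apply/existsP; exists (rev a); rewrite rT // tgt_rev !eqxx.
Qed.

Lemma adjacent_arc (T : {set arc H}) a : a \in T -> adjacent_in T (src a) (tgt a).
Proof. by move=> aT; apply/existsP; exists a; rewrite aT !eqxx. Qed.

Lemma path_arcs (T : {set arc H}) x p : path (adjacent_in T) x p ->
  exists s, [/\ {subset s <= T}, map (@src H) s = belast x p & map (@tgt H) s = p].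
Proof.
elim: p x => [|y p IH] x /=; first by exists [::].
case/andP => /existsP [a /and3P [aT /eqP ax /eqP ay]] /IH [s [sT s1 s2]].
exists (a :: s); split; rewrite /= ?ax ?ay ?s1 ?s2 // => b.
by rewrite inE => /orP [/eqP ->|/sT].
Qed.

Lemma path_arcs_cycle x p s a b :
  map (@src H) s = belast x p -> map (@tgt H) s = p ->
  tgt a = x -> src b = last x p ->
  path (fun a b => tgt a == src b) a (rcons s b).
Proof.
elim: p x s a => [|y p IH] x [|e s] a //=; first by move=> _ _ -> ->; rewrite eqxx.
move=> [ex es] [ey ep] -> bl; rewrite ex eqxx /=.
exact: (IH y).
Qed.

(** A path without repeated vertices repeats no arc. If it contained an arc and its reverse, each of
    the two positions would have to be the successor of the other. *)
Lemma closed_trail_of_path (T : {set arc H}) x p a :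
  rev_closed T -> path (adjacent_in T) x p -> uniq (x :: p) ->
  a \notin T -> tgt a = x -> src a = last x p ->
  exists s, closed_trail (a :: s) /\ {subset s <= T}.
Proof.
move=> rT /path_arcs [s [sT s1 s2]] up aT ax al; exists s; split => //.
have szs : size s = size p by rewrite -s2 size_map.
have ns : a \notin s by apply: contra aT; apply: sT.
have nra : rev a \notin s.
  by apply: contra aT => /sT /rT; rewrite revK.
have us : uniq s.
  apply: (@map_uniq _ _ (@src H)); rewrite s1.
  by move: up; rewrite lastI rcons_uniq => /andP [].
rewrite /closed_trail /= us ns (path_arcs_cycle s1 s2 ax al) /=.
rewrite inE negb_or rev_neq nra /=; apply/allP => e es.
rewrite inE negb_or; apply/andP; split.
  by apply: contra aT => /eqP <-; apply/rT/sT.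
apply/negP => res.
have hsrc i : (i < size p)%N -> src (nth a s i) = nth x (x :: p) i.
  move=> ip; rewrite -(nth_map _ x) ?szs // s1.
  by rewrite lastI nth_rcons size_belast ip.
have htgt i : (i < size p)%N -> tgt (nth a s i) = nth x (x :: p) i.+1.
  by move=> ip; rewrite -(nth_map _ x) ?szs // s2.
have hi : (index e s < size p)%N by rewrite -szs index_mem.
have hj : (index (rev e) s < size p)%N by rewrite -szs index_mem.
have := hsrc _ hi; have := htgt _ hi; have := hsrc _ hj; have := htgt _ hj.
rewrite !nth_index // tgt_rev => h1 h2 h3 h4.
have e1 : (index (rev e) s == (index e s).+1)%N.
  rewrite -(nth_uniq x _ _ up) /= ?ltnS //; last exact: ltnW.
  by rewrite -[nth _ _ (index (rev e) s)]h2 -[nth _ p _]h3.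
have e2 : ((index (rev e) s).+1 == index e s)%N.
  rewrite -(nth_uniq x _ _ up) /= ?ltnS //; last exact: ltnW.
  by rewrite -[nth _ _ (index e s)]h4 -[nth _ p _]h1.
by move: e2; rewrite (eqP e1) -[X in _ == X]addn0 -addn2 eqn_add2l.
Qed.

Section Fixed_root.
Variable r : V.

Lemma valid_choice_root f : valid_choice r f -> f r = None.
Proof. by move/forallP/(_ r); case: (f r) => // a; rewrite eqxx. Qed.

Lemma valid_choice_arc f v : valid_choice r f -> v != r ->
  exists2 a, f v = Some a & src a = v.
Proof.
move/forallP/(_ v); case: (f v) => [a /andP [_ /eqP av] _|/eqP ->].
  by exists a.
by rewrite eqxx.
Qed.

Lemma arborescence_depth f : arborescence r f ->
  exists d : V -> nat, forall v a, f v = Some a -> (d (tgt a) < d v)%N.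
Proof.
case/andP => vf /asboolP /iter_depth [d dP]; exists d => v a fv.
have := dP v; rewrite /step fv; apply.
by apply: contra_eq_neq fv => ->; rewrite valid_choice_root.
Qed.

Lemma tree_of_rev_closed f : rev_closed (tree_of f).
Proof. by move=> a; rewrite !inE tgt_rev revK orbC. Qed.

Lemma arborescence_spanning_tree f : arborescence r f -> spanning_tree (tree_of f).
Proof.
move=> af; have [d dP] := arborescence_depth af.
case/andP: (af) => vf /asboolP reach.
have cs : connect_sym (adjacent_in (tree_of f)).
  exact/sym_connect_sym/adjacent_sym/tree_of_rev_closed.
have tor v : connect (adjacent_in (tree_of f)) v r.
  have [k] := reach v; elim: k v => [|k IH] v; first by move=> /= ->.
  rewrite iterSr => /IH; apply: connect_trans.
  have [->|vr] := eqVneq v r; first by rewrite /step valid_choice_root.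
  have [a fa av] := valid_choice_arc vf vr.
  rewrite /step fa; apply: connect1; rewrite -{1}av; apply: adjacent_arc.
  by rewrite inE av fa eqxx.
split; first exact: tree_of_rev_closed.
  by move=> u v; apply: connect_trans (tor u) _; rewrite cs.
(* At an arc of the trail whose source has maximal depth, both the arc and the reverse of its
   predecessor must be the one arc chosen by that source, so the trail uses an edge twice. *)
move=> s /and4P [s0 cyc us /allP nrev] sub.
have [a0 a0s] : exists a, a \in s by case: (s) s0 => // a s' _; exists a; rewrite inE eqxx.
case: (@arg_maxnP _ a0 (fun a => a \in s) (fun a => d (src a)) a0s) => a as_ amax0.
have amax j : j \in s -> (d (src j) <= d (src a))%N by apply: amax0.
have /= n1 := next_cycle cyc as_; have /= p1 := prev_cycle cyc as_.
have := sub _ as_; rewrite inE => /orP [/eqP fa|/eqP fa]; last first.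
  have := dP _ _ fa; rewrite tgt_rev ltnNge (eqP n1).
  by rewrite amax // mem_next.
have := sub (prev s a); rewrite mem_prev => /(_ as_).
rewrite inE => /orP [/eqP fb|].
  by have := dP _ _ fb; rewrite (eqP p1) ltnNge amax // mem_prev.
rewrite (eqP p1) fa => /eqP [ab].
by have := nrev (prev s a); rewrite mem_prev as_ -ab as_ => /(_ isT).
Qed.

(** A disagreement travels to the root, where there is none. If [f] and [g] differ at [v], the arc
    [f v] can belong to the tree of [g] only as the reverse of the choice of [g] at its target, and
    [f] cannot make that choice because depth decreases. *)
Lemma tree_of_inj f g : arborescence r f -> arborescence r g ->
  tree_of f = tree_of g -> f = g.
Proof.
move=> af ag efg; have [d dP] := arborescence_depth af.
case/andP: (af) => vf /asboolP reach; case/andP: (ag) => vg _.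
have dis v : f v != g v -> f (step f v) != g (step f v).
  move=> nfg.
  have vr : v != r by apply: contraNneq nfg => ->; rewrite !valid_choice_root.
  have [a fa av] := valid_choice_arc vf vr.
  have : a \in tree_of g by rewrite -efg inE av fa eqxx.
  rewrite inE av; case/orP => /eqP ga; first by rewrite fa ga eqxx in nfg.
  rewrite /step fa ga; apply/eqP => fta.
  have := dP _ _ fta; rewrite tgt_rev av ltnNge.
  by rewrite ltnW // dP.
apply/ffunP => v; apply/eqP/negPn/negP => nfg.
have [k kr] := reach v.
have : f (iter k (step f) v) != g (iter k (step f) v).
  by elim: k {kr} => //= k; apply: dis.
by rewrite kr !valid_choice_root.
Qed.

(** Every vertex chooses an arc of [T] that shortens its distance to [r] inside [T]. *)
Lemma arborescence_sub (T : {set arc H}) : rev_closed T -> spanning_connected T ->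
  exists2 f, arborescence r f & tree_of f \subset T.
Proof.
move=> rT cT.
have ex v : exists k, `[< exists p, [/\ size p = k, path (adjacent_in T) v p & last v p = r] >].
  have /connectP [p pp lp] := cT v r.
  by exists (size p); apply/asboolP; exists p.
pose d v := ex_minn (ex v).
have ch v : exists o : option (arc H), if o is Some a then
    [/\ v != r, src a = v, a \in T & (d (tgt a) < d v)%N] else v = r.
  have [->|vr] := eqVneq v r; first by exists None.
  rewrite {2}/d; case: ex_minnP => m /asboolP [[|y p] [sz /= pp lp]] _.
    by rewrite lp eqxx in vr.
  case/andP: pp => /existsP [a /and3P [aT /eqP av /eqP ay]] pp.
  exists (Some a); split=> //; rewrite -sz ay /d; case: ex_minnP => k _ kmin.
  by rewrite ltnS kmin //; apply/asboolP; exists p.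
have [f0 f0P] := choice ch.
pose f : {ffun V -> option (arc H)} := [ffun v => f0 v].
exists f; last first.
  apply/fintype.subsetP => a; rewrite inE !ffunE => /orP [] /eqP e.
    by have := f0P (src a); rewrite e => -[].
  by have := f0P (tgt a); rewrite e => -[_ _ /rT]; rewrite revK.
apply/andP; split.
  apply/forallP => v; rewrite ffunE; have := f0P v.
  by case: (f0 v) => [a [-> -> _ _]|->]; rewrite ?eqxx.
apply/asboolP => v; have [n] := ubnP (d v); elim: n v => // n IH v dv.
have := f0P v; case e : (f0 v) => [a|]; last by exists 0%N.
case=> _ _ _ da; have [k kr] := IH (tgt a) (leq_trans da dv).
by exists k.+1; rewrite iterSr /step ffunE e.
Qed.

Lemma spanning_tree_arborescence (T : {set arc H}) : spanning_tree T ->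
  exists2 f, arborescence r f & tree_of f = T.
Proof.
move=> [rT cT aT]; have [f af sf] := arborescence_sub rT cT.
exists f => //; apply/eqP; rewrite finset.eqEsubset sf; apply/fintype.subsetP => a aTT.
apply/negPn/negP => naf.
have [rf cf _] := arborescence_spanning_tree af.
have /connectP [p0 pp0 lp0] := cf (tgt a) (src a).
case: (shortenP pp0) lp0 => p pp up _ lp.
have [s [cs ss]] := closed_trail_of_path rf pp up naf erefl lp.
apply: (aT _ cs) => b; rewrite inE => /orP [/eqP -> //|/ss].
by apply/fintype.subsetP.
Qed.

Lemma num_spanning_trees_arborescence :
  num_spanning_trees H = #|[set f | arborescence r f]|.
Proof.
have inj : {in [set f | arborescence r f] &, injective tree_of}.
  by move=> f g; rewrite !inE; apply: tree_of_inj.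
rewrite -(card_in_imset inj); apply: eq_card => T; rewrite inE.
apply/asboolP/imsetP => [/spanning_tree_arborescence [f af <-]|[f]].
  by exists f; rewrite ?inE.
by rewrite inE => /arborescence_spanning_tree ? ->.
Qed.

Lemma card_tree_of f : arborescence r f -> #|tree_of f| = (#|V|.-1).*2.
Proof.
move=> af; have [d dP] := arborescence_depth af; case/andP: (af) => vf _.
pose S := [set a | f (src a) == Some a]%SET.
have -> : tree_of f = S :|: @rev H @: S.
  apply/setP => a; rewrite !inE; congr (_ || _); apply/eqP/imsetP.
    by move=> h; exists (rev a); rewrite ?revK // inE h.
  by case=> b; rewrite inE => /eqP h ->; rewrite tgt_rev revK.
rewrite cardsU (card_imset _ (inv_inj (@revK H))).
have -> : S :&: @rev H @: S = finset.set0.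
  apply/setP => a; rewrite !inE; apply/negP => /andP [/eqP h /imsetP [b]].
  rewrite inE => /eqP hb ab; have := dP _ _ h; have := dP _ _ hb.
  by rewrite ab tgt_rev ltnNge => h1 h2; rewrite ltnW in h1.
rewrite cards0 subn0 addnn; congr _.*2.
have inj : {in S &, injective (@src H)}.
  by move=> a b; rewrite !inE => /eqP ha /eqP hb e; move: ha; rewrite e hb => -[].
rewrite -(card_in_imset inj).
have -> : (@src H @: S = [set~ r])%SET.
  apply/setP => v; rewrite !inE; apply/imsetP/idP => [[a]|vr].
    rewrite inE => /eqP ha ->; apply/eqP => e.
    by rewrite e valid_choice_root in ha.
  have [a fa av] := valid_choice_arc vf vr.
  by exists a; rewrite ?inE av ?fa.
by rewrite cardsC1.
Qed.

(** That all spanning trees have equally many arcs bounds the number of arcs exchanged between a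
    tree of a torus and one of its block. *)
Lemma card_spanning_tree (T : {set arc H}) : spanning_tree T ->
  #|T| = (#|V|.-1).*2.
Proof. by move/spanning_tree_arborescence => [f af <-]; apply: card_tree_of. Qed.

End Fixed_root.

(** Both weights stay free: constants are used for the medial and truncation relations, the
    indicator of one colour class for the hexagonal torus. *)
Theorem matrix_tree (F : numFieldType) (r : V) (u w : V -> F) :
  \sum_v w v != 0 ->
  \det (fmx (fun x y => laplacian F x y + u x * w y))
  = (num_spanning_trees H)%:R * (\sum_v u v) * (\sum_v w v).
Proof.
by move=> w0; rewrite (num_spanning_trees_arborescence r); apply: det_laplacian_rank1.
Qed.

Lemma path_connect (T : {set arc H}) (a b : arc H) s :
  path (fun a b => tgt a == src b) a (rcons s b) -> {subset s <= T} ->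
  connect (adjacent_in T) (tgt a) (src b).
Proof.
elim: s a => [|c s IH] a /=; first by rewrite andbT => /eqP ->.
case/andP => /eqP -> h sub; apply: connect_trans (IH _ h _); last first.
  by move=> x xs; apply: sub; rewrite inE xs orbT.
by apply/connect1/adjacent_arc/sub; rewrite inE eqxx.
Qed.

(** A largest acyclic set containing [A] is connected: otherwise some arc leaves the component of a
    vertex, and it can be added. *)
Lemma acyclic_extend (A : {set arc H}) : connected_graph H ->
  rev_closed A -> acyclic A -> exists2 T, spanning_tree T & A \subset T.
Proof.
move=> cH rA aA.
pose good (T : {set arc H}) := `[< [/\ A \subset T, rev_closed T & acyclic T] >].
have gA : good A by apply/asboolP.
case: (@arg_maxnP _ A good (fun T => #|T|) gA) => T /asboolP [AT rT aT] Tmax.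
have cs : connect_sym (adjacent_in T) by apply/sym_connect_sym/adjacent_sym.
exists T => //; split=> // u v; apply/negPn/negP => nuv.
have [a [pa npa]] : exists a, connect (adjacent_in T) u (src a) /\
    ~~ connect (adjacent_in T) u (tgt a).
  apply: contrapT => nex; move/negP: nuv; apply.
  have /connectP [p pp ->] := cH u v.
  suff gen x : path (adjacent_in [set: arc H]%SET) x p ->
    connect (adjacent_in T) u x -> connect (adjacent_in T) u (last x p) by exact: gen.
  elim: p {pp} x => //= y p IH x /andP [/existsP [a]].
  rewrite inE /= => /andP [/eqP ax /eqP ay] pp ux; apply: IH => //.
  apply/negPn/negP => uy; apply: nex; exists a.
  by rewrite ax ay.
have aT' : a \notin T.
  by apply: contra npa => /adjacent_arc /connect1; apply: connect_trans.
pose T' := a |: (rev a |: T).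
suff /Tmax : good T'.
  rewrite /= leqNgt => /negP; apply; apply: proper_card; apply/fintype.properP; split.
    by apply/fintype.subsetP => x xT; rewrite !inE xT !orbT.
  by exists a => //; rewrite !inE eqxx.
apply/asboolP; split.
- apply/fintype.subsetP => x /(fintype.subsetP AT) xT; by rewrite !inE xT !orbT.
- move=> x; rewrite !inE => /or3P [/eqP ->|/eqP ->|/rT ->].
  + by rewrite eqxx orbT.
  + by rewrite revK eqxx.
  + by rewrite !orbT.
move=> s /and4P [s0 cyc us /allP nrev] sub.
(* A trail through the new edge would join its two ends by arcs of [T], although they lie in
   different components. *)
have key b : b \in s -> (b == a) || (b == rev a) -> False.
  move=> bs bb; have [i s' es] := rot_to bs.
  have := cyc; rewrite -(rot_cycle i) es /= => /path_connect h.
  have us' : uniq (b :: s') by rewrite -es rot_uniq.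
  have ms x : x \in s' -> x \in s.
    by move=> xs; rewrite -(mem_rot i) es inE xs orbT.
  have nb : rev b \notin s by apply: nrev.
  have s'T : {subset s' <= T}.
    move=> x xs; have := sub _ (ms _ xs); rewrite !inE.
    have xb : x != b by apply: contraTneq xs => ->; case/andP: us'.
    have xrb : x != rev b by apply: contraNneq nb => <-; apply: ms.
    case/orP: bb => /eqP eb; move: xb xrb; rewrite eb ?revK => /negbTE -> /negbTE -> //.
  have {h} := h _ s'T.
  case/orP: bb => /eqP ->; rewrite ?tgt_rev -?/(tgt a) => h; case/negP: npa.
    by apply: (connect_trans pa); rewrite cs.
  exact: (connect_trans pa).
apply: (aT s); first by apply/and4P; split=> //; apply/allP.
move=> x xs; have := sub _ xs; rewrite !inE => /or3P [xa|xa|//];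
  by case: (key x xs); rewrite xa ?orbT.
Qed.

End Arborescences.

(** * Blocks and tori *)

(** A set with at most [b] elements is the set of proper entries of a [b]-tuple of options, padded
    with [None]. *)
Lemma card_small_sets (T : finType) (b : nat) :
  (#|[set D : {set T} | (#|D| <= b)%N]| <= #|T|.+1 ^ b)%N.
Proof.
pose g (t : b.-tuple (option T)) := [set a | Some a \in (t : seq _)]%SET.
have -> : (#|T|.+1 ^ b)%N = #|{: b.-tuple (option T)}|.
  by rewrite card_tuple card_option.
apply: leq_trans (leq_imset_card g _); apply/subset_leq_card/fintype.subsetP => D.
rewrite inE => Db; apply/imsetP.
pose s := map Some (enum D) ++ nseq (b - #|D|) None.
have sb : size s == b by rewrite size_cat size_map size_nseq -cardE subnKC.
exists (Tuple sb) => //; apply/setP => a; rewrite inE /= mem_cat mem_nseq andbF orbF.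
by rewrite mem_map ?mem_enum // => x y [].
Qed.

Section Submultigraph.
Variables (H' H : multigraph) (g : vertex H' -> vertex H) (phi : arc H' -> arc H).
Hypothesis g_bij : bijective g.
Hypothesis phi_inj : injective phi.
Hypothesis phi_src : forall a, src (phi a) = g (src a).
Hypothesis phi_rev : forall a, phi (rev a) = rev (phi a).

Lemma phi_tgt a : tgt (phi a) = g (tgt a).
Proof. by rewrite /tgt -phi_rev phi_src. Qed.

Lemma closed_trail_map s : closed_trail (map phi s) = closed_trail s.
Proof.
rewrite /closed_trail; congr [&& _, _, _ & _].
- by case: s.
- case: s => //= a s; rewrite -map_rcons path_map.
  by apply: eq_path => x y /=; rewrite phi_tgt phi_src (bij_eq g_bij).
- exact: map_inj_uniq.
- by rewrite all_map; apply: eq_all => a /=; rewrite -phi_rev mem_map.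
Qed.

Lemma acyclic_preim (T : {set arc H}) : acyclic T -> acyclic (phi @^-1: T).
Proof.
move=> aT s cs sub; apply: (aT (map phi s)); first by rewrite closed_trail_map.
by move=> _ /mapP [a /sub aT' ->]; rewrite inE in aT'.
Qed.

Lemma connect_phi (T : {set arc H'}) u v : connect (adjacent_in T) u v ->
  connect (adjacent_in (phi @: T)) (g u) (g v).
Proof.
case/connectP => p pp ->; elim: p u pp => //= w p IH u.
case/andP => /existsP [a /and3P [aT /eqP <- /eqP <-]] /IH.
apply: connect_trans; rewrite -phi_src -phi_tgt.
by apply/connect1/adjacent_arc/imset_f.
Qed.

Lemma spanning_tree_phi (T : {set arc H'}) :
  spanning_tree T -> spanning_tree (phi @: T).
Proof.
move=> [rT cT aT]; split.
- by move=> _ /imsetP [a /rT aT' ->]; rewrite -phi_rev imset_f.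
- case: g_bij => g' gK g'K u v; rewrite -(g'K u) -(g'K v).
  exact/connect_phi/cT.
- move=> s cs sub.
  have [s' es] : exists s', s = map phi s'.
    elim: s sub {cs} => [|a s IH] sub; first by exists [::].
    have /imsetP [b _ ab] := sub a (mem_head _ _).
    have [x xs|s' ->] := IH; first by apply: sub; rewrite inE xs orbT.
    by exists (b :: s'); rewrite ab.
  apply: (aT s'); first by rewrite -closed_trail_map -es.
  move=> a as'; have := sub (phi a); rewrite es mem_map // => /(_ as').
  by rewrite mem_imset.
Qed.

Lemma num_spanning_trees_sub : (num_spanning_trees H' <= num_spanning_trees H)%N.
Proof.
rewrite /num_spanning_trees -(card_imset _ (imset_inj phi_inj)); apply/subset_leq_card/fintype.subsetP.
move=> _ /imsetP [T /asboolP sT ->]; apply/asboolP; exact: spanning_tree_phi.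
Qed.

Hypothesis cH' : connected_graph H'.

(** The restriction of a tree [T] to the subgraph is acyclic and extends to a spanning tree [E T].
    [T] is recovered from its arcs outside the subgraph, from [E T], and from the arcs added by the
    extension. The last two sets differ from [T] by equally many arcs, because all spanning trees
    have the same size; hence at most [b] arcs were added. *)
Lemma num_spanning_trees_sup (r : vertex H') (b : nat) :
  (#|~: (phi @: [set: arc H'])%SET| <= b)%N ->
  (num_spanning_trees H <= num_spanning_trees H' * (2 * #|arc H'|.+1) ^ b)%N.
Proof.
move=> hb.
have ext (T : {set arc H}) : exists T' : {set arc H'},
    spanning_tree T -> spanning_tree T' /\ phi @^-1: T \subset T'.
  have [[rT cT aT]|nT] := pselect (spanning_tree T); last by exists finset.set0.
  have [|T' sT' sub] := acyclic_extend cH' _ (acyclic_preim aT).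
    by move=> a; rewrite !inE phi_rev; apply: rT.
  by exists T'.
have [E EP] := choice ext.
pose im := (phi @: [set: arc H'])%SET.
pose h (T : {set arc H}) := (T :\: im, E T, E T :\: phi @^-1: T).
have hinj : {in [pred T | `[< spanning_tree T >]] &, injective h}.
  move=> T1 T2 /asboolP s1 /asboolP s2 [e1 e2 e3].
  have key T : spanning_tree T -> T = (T :\: im) :|: phi @: (E T :\: (E T :\: phi @^-1: T)).
    move=> /EP [_ sub].
    have -> : E T :\: (E T :\: phi @^-1: T) = phi @^-1: T.
      by rewrite finset.setDDr finset.setDv finset.set0U; apply/finset.setIidPr.
    apply/setP => a; rewrite !inE; have [/imsetP [x _ ->]|ni] /= := boolP (a \in im).
      by rewrite mem_imset // inE.
    case: (a \in T) => //=; apply/esym/negbTE; apply: contra ni => /imsetP [x _ ->].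
    exact: imset_f.
  by rewrite (key _ s1) (key _ s2) e1 e3 e2.
rewrite /num_spanning_trees -(card_in_imset hinj).
pose target := finset.setX (finset.setX (powerset (~: im)) [set T : {set arc H'} | `[< spanning_tree T >]])
  [set D : {set arc H'} | (#|D| <= b)%N]%SET.
apply: (@leq_trans #|target|).
  apply/subset_leq_card/fintype.subsetP => _ /imsetP [T /asboolP sT ->].
  have [sE sub] := EP _ sT.
  rewrite !inE /= -andbA; apply/and3P; split.
  - by rewrite finset.setDE finset.subsetIr.
  - exact/asboolP.
  - have cA : #|phi @^-1: T| = #|T :&: im|.
      rewrite -(card_imset _ phi_inj); congr #|pred_of_set _|.
      apply/setP => a; rewrite !inE; apply/imsetP/andP => [[x]|[aT /imsetP [x _ ax]]].
        by rewrite inE => xT ->; rewrite xT imset_f.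
      by exists x; rewrite ?inE -?ax.
    have cV : #|vertex H'| = #|vertex H| by apply: bij_eq_card g_bij.
    rewrite cardsD (finset.setIidPr sub) cA.
    rewrite (card_spanning_tree r sE) cV -(card_spanning_tree (g r) sT).
    rewrite -(cardsID im T) addKn; apply: leq_trans hb.
    by apply/subset_leq_card; rewrite finset.setDE finset.subsetIr.
rewrite !cardsX card_powerset.
have -> : #|[set T : {set arc H'} | `[< spanning_tree T >]]%SET|
   = #|[pred T : {set arc H'} | `[< spanning_tree T >]]|.
  by apply: eq_card => T; rewrite !inE.
rewrite expnMn mulnA leq_mul ?card_small_sets //.
by rewrite [X in (_ <= X)%N]mulnC leq_mul // leq_exp2l.
Qed.

End Submultigraph.

Lemma num_spanning_trees_gt0 (H : multigraph) :
  connected_graph H -> (0 < num_spanning_trees H)%N.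
Proof.
move=> cH; have [||T sT _] := @acyclic_extend H finset.set0 cH.
- by move=> a; rewrite inE.
- by move=> [|a s] // _ /(_ a (mem_head _ _)); rewrite inE.
by apply/card_gt0P; exists T; apply/asboolP.
Qed.

(** * Tori and the blocks inside them *)

Section Torus.

Definition residue (m : nat) (z : int) : 'I_m.+1 := (Zp1 : 'I_m.+1) *~ z.

Lemma residueD m : {morph @residue m : x y / x + y}.
Proof. by move=> x y; rewrite /residue mulrzDr. Qed.

Lemma residueN m : {morph @residue m : x / - x}.
Proof. by move=> x; rewrite /residue mulrNz. Qed.

Lemma residue_ord m (i : 'I_m.+1) : residue m (Posz i) = i.
Proof.
rewrite /residue -pmulrn Zp_mulrn; apply: val_inj => /=.
by rewrite modnMml mul1n modn_small.
Qed.

Definition cell_residue (m : nat) (z : int * int) : cell m.+1 :=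
  (residue m z.1, residue m z.2).

Lemma cell_residueD m x y : cell_residue m (x + y) = cell_residue m x + cell_residue m y.
Proof. by rewrite /cell_residue !residueD. Qed.

Lemma cell_residueN m x : cell_residue m (- x) = - cell_residue m x.
Proof. by rewrite /cell_residue !residueN. Qed.

Lemma cell_residue0 m : cell_residue m 0 = 0.
Proof. by []. Qed.

Lemma cell_residue_vec m (p : cell m.+1) : cell_residue m (vec p) = p.
Proof. by case: p => i j; rewrite /cell_residue /vec !residue_ord. Qed.

Variables (G : periodic_map) (c : dart G -> int * int) (m : nat).

Definition torus_arc := (dart G * cell m.+1)%type.

(* The arc (d, x) is the class modulo m + 1 of the translate of d by x, so its
   source lies in the copy x + c d of the fundamental domain. *)
Definition torus_src (a : torus_arc) : block_vertex G m.+1 :=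
  (Sub (porbit (node G) a.1) (porbit_vertices _), a.2 + cell_residue m (c a.1)).

Definition torus_rev (a : torus_arc) : torus_arc :=
  (edge G a.1, a.2 + cell_residue m (edge_shift a.1)).

Lemma torus_revK : involutive torus_rev.
Proof.
by case=> d x; rewrite /torus_rev /= edgeK edge_shiftN cell_residueN addrK.
Qed.

Lemma torus_rev_neq a : torus_rev a != a.
Proof. by case: a => d x; rewrite xpair_eqE negb_and edge_neq. Qed.

Definition torus_graph : multigraph :=
  Multigraph torus_src torus_revK torus_rev_neq.

(** A block arc records the copy of its source, a torus arc the translate of the dart; the two
    differ by [c]. *)
Definition block_to_torus (a : block_arc c m.+1) : torus_arc :=
  ((val a).1.1, (val a).1.2 - cell_residue m (c (val a).1.1)).

Lemma vec_inj n : injective (@vec n).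
Proof.
by move=> [i j] [i' j'] [] /val_inj -> /val_inj ->.
Qed.

Lemma block_to_torus_inj : injective block_to_torus.
Proof.
move=> [[[d p] q] h] [[[d' p'] q'] h'] e.
have /= e1 := congr1 fst e; subst d'.
have /addIr /= e2 := congr1 snd e; subst p'.
apply: val_inj => /=; congr (_, _); apply: vec_inj.
by have /eqP /= -> := h; have /eqP /= -> := h'.
Qed.

Lemma block_to_torus_src a : torus_src (block_to_torus a) = block_src a.
Proof. by rewrite /torus_src /block_to_torus /block_src /= subrK. Qed.

Lemma block_to_torus_rev a :
  block_to_torus (block_rev a) = torus_rev (block_to_torus a).
Proof.
case: a => [[[d p] q] h]; rewrite /block_to_torus /block_rev /torus_rev /=.
congr (_, _); move: (h); rewrite /in_block /= => /eqP /(congr1 (cell_residue m)).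
rewrite cell_residueD !cell_residue_vec => ->.
rewrite /displacement !cell_residueD cell_residueN !addrA [LHS]addrAC addrK.
by rewrite addrAC.
Qed.

(** The number of arcs cut by the boundary of a block, per unit of side length. *)
Definition boundary_constant : nat :=
  \sum_(d : dart G) (absz (displacement c d).1 + absz (displacement c d).2).

Lemma card_shift_out (u : int) :
  (#|[pred i : 'I_m.+1 | ~~ ((0 <= Posz i + u) && (Posz i + u < Posz m.+1))%R]|
    <= absz u)%N.
Proof.
pose g (k : 'I_(absz u)) : 'I_m.+1 := inord (if (0 <= u)%R then m - k else k)%N.
rewrite -[X in (_ <= X)%N]card_ord; apply: leq_trans (leq_imset_card g _).
apply/subset_leq_card/fintype.subsetP => i; rewrite inE => hi; apply/imsetP.
have im := ltn_ord i.
have hk : ((if (0 <= u)%R then m - i else i) < absz u)%N by move: hi; case: ifP; lia.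
exists (Ordinal hk) => //; apply: ord_inj; rewrite /g /=.
by move: hi hk; case: ifP => hu hi hk; rewrite inordK //; lia.
Qed.

(** A torus arc is missed only if its displacement leaves the square. For a given dart this confines
    the source to at most as many lines in each direction as the displacement is long, of [m.+1]
    cells each. *)
Lemma card_boundary :
  (#|~: (block_to_torus @: [set: block_arc c m.+1])%SET| <= boundary_constant * m.+1)%N.
Proof.
pose out (u : int) (i : 'I_m.+1) := ~~ ((0 <= Posz i + u) && (Posz i + u < Posz m.+1))%R.
pose pos (a : torus_arc) := a.2 + cell_residue m (c a.1).
pose bad (a : torus_arc) := out (displacement c a.1).1 (pos a).1
   || out (displacement c a.1).2 (pos a).2.
apply: (@leq_trans #|[pred a | bad a]|).
  apply/subset_leq_card/fintype.subsetP => -[d x]; rewrite inE => h.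
  rewrite inE; apply: contraR h; rewrite negb_or !negbK.
  set p := pos (d, x) => /andP [/andP [h1 h2] /andP [h3 h4]].
  have k1 : (absz (Posz p.1 + (displacement c d).1)%R < m.+1)%N by move: h1 h2 => /=; lia.
  have k2 : (absz (Posz p.2 + (displacement c d).2)%R < m.+1)%N by move: h3 h4 => /=; lia.
  pose q : cell m.+1 := (Ordinal k1, Ordinal k2).
  have hb : in_block c (d, p, q).
    by rewrite /in_block /vec /= !gez0_abs //; apply/eqP; congr (_, _).
  apply/imsetP; exists (Sub (d, p, q) hb); rewrite ?inE // /block_to_torus /=.
  by rewrite /p /pos /= addrK.
have -> : #|[pred a | bad a]| = (\sum_(d : dart G) #|[pred x | bad (d, x)]|)%N.
  rewrite -sum1_card; under [RHS]eq_bigr => d _ do rewrite -sum1_card.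
  by rewrite pair_big_dep /=; apply: eq_bigl => -[].
rewrite /boundary_constant big_distrl /=; apply: leq_sum => d _.
set u := displacement c d.
have cardP (P : pred 'I_m.+1) (k : nat) : (#|P| <= k)%N ->
    (#|[pred p : cell m.+1 | P p.1]| <= k * m.+1)%N
    /\ (#|[pred p : cell m.+1 | P p.2]| <= k * m.+1)%N.
  move=> hk; split.
    have -> : #|[pred p : cell m.+1 | P p.1]| = #|[predX P & 'I_m.+1]|.
      by apply: eq_card => -[i j]; rewrite !inE andbT.
    by rewrite cardX card_ord leq_mul.
  have -> : #|[pred p : cell m.+1 | P p.2]| = #|[predX 'I_m.+1 & P]|.
    by apply: eq_card => -[i j]; rewrite !inE.
  by rewrite cardX card_ord mulnC leq_mul.
have [h1 _] := cardP _ _ (card_shift_out u.1).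
have [_ h2] := cardP _ _ (card_shift_out u.2).
rewrite mulnDl; apply: leq_trans (leq_add h1 h2).
rewrite -cardUI; apply: leq_trans (leq_addr _ _).
pose t (x : cell m.+1) := x + cell_residue m (c d).
have t_inj : injective t by move=> x y /addIr.
rewrite -(fintype.card_image t_inj).
apply/subset_leq_card/fintype.subsetP => y; case/fintype.imageP => x hx ->.
by move: hx; rewrite !inE.
Qed.

Lemma torus_le_block : connected_graph (block_graph c m.+1) -> (0 < #|dart G|)%N ->
  (num_spanning_trees torus_graph <=
   num_spanning_trees (block_graph c m.+1)
   * (2 * #|arc (block_graph c m.+1)|.+1) ^ (boundary_constant * m.+1))%N.
Proof.
move=> cB /card_gt0P [d _].
apply: (@num_spanning_trees_sup (block_graph c m.+1) torus_graph id block_to_torus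
  _ block_to_torus_inj block_to_torus_src block_to_torus_rev cB).
- by exists id.
- exact: (torus_src (d, 0)).
- exact: card_boundary.
Qed.

Lemma block_le_torus :
  (num_spanning_trees (block_graph c m.+1) <= num_spanning_trees torus_graph)%N.
Proof.
apply: (@num_spanning_trees_sub (block_graph c m.+1) torus_graph id block_to_torus
  _ block_to_torus_inj block_to_torus_src block_to_torus_rev).
by exists id.
Qed.

Lemma card_block_arc : (#|arc (block_graph c m.+1)| <= #|dart G| * m.+1 ^ 2)%N.
Proof.
apply: leq_trans (leq_card _ block_to_torus_inj) _.
by rewrite !card_prod !card_ord.
Qed.

Lemma card_block_vertex : #|vertex (block_graph c m.+1)| = (#|vertices G| * m.+1 ^ 2)%N.
Proof. by rewrite !card_prod !card_ord card_sig. Qed.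

End Torus.

(** * Medial graphs and truncations *)

Section RegularDeterminants.
Variable F : numFieldType.

(** The sizes of the two matrices are equal but not convertible, so conjugation by a permutation
    matrix is replaced by [det_1subC] for the rectangular matrices [P] and [Q]. *)
Lemma det_fmx_bij (U W : finType) (h : U -> W) (f : W -> W -> F) : bijective h ->
  \det (fmx (fun x y => f (h x) (h y))) = \det (fmx f).
Proof.
move=> bh; have [h' hK h'K] := bh.
pose P := fmx (fun (x : U) (w : W) => (w == h x)%:R : F).
pose Q := fmx (fun (w : W) (x : U) => (w == h x)%:R : F).
have PFQ (g : W -> W -> F) : P *m fmx g *m Q = fmx (fun x y => g (h x) (h y)).
  rewrite !fmx_mul; apply: eq_fmx => x y.
  under eq_bigr => w _ do rewrite sum_delta mulrC.
  by rewrite sum_delta.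
have PQ : P *m Q = 1%:M.
  rewrite fmx_mul -fmx1; apply: eq_fmx => x y.
  by rewrite sum_delta (bij_eq bh).
have QP : Q *m P = 1%:M.
  rewrite fmx_mul -fmx1; apply: eq_fmx => v w.
  under eq_bigr => x _ do rewrite -[v == _](can2_eq h'K hK) [h' v == _]eq_sym.
  by rewrite sum_delta h'K eq_sym.
rewrite -PFQ.
have -> : P *m fmx f *m Q = 1%:M - P *m ((1%:M - fmx f) *m Q).
  by rewrite mulmxBl mulmxBr mul1mx PQ mulmxA subKr.
by rewrite det_1subC -mulmxA QP mulmx1 subKr.
Qed.

(** Constant row sums give J = a^-2 B J B^T, which absorbs the rank one term into a product to which
    [det_1subC] applies. On the other side J B^T B = a b J gives it back with the factor b / a. *)
Lemma det_sub_gram p q (B : 'M[F]_(p, q)) (a b c t : F) :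
  c != 0 -> a != 0 ->
  B *m (const_mx 1 : 'cV_q) = const_mx a -> (const_mx 1 : 'rV_p) *m B = const_mx b ->
  c ^+ q * \det (c%:M - B *m B^T + t *: const_mx 1)
  = c ^+ p * \det (c%:M - B^T *m B + (t * b / a) *: const_mx 1).
Proof.
move=> c0 a0 hr hc.
have Jpq m n : const_mx 1 = (const_mx 1 : 'cV[F]_m) *m (const_mx 1 : 'rV[F]_n).
  by apply/matrixP => i j; rewrite !mxE big_ord_recl big_ord0 !mxE mulr1 addr0.
have colE : (const_mx 1 : 'cV[F]_p) = a^-1 *: (B *m const_mx 1).
  by rewrite hr; apply/matrixP => i j; rewrite !mxE mulVf.
have rowE : (const_mx 1 : 'rV[F]_p) = a^-1 *: (const_mx 1 *m B^T).
  by rewrite -[LHS]trmx_const colE linearZ /= trmx_mul trmx_const.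
have rowB : (const_mx 1 : 'rV[F]_q) *m B^T = const_mx a.
  by rewrite -[const_mx 1]trmx_const -trmx_mul hr trmx_const.
have JBB : (const_mx 1 : 'M[F]_q) *m (B^T *m B) = (a * b) *: const_mx 1.
  rewrite Jpq -!mulmxA (mulmxA _ B^T) rowB.
  have -> : (const_mx a : 'rV[F]_p) = a *: const_mx 1.
    by apply/matrixP => i j; rewrite !mxE mulr1.
  rewrite -scalemxAl hc.
  have -> : (const_mx b : 'rV[F]_q) = b *: const_mx 1.
    by apply/matrixP => i j; rewrite !mxE mulr1.
  by rewrite scalerA -scalemxAr.
pose C : 'M[F]_(q, p) := c^-1 *: ((1%:M - (t / a ^+ 2) *: const_mx 1) *m B^T).
have -> : c%:M - B *m B^T + t *: const_mx 1 = c *: (1%:M - B *m C).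
  rewrite /C -scalemxAr scalerBr scalerA divff // scale1r scale_scalar_mx mulr1.
  rewrite -addrA; congr (_ + _).
  rewrite mulmxBl mul1mx mulmxBr opprB addrC; congr (_ - _).
  rewrite -scalemxAl -scalemxAr (Jpq p p) colE rowE -scalemxAl -scalemxAr scalerA.
  rewrite !mulmxA -(mulmxA B) -Jpq scalerA; congr (_ *: _).
  by rewrite expr2 invfM mulrA.
rewrite detZ det_1subC mulrCA; congr (_ * _).
rewrite -detZ; congr (\det _).
rewrite /C -scalemxAl scalerBr scalerA divff // scale1r scale_scalar_mx mulr1.
rewrite -addrA; congr (_ + _).
rewrite -mulmxA mulmxBl mul1mx opprB addrC; congr (_ - _).
rewrite -scalemxAl JBB scalerA; congr (_ *: _).
by field.
Qed.

Lemma det_laplacian_ones (H : multigraph) (t : F) : (0 < #|vertex H|)%N ->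
  \det (fmx (laplacian F : vertex H -> _) + t *: const_mx 1)
  = t * (num_spanning_trees H)%:R * #|vertex H|%:R ^+ 2.
Proof.
move=> V0; have /card_gt0P [r _] := V0.
have n0 : \sum_(v : vertex H) (1 : F) != 0.
  by rewrite sumr_const pnatr_eq0 -lt0n.
have := @matrix_tree H F r (fun=> t) (fun=> 1) n0.
rewrite !sumr_const -[t *+ _]mulr_natr => e.
have -> : fmx (laplacian F : vertex H -> _) + t *: const_mx 1
  = fmx (fun x y : vertex H => laplacian F x y + t * 1).
  by apply/matrixP => i j; rewrite !mxE.
by rewrite e; ring.
Qed.

End RegularDeterminants.

(** The rotation system of a cubic graph: the arcs leaving a vertex form one cycle of length
    three. *)
Definition cubic_rotation (H : multigraph) (nu : arc H -> arc H) : Prop :=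
  [/\ forall a, nu (nu (nu a)) = a,
      forall a, nu a != a,
      forall a b, (src b == src a) = [|| b == a, b == nu a | b == nu (nu a)]
    & forall v : vertex H, exists a, src a = v].

Section Cubic.
Variables (H : multigraph) (nu : arc H -> arc H).
Hypothesis nuP : cubic_rotation nu.
Variable F : numFieldType.

Lemma nuK a : nu (nu (nu a)) = a. Proof. by case: nuP. Qed.

Lemma nu_bij : bijective nu.
Proof. by exists (fun a => nu (nu a)) => a; rewrite nuK. Qed.

Lemma same_source a b : (src b == src a)%:R
  = (b == a)%:R + (b == nu a)%:R + (b == nu (nu a))%:R :> F.
Proof.
case: nuP => _ ne -> _.
have n2 : nu (nu a) != a.
  by apply: contra (ne a) => /eqP e; rewrite -{1}e nuK.
have [->|ba] := eqVneq b a.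
  by rewrite eq_sym (negbTE (ne a)) eq_sym (negbTE n2) !addr0.
have [->|bn] := eqVneq b (nu a); last by rewrite !add0r.
by rewrite eq_sym (negbTE (ne _)) addr0 add0r.
Qed.

Lemma sum_delta_r (T : finType) (g : T -> F) (x : T) :
  \sum_y g y * (y == x)%:R = g x.
Proof. by under eq_bigr => y _ do rewrite mulrC; apply: sum_delta. Qed.

Lemma sum_same_source a (g : arc H -> F) :
  \sum_b (src b == src a)%:R * g b = g a + g (nu a) + g (nu (nu a)).
Proof.
under eq_bigr => b _ do rewrite same_source !mulrDl.
by rewrite !big_split /= !sum_delta.
Qed.

Lemma cubic_degree (v : vertex H) : \sum_(b : arc H) (src b == v)%:R = 3 :> F.
Proof.
have [_ _ _ /(_ v) [a <-]] := nuP.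
transitivity (\sum_b (src b == src a)%:R * (1 : F)).
  by apply: eq_bigr => b _; rewrite mulr1.
by rewrite (sum_same_source a (fun=> 1)); ring.
Qed.

Lemma cubic_card : #|arc H| = (3 * #|vertex H|)%N.
Proof.
apply/eqP; rewrite -(eqr_nat F) natrM -!sum1_card !natr_sum /= mulr_sumr.
under [X in _ == X]eq_bigr => v _ do rewrite mulr1 -(cubic_degree v).
rewrite exchange_big /=; apply/eqP; apply: eq_bigr => a _.
by rewrite sum_delta1.
Qed.

Lemma laplacianE (K : multigraph) (u v : vertex K) : laplacian F u v =
  \sum_(a : arc K) (src a == u)%:R * ((u == v)%:R - (tgt a == v)%:R).
Proof.
rewrite /laplacian big_mkcond; apply: eq_bigr => a _.
by case: (src a == u); rewrite ?mul1r ?mul0r.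
Qed.

Lemma cubic_laplacian (u v : vertex H) : laplacian F u v =
  3 * (u == v)%:R - \sum_(a : arc H) (src a == u)%:R * (tgt a == v)%:R.
Proof.
rewrite laplacianE; under eq_bigr => a _ do rewrite mulrBr.
by rewrite sumrB -mulr_suml cubic_degree.
Qed.

Section MedialRelation.
Variables (H' : multigraph) (phi : arc H * bool -> arc H').
Hypothesis phi_bij : bijective phi.
Hypothesis phi_rev : forall a b, rev (phi (a, b)) = phi (a, ~~ b).
Let mu a := src (phi (a, false)).
Hypothesis src_phi : forall a, src (phi (a, true)) = mu (nu a).
Hypothesis muE : forall a b, (mu b == mu a) = (b == a) || (b == rev a).
Hypothesis mu_surj : forall x, exists a, mu a = x.

Lemma same_mu a b : (mu b == mu a)%:R = (b == a)%:R + (b == rev a)%:R :> F.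
Proof.
rewrite muE; have [->|_] := eqVneq b a; last by rewrite add0r.
by rewrite eq_sym (negbTE (rev_neq a)) addr0.
Qed.

Lemma mu_degree x : \sum_b (mu b == x)%:R = 2 :> F.
Proof.
have [a <-] := mu_surj x; under eq_bigr => b _ do rewrite same_mu.
rewrite big_split /=; under eq_bigr => b _ do rewrite eq_sym.
by rewrite sum_delta1; under eq_bigr => b _ do rewrite eq_sym; rewrite sum_delta1; ring.
Qed.

Lemma medial_card : (2 * #|vertex H'|)%N = (3 * #|vertex H|)%N.
Proof.
rewrite -cubic_card; apply/eqP; rewrite -(eqr_nat F) natrM -!sum1_card !natr_sum /=.
rewrite mulr_sumr; under [X in X == _]eq_bigr => v _ do rewrite mulr1 -(mu_degree v).
by rewrite exchange_big /=; apply/eqP; apply: eq_bigr => a _; rewrite sum_delta1.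
Qed.

(** The vertex-edge incidence matrix. Counting arcs instead of edges gives a loop the entry 2, so
    the Gram identities hold for multigraphs. *)
Let B := fmx (fun (v : vertex H) (x : vertex H') =>
  \sum_(a : arc H) (src a == v)%:R * (mu a == x)%:R : F).

Lemma medial_laplacian x y : laplacian F x y = 4 * (x == y)%:R
  - \sum_a (mu a == x)%:R * (mu (nu a) == y)%:R
  - \sum_a (mu (nu a) == x)%:R * (mu a == y)%:R.
Proof.
rewrite laplacianE (reindex phi) /=; last exact: onW_bij.
transitivity (\sum_a \sum_b (src (phi (a, b)) == x)%:R
    * ((x == y)%:R - (src (phi (a, ~~ b)) == y)%:R) : F).
  by rewrite pair_big; apply: eq_bigr => -[a b] _; rewrite /tgt phi_rev.
under [LHS]eq_bigr => a _ do rewrite big_bool /= !src_phi -!/(mu _) !mulrBr addrC.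
rewrite big_split !sumrB /= -!mulr_suml mu_degree.
rewrite [X in _ + (X * _ - _)](_ : _ = 2); last first.
  by rewrite -(mu_degree x) [RHS](reindex nu) //; apply/onW_bij/nu_bij.
by ring.
Qed.

(** An entry of B^T B counts pairs of arcs with a common source: equal arcs give twice the identity,
    consecutive ones the adjacency of the medial graph. *)
Lemma medial_gram : fmx (laplacian F : vertex H' -> _) = 6%:M - B^T *m B.
Proof.
have -> : B^T = fmx (fun (x : vertex H') (v : vertex H) =>
  \sum_(a : arc H) (src a == v)%:R * (mu a == x)%:R : F).
  by apply/matrixP => i j; rewrite !mxE.
rewrite fmx_mul; apply/matrixP => i j; rewrite !mxE.
rewrite medial_laplacian -(inj_eq enum_val_inj).
set x := enum_val i; set y := enum_val j.
have -> : \sum_v (\sum_(a : arc H) (src a == v)%:R * (mu a == x)%:R) *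
   (\sum_(a : arc H) (src a == v)%:R * (mu a == y)%:R)
   = \sum_a (mu a == x)%:R * ((mu a == y)%:R + (mu (nu a) == y)%:R + (mu (nu (nu a)) == y)%:R) :> F.
  under eq_bigr => v _ do rewrite big_distrl /=.
  rewrite exchange_big /=; apply: eq_bigr => a _.
  rewrite -(sum_same_source a (fun b => (mu b == y)%:R)).
  under eq_bigr => v _ do rewrite -mulrA (eq_sym (src a)).
  by rewrite sum_delta; congr (_ * _).
under [X in _ = _ - X]eq_bigr => a _ do rewrite !mulrDr.
rewrite !big_split /=.
have -> : \sum_a (mu a == x)%:R * (mu a == y)%:R = 2 * (x == y)%:R :> F.
  rewrite -(mu_degree x) mulr_suml; apply: eq_bigr => a _.
  by case: (eqVneq (mu a) x) => [->|]; rewrite ?mul1r ?mul0r.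
have -> : \sum_a (mu a == x)%:R * (mu (nu (nu a)) == y)%:R
   = \sum_a (mu (nu a) == x)%:R * (mu a == y)%:R :> F.
  rewrite (reindex nu) /=; last by apply/onW_bij/nu_bij.
  by apply: eq_bigr => a _; rewrite nuK.
by rewrite -[_ *+ (_ == _)]mulr_natr; ring.
Qed.

(** An entry of B B^T counts pairs of arcs on a common edge: equal arcs give three times the
    identity, opposite ones the adjacency. *)
Lemma cubic_gram : fmx (laplacian F : vertex H -> _) = 6%:M - B *m B^T.
Proof.
have -> : B^T = fmx (fun (x : vertex H') (v : vertex H) =>
  \sum_(a : arc H) (src a == v)%:R * (mu a == x)%:R : F).
  by apply/matrixP => i j; rewrite !mxE.
rewrite fmx_mul; apply/matrixP => i j; rewrite !mxE.
rewrite cubic_laplacian -(inj_eq enum_val_inj).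
set x := enum_val i; set y := enum_val j.
have -> : \sum_v (\sum_(a : arc H) (src a == x)%:R * (mu a == v)%:R) *
   (\sum_(a : arc H) (src a == y)%:R * (mu a == v)%:R)
   = \sum_(a : arc H) (src a == x)%:R * ((src a == y)%:R + (tgt a == y)%:R) :> F.
  under eq_bigr => v _ do rewrite big_distrl /=.
  rewrite exchange_big /=; apply: eq_bigr => a _.
  under eq_bigr => v _ do rewrite -mulrA (eq_sym (mu a)).
  rewrite -mulr_sumr sum_delta; congr (_ * _).
  under eq_bigr => b _ do rewrite same_mu mulrDr.
  by rewrite big_split /= !sum_delta_r.
under [X in _ = _ - X]eq_bigr => a _ do rewrite mulrDr.
rewrite big_split /=.
have -> : \sum_(a : arc H) (src a == x)%:R * (src a == y)%:R = 3 * (x == y)%:R :> F.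
  rewrite -(cubic_degree x) mulr_suml; apply: eq_bigr => a _.
  by case: (eqVneq (src a) x) => [->|]; rewrite ?mul1r ?mul0r.
by rewrite -[_ *+ (_ == _)]mulr_natr; ring.
Qed.

Lemma sum_enum_val (U : finType) (g : U -> F) : \sum_(i < #|U|) g (enum_val i) = \sum_u g u.
Proof.
rewrite [RHS](reindex (@enum_val U U)) //=.
by exists enum_rank => y _; [exact: enum_valK | exact: enum_rankK].
Qed.

Lemma medial_tree_count : (0 < #|vertex H|)%N ->
  6 ^+ #|vertex H'| * (num_spanning_trees H)%:R * 2
  = 6 ^+ #|vertex H| * (num_spanning_trees H')%:R * 3 :> F.
Proof.
move=> V0; have /card_gt0P [r _] := V0; have [a0 _] := let: And4 _ _ _ h := nuP in h r.
have V'0 : (0 < #|vertex H'|)%N by apply/card_gt0P; exists (mu a0).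
have h1 : B *m (const_mx 1 : 'cV_#|vertex H'|) = const_mx 3.
  apply/matrixP => i j; rewrite !mxE.
  under eq_bigr => k _ do rewrite !mxE mulr1.
  rewrite (sum_enum_val (fun x => \sum_(a : arc H) (src a == enum_val i)%:R * (mu a == x)%:R)).
  rewrite exchange_big /= -(cubic_degree (enum_val i)); apply: eq_bigr => a _.
  by rewrite -mulr_sumr sum_delta1 mulr1.
have h2 : (const_mx 1 : 'rV_#|vertex H|) *m B = const_mx 2.
  apply/matrixP => i j; rewrite !mxE.
  under eq_bigr => k _ do rewrite !mxE mul1r.
  rewrite (sum_enum_val (fun v => \sum_(a : arc H) (src a == v)%:R * (mu a == enum_val j)%:R)).
  rewrite exchange_big /= -(mu_degree (enum_val j)); apply: eq_bigr => a _.
  by rewrite -mulr_suml sum_delta1 mul1r.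
have n6 : 6 != 0 :> F by rewrite pnatr_eq0.
have n3 : 3 != 0 :> F by rewrite pnatr_eq0.
(* Rows of [B] sum to 3 and columns to 2, so the perturbation 3 on the vertices becomes 2 on the
   edges. *)
have := det_sub_gram 3 n6 n3 h1 h2.
rewrite -cubic_gram -medial_gram.
rewrite !det_laplacian_ones // => e.
have cV : 2 * #|vertex H'|%:R = 3 * #|vertex H|%:R :> F.
  by rewrite -!natrM medial_card.
have cV' : #|vertex H'|%:R = 3 / 2 * #|vertex H|%:R :> F.
  by rewrite mulrAC -cV mulrAC divff ?mul1r // pnatr_eq0.
have nz : 3 / 2 * #|vertex H|%:R ^+ 2 != 0 :> F.
  by rewrite !mulf_neq0 ?invr_eq0 ?expf_eq0 ?pnatr_eq0 -?lt0n.
apply: (mulfI nz); move: e; rewrite cV' => e.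
transitivity (6 ^+ #|vertex H'| * (3 * (num_spanning_trees H)%:R * #|vertex H|%:R ^+ 2) : F).
  by field.
by rewrite e; field.
Qed.

End MedialRelation.

Section TruncationRelation.
Variables (K : multigraph) (phi : arc H * 'I_3 -> arc K) (sigma : arc H -> vertex K).
Hypothesis phi_bij : bijective phi.
Hypothesis sigma_bij : bijective sigma.
Hypothesis phi_src : forall a k, src (phi (a, k)) = sigma a.
Hypothesis phi_tgt : forall a k, tgt (phi (a, k))
  = sigma (match val k with 0%N => rev a | 1%N => nu a | _ => nu (nu a) end).

Lemma truncation_laplacian a b : laplacian F (sigma a) (sigma b) =
  3 * (a == b)%:R - (rev a == b)%:R - (nu a == b)%:R - (nu (nu a) == b)%:R.
Proof.
rewrite laplacianE (reindex phi) /=; last exact: onW_bij.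
transitivity (\sum_(a' : arc H) \sum_(k < 3) (src (phi (a', k)) == sigma a)%:R
    * ((sigma a == sigma b)%:R - (tgt (phi (a', k)) == sigma b)%:R) : F).
  by rewrite pair_big; apply: eq_bigr => -[].
under eq_bigr => a' _ do under eq_bigr => k _ do
  rewrite phi_src phi_tgt !(bij_eq sigma_bij).
under eq_bigr => a' _ do rewrite -mulr_sumr.
rewrite sum_delta !big_ord_recl big_ord0 /=; ring.
Qed.

Let E := fmx (fun a b : arc H => (rev a == b)%:R : F).

Lemma reversal_mul : E *m E = 1%:M.
Proof.
rewrite fmx_mul -fmx1; apply: eq_fmx => a b.
under eq_bigr => c _ do rewrite eq_sym.
by rewrite sum_delta revK.
Qed.

(** An orientation of the edges gives a diagonal sign matrix that conjugates E to -E. Hence the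
    square is the determinant of (4 - E)(4 + E) = 15. Only the square is computed, which is why the
    relation between tree counts is quadratic. *)
Lemma det_reversal : \det (4%:M - E) ^+ 2 = 15 ^+ #|arc H|.
Proof.
pose s (a : arc H) : F := if (enum_rank a < enum_rank (rev a))%N then 1 else -1.
have sV a : s (rev a) = - s a.
  rewrite /s revK; case: (ltngtP (enum_rank a) (enum_rank (rev a))) => //.
    by rewrite opprK.
  by move/ord_inj/enum_rank_inj/eqP; rewrite eq_sym (negbTE (rev_neq a)).
have s2 a : s a * s a = 1 by rewrite /s; case: ifP; rewrite ?mulr1 ?mulrNN ?mulr1.
pose D := fmx (fun a b : arc H => (a == b)%:R * s a : F).
have DD : D *m D = 1%:M.
  rewrite fmx_mul -fmx1; apply: eq_fmx => a b.
  under eq_bigr => c _ do rewrite -mulrA eq_sym.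
  rewrite sum_delta; have [->|] := eqVneq a b; first by rewrite mul1r s2.
  by rewrite mul0r mulr0.
have DED : D *m E *m D = - E.
  rewrite !fmx_mul fmxN; apply: eq_fmx => a b.
  under eq_bigr => c _ do under eq_bigr => d _ do rewrite -mulrA eq_sym.
  under eq_bigr => c _ do rewrite sum_delta -mulrA eq_sym mulrCA.
  rewrite sum_delta; have [_|_] := eqVneq (rev a) b; last by rewrite mul0r mulr0 oppr0.
  by rewrite mul1r sV mulrN s2.
have e1 : D *m (4%:M - E) *m D = 4%:M + E.
  by rewrite mulmxBr mulmxBl DED opprK scalar_mxC -mulmxA DD mulmx1.
have e2 : (4%:M - E) *m (4%:M + E) = 15%:M.
  rewrite mulmxDr !mulmxBl reversal_mul -!scalar_mxM.
  rewrite [E *m _]scalar_mxC addrA subrK -raddfB /=; congr (_%:M); ring.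
have dD : \det D * \det D = 1 by rewrite -det_mulmx DD det1.
rewrite expr2.
have {2}-> : \det (4%:M - E) = \det (4%:M + E).
  by rewrite -e1 !det_mulmx mulrAC dD mul1r.
by rewrite -det_mulmx e2 det_scalar.
Qed.

Let N := fmx (fun (v : vertex H) (a : arc H) => (src a == v)%:R : F).

(** N^T N is the same-source relation, that is the identity plus the triangle adjacency. Every arc
    has one source, so N^T J N is again all ones and the perturbation fits into the same product. *)
Lemma truncation_matrix (t : F) : fmx (fun a b => laplacian F (sigma a) (sigma b) + t)
  = 4%:M - E - N^T *m ((1%:M - t *: const_mx 1) *m N).
Proof.
have NT : N^T = fmx (fun (a : arc H) (v : vertex H) => (src a == v)%:R : F).
  by apply/matrixP => i j; rewrite !mxE.
have -> : (const_mx 1 : 'M[F]_#|vertex H|) = fmx (fun _ _ : vertex H => 1).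
  by apply/matrixP => i j; rewrite !mxE.
rewrite NT mulmxBl mul1mx -scalemxAl !fmx_mul mulmxBr -scalemxAr !fmx_mul.
apply/matrixP => i j; rewrite !mxE truncation_laplacian -(inj_eq enum_val_inj).
set a := enum_val i; set b := enum_val j.
have -> : \sum_(w : vertex H) (src a == w)%:R * (src b == w)%:R
    = (b == a)%:R + (b == nu a)%:R + (b == nu (nu a))%:R :> F.
  under eq_bigr => w _ do rewrite eq_sym.
  by rewrite sum_delta same_source.
have -> : \sum_(w : vertex H) (src a == w)%:R * (\sum_(x : vertex H) 1 * (src b == x)%:R) = 1 :> F.
  under eq_bigr => w _ do under eq_bigr => x _ do rewrite mul1r.
  by under eq_bigr => w _ do rewrite sum_delta1 mulr1; rewrite sum_delta1.
rewrite (eq_sym b) (eq_sym b) (eq_sym b) -[_ *+ (_ == _)]mulr_natr; ring.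
Qed.

(** The inverse of 4 - E is (4 + E) / 15, and N (4 + E) N^T = 15 - L. After [det_1subC], J L = 0
    turns 1 - (1 - J)(15 - L) / 15 into (L + 15 J) / 15, which the matrix-tree theorem evaluates. *)
Lemma truncation_tree_count : (0 < #|vertex H|)%N ->
  9 * (num_spanning_trees K)%:R ^+ 2
  = 25 * 15 ^+ #|vertex H| * (num_spanning_trees H)%:R ^+ 2 :> F.
Proof.
move=> V0; have /card_gt0P [r _] := V0.
have [a0 _] : exists a, src a = r by case: nuP.
have cK : #|vertex K| = #|arc H| by rewrite (bij_eq_card sigma_bij).
have K0 : (0 < #|vertex K|)%N by rewrite cK; apply/card_gt0P; exists a0.
have n15 : 15 != 0 :> F by rewrite pnatr_eq0.
have := det_laplacian_ones (1 : F) K0.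
have -> : fmx (laplacian F : vertex K -> _) + 1 *: const_mx 1
  = fmx (fun x y : vertex K => laplacian F x y + 1).
  by apply/matrixP => i j; rewrite !mxE mulr1.
rewrite -(det_fmx_bij (fun x y => laplacian F x y + 1) sigma_bij) truncation_matrix.
rewrite scale1r cK.
set J := const_mx 1; set L := fmx (laplacian F : vertex H -> _).
have e2 : (4%:M - E) *m (4%:M + E) = 15%:M.
  rewrite mulmxDr !mulmxBl reversal_mul -!scalar_mxM.
  rewrite [E *m _]scalar_mxC addrA subrK -raddfB /=; congr (_%:M); ring.
have NEN : N *m (4%:M + E) *m N^T = 15%:M - L.
  have NT : N^T = fmx (fun (a : arc H) (v : vertex H) => (src a == v)%:R : F).
    by apply/matrixP => i j; rewrite !mxE.
  rewrite mulmxDr mulmxDl scalar_mxC mul_scalar_mx -scalemxAl NT !fmx_mul.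
  apply/matrixP => i j; rewrite !mxE cubic_laplacian -(inj_eq enum_val_inj).
  set u := enum_val i; set v := enum_val j.
  have -> : \sum_(a : arc H) (src a == u)%:R * (src a == v)%:R = 3 * (u == v)%:R :> F.
    rewrite -(cubic_degree u) mulr_suml; apply: eq_bigr => a _.
    by case: (eqVneq (src a) u) => [->|]; rewrite ?mul1r ?mul0r.
  have -> : \sum_b (\sum_a (src a == u)%:R * (rev a == b)%:R) * (src b == v)%:R
    = \sum_(a : arc H) (src a == u)%:R * (tgt a == v)%:R :> F.
    under eq_bigr => b _ do rewrite mulr_suml.
    rewrite exchange_big /=; apply: eq_bigr => a _.
    under eq_bigr => b _ do rewrite -mulrA (eq_sym (rev a)).
    by rewrite -mulr_sumr sum_delta.
  by rewrite -[_ *+ (_ == _)]mulr_natr; ring.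
have JL : J *m L = 0.
  apply/matrixP => i j; rewrite !mxE.
  under eq_bigr => k _ do rewrite !mxE mul1r laplacian_sym.
  rewrite (sum_enum_val (fun x : vertex H => laplacian F (enum_val j) x)).
  exact: laplacian_row.
have -> : 4%:M - E - N^T *m ((1%:M - J) *m N)
   = (4%:M - E) *m (1%:M - (15^-1 *: ((4%:M + E) *m N^T)) *m ((1%:M - J) *m N)).
  rewrite mulmxBr mulmx1; congr (_ - _).
  rewrite -scalemxAl -scalemxAr !mulmxA e2 mul_scalar_mx -!scalemxAl scalerA.
  by rewrite mulVf // scale1r.
rewrite det_mulmx det_1subC -mulmxA -scalemxAr (mulmxA N) NEN.
have -> : 1%:M - (1%:M - J) *m (15^-1 *: (15%:M - L)) = 15^-1 *: (L + 15 *: J).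
  rewrite -scalemxAr mulmxBl mul1mx mulmxBr JL subr0 mul_mx_scalar.
  rewrite -[X in X - _ = _](scalerK n15) -scalerBr; congr (_ *: _).
  by rewrite scale_scalar_mx mulr1 opprB addrC opprB addrA subrK addrC.
rewrite detZ det_laplacian_ones // => e.
have := congr1 (fun x => x ^+ 2) e; rewrite [LHS]exprMn det_reversal cubic_card.
rewrite natrM exprVn => {}e.
have nV : #|vertex H|%:R != 0 :> F by rewrite pnatr_eq0 -lt0n.
have n15V : 15 ^+ #|vertex H| != 0 :> F by rewrite expf_eq0 (negbTE n15) andbF.
have nz : 9 * #|vertex H|%:R ^+ 4 != 0 :> F.
  by rewrite mulf_neq0 ?expf_eq0 ?(negbTE nV) ?andbF // pnatr_eq0.
apply: (mulfI nz).
transitivity ((1 * (num_spanning_trees K)%:R * (3 * #|vertex H|%:R) ^+ 2) ^+ 2 : F).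
  ring.
by rewrite -e mulnC exprM; field.
Qed.

End TruncationRelation.
End Cubic.

Definition cubic_map (G : periodic_map) : Prop :=
  forall d : dart G, node G (node G (node G d)) = d /\ node G d != d.

Lemma bijective_of_inj_surj (T U : Type) (f : T -> U) :
  injective f -> (forall y, exists x, f x = y) -> bijective f.
Proof.
move=> f_inj f_surj; have [g gK] := choice f_surj.
by exists g => // x; apply: f_inj.
Qed.

Lemma porbit_eq_sym (T : finType) (s : {perm T}) x y :
  (porbit s y == porbit s x) = (y \in porbit s x).
Proof. by rewrite eq_porbit_mem porbit_sym. Qed.

Lemma porbit_closed (T : finType) (s : {perm T}) (A : pred T) x y :
  (forall z, A z -> A (s z)) -> A x -> y \in porbit s x -> A y.
Proof.
move=> As Ax /porbitP [k ->]; rewrite permX.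
by elim: k => //= k; apply: As.
Qed.

Lemma mem_porbit1 (T : finType) (s : {perm T}) x : s x \in porbit s x.
Proof. by have := mem_porbit s 1 x; rewrite expg1. Qed.

Lemma porbit_step (T : finType) (s : {perm T}) x : porbit s (s x) = porbit s x.
Proof. by apply/eqP; rewrite porbit_eq_sym mem_porbit1. Qed.

Lemma cubic_porbit (G : periodic_map) (d d' : dart G) : cubic_map G ->
  (porbit (node G) d' == porbit (node G) d)
  = [|| d' == d, d' == node G d | d' == node G (node G d)].
Proof.
move=> cG; rewrite porbit_eq_sym; apply/idP/idP.
  apply: (@porbit_closed _ _ (fun z => [|| z == d, z == node G d | z == node G (node G d)])).
    by move=> z /or3P [] /eqP ->; rewrite ?(cG d).1 eqxx ?orbT.
  by rewrite eqxx.
by case/or3P => /eqP ->; rewrite -porbit_eq_sym ?porbit_step eqxx.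
Qed.

Section TorusRotation.
Variables (G : periodic_map) (c : dart G -> int * int) (m : nat).
Hypothesis cG : cubic_map G.
Hypothesis fc : fundamental_domain c.

Definition torus_rotation (a : arc (torus_graph c m)) : arc (torus_graph c m) :=
  (node G a.1, a.2 + cell_residue m (node_shift a.1)).

Lemma node_shift_domain d : node_shift d = c d - c (node G d).
Proof. by rewrite {1}(fc d) addrK. Qed.

Lemma torus_vertexP (v : block_vertex G m.+1) :
  exists d p, v = (Sub (porbit (node G) d) (porbit_vertices d), p).
Proof.
case: v => [[P hP] p]; case/imsetP: (hP) => d _ e; exists d, p.
by congr (_, _); apply: val_inj.
Qed.

Lemma torus_src_surj (v : vertex (torus_graph c m)) : exists a : arc (torus_graph c m), src a = v.
Proof.
have [d [p ->]] := torus_vertexP v.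
by exists (d, p - cell_residue m (c d)); rewrite /= /torus_src /= subrK.
Qed.

Lemma torus_srcE (a b : torus_arc G m) :
  (torus_src c a == torus_src c b) = (porbit (node G) a.1 == porbit (node G) b.1)
   && (a.2 + cell_residue m (c a.1) == b.2 + cell_residue m (c b.1)).
Proof. by rewrite /torus_src xpair_eqE -val_eqE. Qed.

Lemma torus_arc_eq (a b : arc (torus_graph c m)) :
  (a == b) = (a.1 == b.1) && (a.2 == b.2).
Proof. by case: a b => d x [d' x']. Qed.

(** On a fundamental domain [node_shift] is a coboundary of [c], so the shifts around a vertex add
    up to zero and the rotation closes after three steps. *)
Lemma torus_cubic : cubic_rotation torus_rotation.
Proof.
split; last exact: torus_src_surj.
- case=> d x; rewrite /torus_rotation /= (cG d).1; congr (_, _).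
  rewrite -!addrA -!cell_residueD !node_shift_domain (cG d).1.
  have -> : c d - c (node G d) + (c (node G d) - c (node G (node G d))
    + (c (node G (node G d)) - c d)) = 0 by rewrite !subrKA subrr.
  by rewrite addr0.
- by case=> d x; rewrite torus_arc_eq negb_and (cG d).2.
- case=> d x [d' x']; rewrite [LHS]torus_srcE /= cubic_porbit // !torus_arc_eq /=.
  have [->|_] /= := eqVneq d' d.
    rewrite (inj_eq (addIr _)) [d == node G d]eq_sym (negbTE (cG d).2) /=.
    case: (d =P node G (node G d)) => [e|_]; last by rewrite orbF.
    have := (cG d).2; rewrite -{2}(cG d).1 -e.
    by rewrite eqxx.
  have [->|_] /= := eqVneq d' (node G d).
    rewrite [node G d == _]eq_sym (negbTE (cG _).2) orbF node_shift_domain cell_residueD cell_residueN.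
    by rewrite addrA [RHS]eq_sym subr_eq eq_sym.
  have [->|//] := eqVneq d' (node G (node G d)).
  rewrite !node_shift_domain -addrA -cell_residueD subrKA.
  by rewrite cell_residueD cell_residueN addrA [X in _ = _ && X]eq_sym subr_eq eq_sym.
Qed.

End TorusRotation.

Lemma medial_nodeF (G : periodic_map) (d : dart G) :
  node (medial G) (d, false) = ((node G)^-1%g d, true).
Proof. by rewrite [LHS]permE. Qed.

Lemma medial_nodeT (G : periodic_map) (d : dart G) :
  node (medial G) (d, true) = (edge G (node G d), false).
Proof. by rewrite [LHS]permE. Qed.

Lemma truncation_nodeE (G : periodic_map) (d : dart G) k :
  node (truncation G) (d, k) = (d, ordS k).
Proof. by rewrite [LHS]permE. Qed.

Section TorusMedial.
Variables (G : periodic_map) (c : dart G -> int * int) (m : nat).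
Variable c' : dart (medial G) -> int * int.
Hypothesis cG : cubic_map G.
Hypothesis fc : fundamental_domain c.
Hypothesis fc' : fundamental_domain c'.

Definition medial_torus_arc (a : arc (torus_graph c m) * bool) :
  arc (torus_graph c' m) := ((a.1.1, a.2), a.1.2).

Lemma medial_torus_arc_bij : bijective medial_torus_arc.
Proof.
by exists (fun a : arc (torus_graph c' m) => ((a.1.1, a.2), a.1.2) : arc (torus_graph c m) * bool)
  => [[[d x] b]|[[d b] x]].
Qed.

(** Two rotation steps at a midpoint lead from [d] to [edge G d], and the shifts along the way
    reduce to that of the edge. *)
Lemma medial_domain_edge (d : dart G) :
  c' (d, false) = edge_shift d + c' (edge G d, false).
Proof.
have := fc' (d, false); have := fc' ((node G)^-1%g d, true).
rewrite medial_nodeF medial_nodeT permKV => ->.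
move=> ->.
rewrite -[X in X + _ = _]/(node_shiftV d) -[X in _ + (X + _) = _]/(_ + _).
by rewrite /medial_node_shift /= /node_shiftV permKV !addrA addNr add0r.
Qed.

Lemma medial_domain_node (d : dart G) :
  c' (node G d, false) = - node_shift d + c' (d, true).
Proof.
have := fc' (node G d, false).
by rewrite medial_nodeF permK /= /medial_node_shift /= /node_shiftV permK.
Qed.

Lemma medial_porbit (d d' : dart G) :
  (porbit (medial_node G) (d', false) == porbit (medial_node G) (d, false))
  = (d' == d) || (d' == edge G d).
Proof.
have step2 e : medial_node G (medial_node G (e, false)) = (edge G e, false).
  by rewrite !permE /medial_node_fun /= permKV.
rewrite porbit_eq_sym; apply/idP/idP.
  pose A (z : medial_dart G) := if z.2 then (node G z.1 == d) || (node G z.1 == edge G d)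
     else (z.1 == d) || (z.1 == edge G d).
  apply: (@porbit_closed _ _ A); last by rewrite /A /= eqxx.
  case=> e [|]; rewrite /A /= permE /medial_node_fun /=.
    by case/orP => /eqP ->; rewrite ?edgeK eqxx ?orbT.
  by rewrite permKV.
case/orP => /eqP ->; rewrite -porbit_eq_sym //.
by rewrite -step2 !porbit_step.
Qed.

Lemma medial_torus_count : (0 < #|vertex (torus_graph c m)|)%N ->
  forall F : numFieldType,
  6 ^+ #|vertex (torus_graph c' m)| * (num_spanning_trees (torus_graph c m))%:R * 2
  = 6 ^+ #|vertex (torus_graph c m)| * (num_spanning_trees (torus_graph c' m))%:R * 3 :> F.
Proof.
move=> V0 F; apply: (medial_tree_count (torus_cubic m cG fc) F medial_torus_arc_bij) => //.
- case=> d x b; rewrite /= /torus_rev /medial_torus_arc /= permE /medial_edge_fun /=.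
  by rewrite cell_residue0 addr0.
- case=> d x; apply/eqP; rewrite [_ == _]torus_srcE /=; apply/andP; split.
    rewrite -[(d, true)](_ : medial_node G (node G d, false) = _) ?porbit_step //.
    by rewrite permE /medial_node_fun /= permK.
  rewrite medial_domain_node cell_residueD cell_residueN addrA.
  by rewrite addrK.
- case=> d x [d' x']; rewrite [LHS]torus_srcE /= medial_porbit !(torus_arc_eq (c := c)) /=.
  have [->|_] /= := eqVneq d' d.
    by rewrite (inj_eq (addIr _)) [d == _]eq_sym (negbTE (edge_neq d)) orbF.
  have [->|//] /= := eqVneq d' (edge G d).
  by rewrite (medial_domain_edge d) cell_residueD addrA (inj_eq (addIr _)).
- move=> v; have [[[d b] x] <-] := torus_src_surj v.
  case: b; last by exists (d, x).
  exists (node G d, x + cell_residue m (node_shift d)); apply/eqP.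
  rewrite [_ == _]torus_srcE /=; apply/andP; split.
    rewrite -[(d, true)](_ : medial_node G (node G d, false) = _) ?porbit_step //.
    by rewrite permE /medial_node_fun /= permK.
  rewrite medial_domain_node cell_residueD cell_residueN addrA.
  by rewrite addrK.
Qed.

End TorusMedial.

Section TorusTruncation.
Variables (G : periodic_map) (c : dart G -> int * int) (m : nat).
Variable c' : dart (truncation G) -> int * int.
Hypothesis cG : cubic_map G.
Hypothesis fc : fundamental_domain c.
Hypothesis fc' : fundamental_domain c'.

Definition trunc_torus_arc (a : arc (torus_graph c m) * 'I_3) :
  arc (torus_graph c' m) := ((a.1.1, a.2), a.1.2).

Lemma trunc_torus_arc_bij : bijective trunc_torus_arc.
Proof.
by exists (fun a : arc (torus_graph c' m) => ((a.1.1, a.2), a.1.2) : arc (torus_graph c m) * 'I_3)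
  => [[[d x] b]|[[d b] x]].
Qed.

Definition trunc_torus_vertex (a : arc (torus_graph c m)) : vertex (torus_graph c' m) :=
  torus_src c' ((a.1, ord0), a.2).

Lemma trunc_porbit (a b : trunc_dart G) :
  (porbit (trunc_node G) b == porbit (trunc_node G) a) = (b.1 == a.1).
Proof.
rewrite porbit_eq_sym; apply/idP/eqP.
  move=> h; apply/eqP; move: h.
  by apply: (@porbit_closed _ _ (fun z => z.1 == a.1)) => // z; rewrite permE.
case: a b => d k [d' k'] /= ->.
have s1 j : trunc_node G (d, j) = (d, ordS j) by rewrite permE.
have h j : (d, j) \in porbit (trunc_node G) (d, ord0).
  case: j => [[|[|[|j]]] hj] //.
  - by rewrite (_ : Ordinal hj = ord0) ?porbit_id //; apply: val_inj.
  - rewrite (_ : Ordinal hj = ordS ord0) -?s1 ?mem_porbit1 //; exact: val_inj.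
  - rewrite (_ : Ordinal hj = ordS (ordS ord0)) -?s1 -?porbit_eq_sym ?porbit_step //.
    exact: val_inj.
have := h k'; have := h k; rewrite -!porbit_eq_sym => /eqP -> /eqP ->.
by rewrite eqxx.
Qed.

Lemma trunc_domain (d : dart G) k : c' (d, k) = c' (d, ord0).
Proof.
have s1 j : c' (d, j) = c' (d, ordS j).
  by have := fc' (d, j); rewrite truncation_nodeE add0r.
case: k => [[|[|[|k]]] hk] //.
- by congr c'; congr (_, _); apply: val_inj.
- by rewrite [RHS]s1; congr c'; congr (_, _); apply: val_inj.
- by rewrite [RHS]s1 [RHS]s1; congr c'; congr (_, _); apply: val_inj.
Qed.

Lemma trunc_torus_srcE (a b : torus_arc (truncation G) m) :
  (torus_src c' a == torus_src c' b) = (a.1.1 == b.1.1) && (a.2 == b.2).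
Proof.
rewrite [LHS]torus_srcE trunc_porbit; case: a b => [[d k] x] [[d' k'] x'] /=.
have [->|//] := eqVneq d d'; rewrite !(trunc_domain d').
by rewrite (inj_eq (addIr _)).
Qed.

Lemma trunc_torus_count : (0 < #|vertex (torus_graph c m)|)%N ->
  forall F : numFieldType,
  9 * (num_spanning_trees (torus_graph c' m))%:R ^+ 2
  = 25 * 15 ^+ #|vertex (torus_graph c m)| * (num_spanning_trees (torus_graph c m))%:R ^+ 2 :> F.
Proof.
move=> V0 F.
apply: (truncation_tree_count (torus_cubic m cG fc) F trunc_torus_arc_bij
  (sigma := trunc_torus_vertex)) => //.
- apply: bijective_of_inj_surj => [[d x] [d' x'] /eqP|v].
    by rewrite [_ == _]trunc_torus_srcE /= => /andP [/eqP -> /eqP ->].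
  have [[[d k] x] <-] := torus_src_surj v; exists (d, x); apply/eqP.
  by rewrite [_ == _]trunc_torus_srcE /= !eqxx.
- case=> d x k; apply/eqP; by rewrite [_ == _]trunc_torus_srcE /= !eqxx.
- case=> d x k; apply/eqP.
  rewrite [_ == _]trunc_torus_srcE /= permE.
  case: k => [[|[|[|k]]] hk] //=; rewrite ?eqxx //.
  have nV : (node G)^-1%g d = node G (node G d).
    by apply: (@perm_inj _ (node G)); rewrite permKV (cG d).1.
  rewrite nV eqxx /= -addrA -cell_residueD /node_shiftV nV.
  rewrite !(node_shift_domain fc) (cG d).1; apply/eqP; congr (_ + cell_residue _ _).
  by rewrite opprB addrA subrK.
Qed.

End TorusTruncation.

(** * Fundamental domains *)

Section BlockVertices.
Variables (G : periodic_map) (c : dart G -> int * int) (m : nat).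

Definition block_at (d : dart G) (p : cell m) : vertex (block_graph c m) :=
  (Sub (porbit (node G) d) (porbit_vertices d), p).

Lemma block_atP (v : vertex (block_graph c m)) : exists d p, v = block_at d p.
Proof.
case: v => [[P hP] p]; case/imsetP: (hP) => d _ e; exists d, p.
by congr (_, _); apply: val_inj.
Qed.

Lemma block_at_eq d d' p : d' \in porbit (node G) d -> block_at d' p = block_at d p.
Proof.
rewrite -porbit_eq_sym => /eqP e; congr (_, _); exact: val_inj.
Qed.

Lemma block_adjacent d p q : vec q = vec p + displacement c d ->
  connect (adjacent_in [set: arc (block_graph c m)]%SET) (block_at d p) (block_at (edge G d) q).
Proof.
move=> e; have h : in_block c (d, p, q) by apply/eqP.
apply: connect1; apply/existsP; exists (Sub (d, p, q) h : block_arc c m).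
rewrite finset.in_setT /=; apply/andP; split; apply/eqP; congr (_, _); exact: val_inj.
Qed.

Lemma block_connect_sym : connect_sym (adjacent_in [set: arc (block_graph c m)]%SET).
Proof. by apply/sym_connect_sym/adjacent_sym => a _; rewrite finset.in_setT. Qed.

End BlockVertices.

(** The new vertices inherit the copy of the old vertex, so triangle sides have displacement zero
    and old edges keep theirs. A walk in the old block lifts by moving around a triangle between
    consecutive edges. *)
Lemma truncation_admissible (G : periodic_map) (c : dart G -> int * int) :
  admissible_domain c ->
  admissible_domain ((fun a => c a.1) : dart (truncation G) -> int * int).
Proof.
move=> [fc cc]; set c' := fun _ => _.
split; first by case=> d k; rewrite truncation_nodeE /= add0r.
move=> m m0; have cB := cc m m0.
pose W d (p : cell m) := block_at c' (d, ord0) p.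
have WE d k p : block_at c' (d, k) p = W d p.
  by apply: block_at_eq; rewrite -porbit_eq_sym trunc_porbit.
set R := connect (adjacent_in [set: arc (block_graph c' m)]%SET).
have Wnode d p : R (W d p) (W (node G d) p).
  rewrite -(WE d (inord 1)) -(WE _ (inord 2)).
  have -> : (node G d, inord 2) = edge (truncation G) (d, inord 1).
    by rewrite [RHS]permE /trunc_edge_fun /= inordK.
  apply: block_adjacent; rewrite /displacement [edge _ _]permE /= inordK //=.
  by rewrite /c' /= -fc subrr addr0.
have Worb d p d' : d' \in porbit (node G) d -> R (W d p) (W d' p).
  apply: (@porbit_closed _ _ (fun z => R (W d p) (W z p))) => [z Rz|]; last exact: connect0.
  exact: connect_trans Rz (Wnode _ _).
have Wedge d p q : vec q = vec p + displacement c d -> R (W d p) (W (edge G d) q).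
  move=> e; rewrite -(WE d (inord 0)) -(WE _ (inord 0)).
  have -> : (edge G d, inord 0) = edge (truncation G) (d, inord 0).
    by rewrite [RHS]permE /trunc_edge_fun /= inordK.
  apply: block_adjacent; rewrite e /displacement [edge (truncation _) _]permE /= inordK //=.
move=> u v; have [[d k] [p ->]] := block_atP u; have [[d' k'] [p' ->]] := block_atP v.
rewrite !WE -/R.
have /connectP [s] := cB (block_at c d p) (block_at c d' p').
move: d p {k}; elim: s => [|w s IH] d p /=.
  move=> _ /eqP; rewrite xpair_eqE -val_eqE /= porbit_eq_sym => /andP [h /eqP ->].
  exact: Worb.
case/andP => /existsP [[[[e pe] qe] he]]; rewrite finset.in_setT /= => /andP [].
rewrite xpair_eqE -val_eqE /= porbit_eq_sym => /andP [h /eqP pp] /eqP <- hs hl; subst p.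
apply: connect_trans (Worb _ _ _ h) _.
apply: connect_trans (Wedge e _ qe _) _; first exact/eqP.
exact: IH.
Qed.

Section MedialDomain.
Variables (G : periodic_map) (c : dart G -> int * int).
Hypothesis cG : cubic_map G.
Hypothesis ac : admissible_domain c.

(* The midpoint of each edge is put into the copy that contains one chosen
   endpoint of this edge. *)
Definition midpoint_domain (d : dart G) : int * int :=
  if (enum_rank d < enum_rank (edge G d))%N then c d
  else edge_shift d + c (edge G d).

Definition medial_domain (a : dart (medial G)) : int * int :=
  if a.2 then node_shift a.1 + midpoint_domain (node G a.1) else midpoint_domain a.1.

Lemma midpoint_domain_edge d :
  midpoint_domain d = edge_shift d + midpoint_domain (edge G d).
Proof.
rewrite /midpoint_domain edgeK; case: ltngtP => //.
  by rewrite edge_shiftN addrA subrr add0r.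
by move/ord_inj/enum_rank_inj/eqP; rewrite eq_sym (negbTE (edge_neq d)).
Qed.

Lemma medial_domain_fundamental : fundamental_domain medial_domain.
Proof.
case=> d [|]; rewrite ?medial_nodeT ?medial_nodeF /medial_domain /=.
  by rewrite /medial_node_shift /= -addrA -midpoint_domain_edge.
by rewrite /medial_node_shift /= /node_shiftV permKV addKr.
Qed.

(** A walk through vertices becomes a walk through midpoints, consecutive ones sharing a vertex. An
    edge inside the block has its midpoint there, and every midpoint of the block has its chosen
    endpoint in the block. Since any two of the three edges at a vertex share a corner, no third
    midpoint, possibly outside the block, is needed. *)
Lemma medial_admissible : admissible_domain medial_domain.
Proof.
have [fc cc] := ac; split; first exact: medial_domain_fundamental.
move=> m m0; have cB := cc m m0.
pose e := midpoint_domain.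
pose M d (p : cell m) := block_at medial_domain (d, false) p.
have ME d p : M (edge G d) p = M d p.
  by apply: block_at_eq; rewrite -porbit_eq_sym medial_porbit eqxx orbT.
set R := connect (adjacent_in [set: arc (block_graph medial_domain m)]%SET).
have Rsym u v : R u v = R v u by apply: block_connect_sym.
have Mnode d q q' : vec q' - e (node G d) = vec q - e d + node_shift d ->
    R (M d q) (M (node G d) q').
  move=> h; rewrite /M.
  have -> : block_at medial_domain (node G d, false) q' = block_at medial_domain (d, true) q'.
    apply: block_at_eq; have -> : (d, true) = node (medial G) (node G d, false).
      by rewrite medial_nodeF permK.
    by rewrite -porbit_eq_sym porbit_step.
  have -> : (d, true) = edge (medial G) (d, false) by rewrite [RHS]permE.
  apply: block_adjacent; rewrite /displacement [edge _ _]permE /= /medial_domain /= add0r.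
  rewrite -/(e d) -/(e (node G d)) -[vec q'](subrK (e (node G d))) h.
  by rewrite -!addrA; congr (_ + _); rewrite addrC -!addrA.
(* [at_vertex P d q]: the copy at q of the midpoint of d is the midpoint of
   the translate of d whose source lies in the copy P. *)
pose at_vertex (P : int * int) d (q : cell m) := P = vec q - e d + c d.
have adj P d d' q q' : porbit (node G) d' = porbit (node G) d ->
    at_vertex P d q -> at_vertex P d' q' -> R (M d q) (M d' q').
  have step a b r r' : b = node G a -> at_vertex P a r -> at_vertex P b r' -> R (M a r) (M b r').
    move=> -> -> h; apply: Mnode; apply: (addIr (c (node G a))).
    by rewrite -h (fc a) !addrA.
  move/eqP; rewrite (cubic_porbit _ _ cG) => /or3P [] /eqP ->.
  - move=> -> /addIr/addIr/vec_inj ->; exact: connect0.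
  - exact: step.
  - by move=> h h'; rewrite Rsym; apply: (step _ _ _ _ _ h' h); rewrite (cG d).1.
have ex d (q : cell m) : exists d' (p : cell m), M d q = M d' q /\ at_vertex (vec p) d' q.
  have [lt|ge] := boolP (enum_rank d < enum_rank (edge G d))%N.
    by exists d, q; split=> //; rewrite /at_vertex /e /midpoint_domain lt subrK.
  exists (edge G d), q; rewrite ME; split=> //.
  have lt : (enum_rank (edge G d) < enum_rank (edge G (edge G d)))%N.
    rewrite edgeK; case: ltngtP ge => // /ord_inj/enum_rank_inj/eqP.
    by rewrite eq_sym (negbTE (edge_neq d)).
  by rewrite /at_vertex /e /midpoint_domain lt subrK.
have reach d (p : cell m) q d' (p' : cell m) q' : at_vertex (vec p) d q -> at_vertex (vec p') d' q' ->
    R (M d q) (M d' q').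
  have /connectP [s] := cB (block_at c d p) (block_at c d' p').
  move: d p q; elim: s => [|w s IH] d p q /=.
    move=> _ /eqP; rewrite xpair_eqE -val_eqE /= => /andP [/eqP o /eqP ->].
    exact: adj.
  case/andP => /existsP [[[[f pf] qf] hf]]; rewrite finset.in_setT /= => /andP [].
  rewrite xpair_eqE -val_eqE /= => /andP [/eqP o /eqP pp] /eqP <- hs hl hd hd'; subst p.
  have hqf : vec qf = vec pf + displacement c f by apply/eqP.
  (* The midpoint lies in the copy of one of the two endpoints, and both copies belong to the
     block. *)
  have [r hr] : exists r : cell m, vec r = vec pf + e f - c f.
    rewrite /e /midpoint_domain; case: ifP => _; first by exists pf; rewrite addrK.
    by exists qf; rewrite hqf /displacement !addrA.
  have a1 : at_vertex (vec pf) f r by rewrite /at_vertex hr [vec pf + _ - _ - _]addrAC addrK subrK.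
  have a2 : at_vertex (vec qf) (edge G f) r.
    have ef : e f = edge_shift f + e (edge G f) by apply: midpoint_domain_edge.
    rewrite /at_vertex hr hqf ef /displacement !addrA.
    by rewrite [_ - c f - e _]addrAC addrK [RHS]addrAC.
  apply: connect_trans (adj _ _ _ _ _ o hd a1) _.
  by rewrite -ME; apply: (IH _ _ _ hs hl a2 hd').
have MM u : exists d q, u = M d q.
  have [[d b] [q ->]] := block_atP u; case: b; last by exists d, q.
  exists (node G d), q; apply: block_at_eq.
  have -> : (d, true) = node (medial G) (node G d, false).
    by rewrite medial_nodeF permK.
  exact: mem_porbit1.
move=> u v; have [d [q ->]] := MM u; have [d' [q' ->]] := MM v.
have [d1 [p1 [-> h1]]] := ex d q; have [d2 [p2 [-> h2]]] := ex d' q'.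
exact: (reach _ _ _ _ _ _ h1 h2).
Qed.

End MedialDomain.

Lemma hexagonal_nodeE b k : node hexagonal (b, k) = (b, ordS k).
Proof. by rewrite [LHS]permE. Qed.

Lemma hexagonal_edgeE b k : edge hexagonal (b, k) = (~~ b, k).
Proof. by rewrite [LHS]permE. Qed.

Lemma ordS3 (k : 'I_3) : ordS (ordS (ordS k)) = k.
Proof. by case: k => [[|[|[|k]]] hk] //; apply: val_inj. Qed.

Lemma ordS3_neq (k : 'I_3) : ordS k != k.
Proof. by case: k => [[|[|[|k]]] hk]. Qed.

Lemma hexagonal_cubic : cubic_map hexagonal.
Proof.
by case=> b k; rewrite !hexagonal_nodeE ordS3 xpair_eqE negb_and ordS3_neq orbT.
Qed.

Lemma truncation_cubic (G : periodic_map) : cubic_map (truncation G).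
Proof.
by case=> d k; rewrite !truncation_nodeE ordS3 xpair_eqE negb_and ordS3_neq orbT.
Qed.

Lemma truncated_hexagonal_cubic n : cubic_map (truncated_hexagonal n).
Proof. by case: n => [|n]; [exact: hexagonal_cubic | exact: truncation_cubic]. Qed.

Definition hexagonal_domain : dart hexagonal -> int * int := fun=> 0.

Lemma hexagonal_fundamental : fundamental_domain hexagonal_domain.
Proof. by move=> d; rewrite addr0. Qed.

Lemma hexagonal_porbit (a b : dart hexagonal) :
  (porbit (node hexagonal) b == porbit (node hexagonal) a) = (b.1 == a.1).
Proof.
rewrite (cubic_porbit _ _ hexagonal_cubic); case: a b => x k [y l].
rewrite !hexagonal_nodeE !xpair_eqE /= -!andb_orr.
have -> : [|| l == k, l == ordS k | l == ordS (ordS k)] = true.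
  by case: k l => [[|[|[|k]]] hk] // [[|[|[|l]]] hl].
by rewrite andbT.
Qed.

(** From a black vertex, pass to the white vertex of the same cell and on to the black vertex with
    one coordinate smaller. This stays in the block and ends at the origin. *)
Lemma hexagonal_admissible : admissible_domain hexagonal_domain.
Proof.
split; first exact: hexagonal_fundamental.
case=> // m _; set R := connect (adjacent_in [set: arc (block_graph hexagonal_domain m.+1)]%SET).
pose X b (p : cell m.+1) := block_at hexagonal_domain (b, ord0) p.
have XE b k p : block_at hexagonal_domain (b, k) p = X b p.
  by apply: block_at_eq; rewrite -porbit_eq_sym hexagonal_porbit.
have Rsym u v : R u v = R v u by apply: block_connect_sym.
have Xe k (p q : cell m.+1) : vec q = vec p + hex_vec k -> R (X true p) (X false q).
  move=> h; rewrite -(XE true k) -(XE false k) -[(false, k)](hexagonal_edgeE true k).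
  by apply: block_adjacent; rewrite /displacement /= subr0 addr0.
have Xtf p : R (X true p) (X false p) by apply: (Xe ord0); rewrite addr0.
have X0 b p : R (X true (ord0, ord0)) (X b p).
  have [n] := ubnP (p.1 + p.2); elim: n b p => // n IH b [i j] /= hn.
  suff h : R (X true (ord0, ord0)) (X true (i, j)).
    by case: b => //; apply: connect_trans h (Xtf _).
  have back (q : cell m.+1) k : vec (i, j) = vec q + hex_vec k -> (q.1 + q.2 < i + j)%N ->
      R (X true (ord0, ord0)) (X true (i, j)).
    move=> /Xe h lt; apply: connect_trans (IH true q _) _; first by lia.
    apply: connect_trans h _; rewrite -/(R _ _) Rsym; exact: Xtf.
  case: i j back {hn} => [[|i] hi] [[|j] hj] back.
  - rewrite (_ : (_, _) = (ord0, ord0)); first exact: connect0.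
    by congr (_, _); apply: val_inj.
  - apply: (back (Ordinal hi, Ordinal (ltnW hj)) (@Ordinal 3 2 isT)) => /=; last by lia.
    by rewrite /vec /hex_vec /=; congr (_, _) => /=; lia.
  - apply: (back (Ordinal (ltnW hi), Ordinal hj) (@Ordinal 3 1 isT)) => /=; last by lia.
    by rewrite /vec /hex_vec /=; congr (_, _) => /=; lia.
  - apply: (back (Ordinal (ltnW hi), Ordinal hj) (@Ordinal 3 1 isT)) => /=; last by lia.
    by rewrite /vec /hex_vec /=; congr (_, _) => /=; lia.
move=> u v; have [[b k] [p ->]] := block_atP u; have [[b' k'] [p' ->]] := block_atP v.
by rewrite !XE; apply: connect_trans (X0 _ _); rewrite -/(R _ _) Rsym.
Qed.

Lemma truncated_hexagonal_admissible n :
  exists c : dart (truncated_hexagonal n) -> int * int, admissible_domain c.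
Proof.
elim: n => [|n [c ac]]; first by exists hexagonal_domain; exact: hexagonal_admissible.
by exists (fun a => c a.1); exact: truncation_admissible ac.
Qed.

Lemma medial_truncated_admissible n :
  exists c : dart (medial_truncated_hexagonal n) -> int * int, admissible_domain c.
Proof.
have [c ac] := truncated_hexagonal_admissible n.
exists (medial_domain c); apply: medial_admissible ac.
exact: truncated_hexagonal_cubic.
Qed.

Lemma card_porbit_semiconj (T U : finType) (s : {perm T}) (t : {perm U}) (i : T -> U) x :
  injective i -> (forall y, t (i y) = i (s y)) -> #|porbit t (i x)| = #|porbit s x|.
Proof.
move=> i_inj ts; rewrite -(card_imset _ i_inj); congr #|pred_of_set _|.
apply/setP => y; apply/idP/imsetP => [/porbitP [k ->]|[z /porbitP [k ->] ->]].
  exists ((s ^+ k)%g x); first exact: mem_porbit.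
  by rewrite !permX; elim: k => //= k ->.
apply/porbitP; exists k; rewrite !permX; elim: k => //= k <-.
by rewrite ts.
Qed.

(** * Faces *)

Section OrbitSums.
Variable R : numFieldType.

(** Sums over faces become weighted sums over darts, on which the face permutations of different
    maps can be compared pointwise. *)
Lemma porbits_sum (T : finType) (s : {perm T}) (h : nat -> R) :
  \sum_(f in porbits s) h #|f| = \sum_x h #|porbit s x| / #|porbit s x|%:R.
Proof.
rewrite [RHS](partition_big (porbit s) (mem (porbits s))) /=; last first.
  by move=> x _; exact: imset_f.
apply: eq_bigr => f /imsetP [x _ ->].
rewrite (eq_bigr (fun=> h #|porbit s x| / #|porbit s x|%:R)); last first.
  by move=> y /eqP ->.
rewrite sumr_const -[RHS]mulr_natr.
have -> : #|[pred y | porbit s y == porbit s x]| = #|porbit s x|.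
  by apply: eq_card => y; rewrite inE porbit_eq_sym.
by rewrite divfK // pnatr_eq0 -lt0n; apply/card_gt0P; exists x; exact: porbit_id.
Qed.

Lemma porbits_sum_const (T : finType) (s : {perm T}) k (h : nat -> R) :
  (forall x, #|porbit s x| = k) ->
  \sum_(f in porbits s) h #|f| = #|porbits s|%:R * h k.
Proof.
move=> hk; rewrite (eq_bigr (fun=> h k)) => [|f /imsetP [x _ ->]]; last by rewrite hk.
by rewrite sumr_const mulr_natl.
Qed.

End OrbitSums.

Lemma card_porbits_const (T : finType) (s : {perm T}) k :
  (forall x, #|porbit s x| = k) -> (#|porbits s| * k)%N = #|T|.
Proof.
move=> hk; have := porbits_sum s (fun j => j%:R : rat).
rewrite [X in X = _](eq_bigr (fun=> k%:R)) => [|f /imsetP [x _ ->]]; last by rewrite hk.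
rewrite [X in _ = X](eq_bigr (fun=> 1)) => [|x _]; last first.
  by rewrite divff // pnatr_eq0 -lt0n; apply/card_gt0P; exists x; exact: porbit_id.
rewrite !sumr_const -[k%:R *+ _]mulr_natr -natrM mulnC => /eqP.
by rewrite eqr_nat => /eqP.
Qed.

Section FaceCounts.
Variable G : periodic_map.

Lemma faceE d : face G d = (node G)^-1%g (edge G d).
Proof. by rewrite permM. Qed.

Lemma card_edge_porbit d : #|porbit (edge G) d| = 2%N.
Proof.
have -> : porbit (edge G) d = [set d; edge G d]%SET.
  apply/setP => y; rewrite !inE; apply/idP/idP.
    apply: (@porbit_closed _ _ (fun z => (z == d) || (z == edge G d))); last by rewrite eqxx.
    by move=> z /orP [] /eqP ->; rewrite ?edgeK eqxx ?orbT.
  by case/orP => /eqP ->; rewrite ?porbit_id ?mem_porbit1.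
by rewrite cards2 eq_sym edge_neq.
Qed.

Lemma card_edges : (#|edges G| * 2)%N = #|dart G|.
Proof. exact/card_porbits_const/card_edge_porbit. Qed.

(** The face permutation of the dual map is the conjugate of [node] by [edge]: dual faces are
    vertices. *)
Lemma card_face_dual d : #|porbit (face (dual_map G)) (edge G d)| = #|porbit (node G) d|.
Proof.
apply: card_porbit_semiconj; first exact: perm_inj.
move=> y; rewrite permM /= edgeK /face invMg permM invgK.
by apply: (@perm_inj _ (edge G)); rewrite permKV edgeK.
Qed.

Hypothesis cG : cubic_map G.

Lemma card_node_porbit d : #|porbit (node G) d| = 3%N.
Proof.
have ne : node G (node G d) != d.
  apply: contraNneq (cG d).2 => e; rewrite -{2}(cG d).1 e.
  by [].
have -> : porbit (node G) d = d |: [set node G d; node G (node G d)]%SET.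
  by apply/setP => y; rewrite !inE -porbit_eq_sym cubic_porbit.
rewrite cardsU1 cards2 !inE negb_or eq_sym (cG d).2 eq_sym ne.
by rewrite eq_sym (cG _).2.
Qed.

Lemma card_vertices : (#|vertices G| * 3)%N = #|dart G|.
Proof. exact/card_porbits_const/card_node_porbit. Qed.

(** The faces of the medial graph are of two kinds: [false] darts run around the vertices of [G],
    [true] darts around its faces. *)
Lemma medial_faceF d : face (medial G) (d, false) = (node G d, false).
Proof.
rewrite /face permM [edge _ _]permE /medial_edge_fun /=.
apply: (@perm_inj _ (node (medial G))); rewrite permKV medial_nodeF permK //.
Qed.

Lemma medial_faceT d : face (medial G) (d, true) = (face G d, true).
Proof.
rewrite /face permM [edge (medial G) _]permE /medial_edge_fun /=.
apply: (@perm_inj _ (node (medial G))); rewrite permKV medial_nodeT permM permKV.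
by rewrite edgeK.
Qed.

Lemma card_medial_node a : #|porbit (node (medial G)) a| = 4%N.
Proof.
suff h d : #|porbit (node (medial G)) (d, false)| = 4%N.
  case: a => d [|//]; rewrite -(h (edge G (node G d))) -medial_nodeT.
  by rewrite porbit_step.
have -> : porbit (node (medial G)) (d, false)
  = [set (d, false); (edge G d, false)]%SET
    :|: [set ((node G)^-1%g d, true); ((node G)^-1%g (edge G d), true)]%SET.
  apply/setP => y; rewrite !inE; apply/idP/idP.
    apply: (@porbit_closed _ _ (fun y => [|| (y == (d, false)) || (y == (edge G d, false)),
       y == ((node G)^-1%g d, true) | y == ((node G)^-1%g (edge G d), true)])).
      by move=> z /orP [] /orP [] /eqP ->;
        rewrite ?medial_nodeF ?medial_nodeT ?permKV ?edgeK !eqxx ?orbT.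
    by rewrite eqxx.
  have e1 : porbit (node (medial G)) ((node G)^-1%g d, true) = porbit (node (medial G)) (d, false).
    by rewrite -medial_nodeF porbit_step.
  have e2 : porbit (node (medial G)) (edge G d, false) = porbit (node (medial G)) (d, false).
    by rewrite -e1 -[RHS]porbit_step medial_nodeT permKV.
  have e3 : porbit (node (medial G)) ((node G)^-1%g (edge G d), true) = porbit (node (medial G)) (d, false).
    by rewrite -medial_nodeF porbit_step.
  by case/orP => /orP [] /eqP ->; rewrite -porbit_eq_sym ?e1 ?e2 ?e3.
rewrite cardsU !cards2 !xpair_eqE !andbT (inj_eq perm_inj) eq_sym edge_neq /=.
have -> : [set (d, false); (edge G d, false)]%SET
    :&: [set ((node G)^-1%g d, true); ((node G)^-1%g (edge G d), true)]%SET = finset.set0.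
  by apply/setP => -[y [|]]; rewrite !inE !xpair_eqE !andbF ?andbF.
by rewrite cards0.
Qed.

Lemma card_medial_vertices : (#|vertices (medial G)| * 2)%N = #|dart G|.
Proof.
have := card_porbits_const card_medial_node; rewrite -/(vertices _) card_prod card_bool.
by rewrite -[4%N]/(2 * 2)%N mulnA => /eqP; rewrite eqn_pmul2r // => /eqP.
Qed.

Lemma trunc_face0 d : face (truncation G) (d, inord 0) = (edge G d, inord 2).
Proof.
rewrite /face permM [edge _ _]permE /trunc_edge_fun /= inordK //=.
apply: (@perm_inj _ (node (truncation G))); rewrite permKV truncation_nodeE.
by congr (_, _); apply: val_inj; rewrite /= !inordK.
Qed.

Lemma trunc_face2 d : face (truncation G) (d, inord 2) = ((node G)^-1%g d, inord 0).
Proof.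
rewrite /face permM [edge _ _]permE /trunc_edge_fun /= inordK //=.
apply: (@perm_inj _ (node (truncation G))); rewrite permKV truncation_nodeE.
by congr (_, _); apply: val_inj; rewrite /= !inordK.
Qed.

Lemma trunc_face1 d : face (truncation G) (d, inord 1) = (node G d, inord 1).
Proof.
rewrite /face permM [edge _ _]permE /trunc_edge_fun /= inordK //=.
apply: (@perm_inj _ (node (truncation G))); rewrite permKV truncation_nodeE.
by congr (_, _); apply: val_inj; rewrite /= !inordK.
Qed.

(** Along an old face the darts with index 0 and index 2 alternate, which doubles its degree; those
    with index 1 run around the new triangles. *)
Lemma card_trunc_face d :
  #|porbit (face (truncation G)) (d, inord 0)| = (2 * #|porbit (face G) d|)%N.
Proof.
set f := face (truncation G).
pose i0 (d : dart G) : dart (truncation G) := (d, inord 0).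
pose i2 (d : dart G) : dart (truncation G) := (edge G d, inord 2).
have i0_inj : injective i0 by move=> x y [].
have i2_inj : injective i2 by move=> x y [] /perm_inj.
have f0 x : f (i0 x) = i2 x by apply: trunc_face0.
have f2 x : f (i2 x) = i0 (face G x) by rewrite /f trunc_face2 -faceE.
have -> : porbit f (d, inord 0) = (i0 @: porbit (face G) d) :|: (i2 @: porbit (face G) d).
  apply/setP => y; apply/idP/idP; rewrite inE.
    apply: (@porbit_closed _ _ (fun y => (y \in i0 @: porbit (face G) d) || (y \in i2 @: porbit (face G) d))).
      move=> z /orP [] /imsetP [x hx ->]; rewrite ?f0 ?f2; apply/orP; [right|left];
        apply: imset_f => //.
      by rewrite -porbit_eq_sym porbit_step porbit_eq_sym.
    by apply/orP; left; apply: imset_f; exact: porbit_id.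
  have h x : x \in porbit (face G) d -> i0 x \in porbit f (i0 d).
    apply: (@porbit_closed _ _ (fun x => i0 x \in porbit f (i0 d))); last exact: porbit_id.
    by move=> z; rewrite -!porbit_eq_sym -f2 -f0 !porbit_step.
  case/orP => /imsetP [x /h hx ->] //.
  by rewrite -f0 -porbit_eq_sym porbit_step porbit_eq_sym.
rewrite cardsU !card_imset //.
have -> : (i0 @: porbit (face G) d) :&: (i2 @: porbit (face G) d) = finset.set0.
  apply/setP => y; rewrite !inE; apply/negP => /andP [/imsetP [x _ ->] /imsetP [z _]].
  by move/(congr1 (fun a => val a.2)); rewrite /= !inordK.
by rewrite cards0 subn0 mul2n addnn.
Qed.

Section Sums.
Variables (R : numFieldType) (h : nat -> R).

Lemma medial_faces_sum : \sum_(f in faces (medial G)) h #|f|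
  = #|vertices G|%:R * h 3 + \sum_(f in faces G) h #|f|.
Proof.
rewrite !porbits_sum.
transitivity (\sum_(d : dart G) \sum_(b : bool)
   h #|porbit (face (medial G)) (d, b)| / #|porbit (face (medial G)) (d, b)|%:R).
  by rewrite pair_big; apply: eq_bigr => -[].
under eq_bigr => d _ do rewrite big_bool /= addrC.
rewrite big_split /=; congr (_ + _); last first.
  apply: eq_bigr => d _.
  by rewrite (@card_porbit_semiconj _ _ (face G) _ (fun d => (d, true))) // => [x y []|y] //;
     rewrite medial_faceT.
rewrite (eq_bigr (fun=> h 3 / 3)) => [|d _]; last first.
  by rewrite (@card_porbit_semiconj _ _ (node G) _ (fun d => (d, false))) ?card_node_porbit //
     => [x y []|y] //; rewrite medial_faceF.
rewrite sumr_const -card_vertices -[LHS]mulr_natr natrM.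
by rewrite mulrC -mulrA; congr (_ * _); field.
Qed.

Lemma truncation_faces_sum : \sum_(f in faces (truncation G)) h #|f|
  = \sum_(f in faces G) h (2 * #|f|)%N + #|vertices G|%:R * h 3.
Proof.
rewrite (porbits_sum _ h) (porbits_sum _ (fun k => h (2 * k)%N)).
pose g a := h #|porbit (face (truncation G)) a| / #|porbit (face (truncation G)) a|%:R.
transitivity (\sum_(d : dart G) \sum_(k < 3) g (d, k)).
  by rewrite pair_big; apply: eq_bigr => -[].
have e0 d : g (d, ord0) = h (2 * #|porbit (face G) d|)%N / (2 * #|porbit (face G) d|)%:R.
  have -> : ord0 = inord 0 :> 'I_3 by apply: val_inj; rewrite /= inordK.
  by rewrite /g card_trunc_face.
have e1 d : g (d, lift ord0 ord0) = h 3 / 3.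
  have -> : lift ord0 ord0 = inord 1 :> 'I_3 by apply: val_inj; rewrite /= inordK.
  rewrite /g.
  rewrite (@card_porbit_semiconj _ _ (node G) _ (fun d => (d, inord 1))) ?card_node_porbit //.
    by move=> x y [].
  by move=> y; rewrite trunc_face1.
(* Each dart of index 2 shares its face with a dart of index 0, so both families contribute the same
   sum. *)
have e2 d : g (edge G d, lift ord0 (lift ord0 ord0)) = g (d, ord0).
  have -> : lift ord0 (lift ord0 ord0) = inord 2 :> 'I_3.
    by apply: val_inj; rewrite /= inordK.
  have -> : ord0 = inord 0 :> 'I_3 by apply: val_inj; rewrite /= inordK.
  by rewrite /g -trunc_face0 porbit_step.
under eq_bigr => d _ do rewrite !big_ord_recl big_ord0 addr0.
rewrite !big_split /=.
have -> : \sum_(d : dart G) g (d, lift ord0 (lift ord0 ord0)) = \sum_d g (d, ord0).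
  by rewrite (reindex_inj (@perm_inj _ (edge G))); apply: eq_bigr => d _; rewrite e2.
under [X in _ + (X + _) = _]eq_bigr => d _ do rewrite e1.
rewrite sumr_const -card_vertices -[(h 3 / 3) *+ _]mulr_natr natrM.
have -> : \sum_x h (2 * #|porbit (face G) x|)%N / #|porbit (face G) x|%:R
  = \sum_d g (d, ord0) + \sum_d g (d, ord0).
  rewrite -big_split; apply: eq_bigr => d _ /=; rewrite e0 natrM.
  have : #|porbit (face G) d|%:R != 0 :> R.
    by rewrite pnatr_eq0 -lt0n; apply/card_gt0P; exists d; exact: porbit_id.
  by move=> ?; field.
by field.
Qed.

End Sums.
End FaceCounts.

Lemma hexagonal_faceE b k : face hexagonal (b, k) = (~~ b, ordS (ordS k)).
Proof.
rewrite faceE; apply: (@perm_inj _ (node hexagonal)).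
by rewrite permKV hexagonal_edgeE hexagonal_nodeE ordS3.
Qed.

Lemma card_hexagonal_dart : #|dart hexagonal| = 6%N.
Proof. by rewrite card_prod card_bool card_ord. Qed.

Lemma card_hexagonal_face d : #|porbit (face hexagonal) d| = 6%N.
Proof.
rewrite -card_hexagonal_dart -cardsT; congr #|pred_of_set _|.
apply/setP => y; rewrite finset.in_setT; case: d y => b k [b' k'].
have st x : face hexagonal x \in porbit (face hexagonal) (b, k) = (x \in porbit (face hexagonal) (b, k)).
  by rewrite -!porbit_eq_sym porbit_step.
have h0 : (b, k) \in porbit (face hexagonal) (b, k) by exact: porbit_id.
have h1 := h0; rewrite -st hexagonal_faceE in h1.
have h2 := h1; rewrite -st hexagonal_faceE ordS3 negbK in h2.
have h3 := h2; rewrite -st hexagonal_faceE ordS3 in h3.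
have h4 := h3; rewrite -st hexagonal_faceE negbK in h4.
have h5 := h4; rewrite -st hexagonal_faceE ordS3 in h5.
have hk : [|| k' == k, k' == ordS k | k' == ordS (ordS k)].
  by case: k k' {st h0 h1 h2 h3 h4 h5} => [[|[|[|k]]] hk] // [[|[|[|l]]] hl].
have hb : (b' == b) || (b' == ~~ b) by case: b b' {st h0 h1 h2 h3 h4 h5} => [] [].
by case/orP: hb => /eqP ->; case/or3P: hk => /eqP ->.
Qed.

Lemma card_truncated_dart n : #|dart (truncated_hexagonal n)| = (6 * 3 ^ n)%N.
Proof.
elim: n => [|n IH]; first exact: card_hexagonal_dart.
by rewrite card_prod card_ord IH expnSr mulnA.
Qed.

Lemma card_truncated_vertices n : #|vertices (truncated_hexagonal n)| = (2 * 3 ^ n)%N.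
Proof.
have := card_vertices (@truncated_hexagonal_cubic n).
rewrite card_truncated_dart -[6%N]/(2 * 3)%N -mulnA mulnCA mulnC => /eqP.
by rewrite eqn_pmul2l // => /eqP.
Qed.

Lemma card_medial_truncated_vertices n :
  #|vertices (medial_truncated_hexagonal n)| = (3 * 3 ^ n)%N.
Proof.
have := card_medial_vertices (truncated_hexagonal n).
rewrite card_truncated_dart -[6%N]/(2 * 3)%N -mulnA mulnC => /eqP.
by rewrite eqn_pmul2l // => /eqP.
Qed.

Section FaceSum.
Variable R : realType.

Definition face_sum n (h : nat -> R) : R :=
  \sum_(f in faces (truncated_hexagonal n)) h #|f|.

Lemma face_sum0 h : face_sum 0 h = h 6.
Proof.
rewrite /face_sum (porbits_sum_const h card_hexagonal_face).
have := card_porbits_const card_hexagonal_face.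
rewrite card_hexagonal_dart -[X in _ = X]mul1n => /eqP.
by rewrite eqn_pmul2r // => /eqP ->; rewrite mul1r.
Qed.

Lemma face_sumS n h : face_sum n.+1 h
  = face_sum n (fun k => h (2 * k)%N) + 2 * 3 ^+ n * h 3.
Proof.
rewrite /face_sum (truncation_faces_sum (@truncated_hexagonal_cubic n) h).
by rewrite card_truncated_vertices natrM natrX.
Qed.

(** The induction generalises [a]: replacing [h k] by [h (2 * k)] raises [a] by [b * ln 2], and the
    new triangles contribute through the bound at 3. The factor (3^n - 1) / 2 is the geometric sum
    of the powers of 3 below 3^n. *)
Lemma face_sum_ln_le n (h : nat -> R) (a b : R) :
  (forall k, (3 <= k)%N -> h k <= a + b * ln k%:R) ->
  face_sum n h <= a * 3 ^+ n + b * (ln 6 + (3 ^+ n - 1) / 2 * (ln 2 + 2 * ln 3)).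
Proof.
elim: n h a => [|n IH] h a hab.
  by rewrite face_sum0 expr0 subrr mul0r mul0r addr0 mulr1 hab.
rewrite face_sumS.
have h2 k : (3 <= k)%N -> h (2 * k)%N <= (a + b * ln 2) + b * ln k%:R.
  move=> k3; apply: le_trans (hab _ _) _; first by rewrite mul2n -addnn; exact: leq_trans (leq_addr _ _).
  rewrite natrM lnM ?posrE ?ltr0n //; last exact: leq_trans k3.
  by rewrite mulrDr addrA.
have h3 := hab 3%N (leqnn _).
apply: le_trans (lerD (IH _ _ h2) (ler_wpM2l _ h3)) _; first by rewrite mulr_ge0 // exprn_ge0.
by rewrite exprS le_eqVlt; apply/orP; left; apply/eqP; field.
Qed.

(** The dual of the medial graph has only quadrilateral faces, one per medial vertex; they account
    for the summand [v_oct]. *)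
Lemma nu_lozenge_medial_truncated n :
  nu_lozenge R (medial_truncated_hexagonal n)
  = (2 * 3 ^+ n * vol_bipyramid R 3 + face_sum n (vol_bipyramid R)) / (3 * 3 ^+ n) + v_oct R.
Proof.
rewrite /nu_lozenge /vol_lozenge.
rewrite (medial_faces_sum (@truncated_hexagonal_cubic n)).
have hd d : #|porbit (face (dual_map (medial_truncated_hexagonal n))) d| = 4%N.
  rewrite -[d](@edgeK (medial_truncated_hexagonal n)) card_face_dual.
  exact: card_medial_node.
rewrite (porbits_sum_const _ hd).
have -> : #|faces (dual_map (medial_truncated_hexagonal n))|
   = #|vertices (medial_truncated_hexagonal n)|.
  apply/eqP; rewrite -(@eqn_pmul2r 4) // (card_porbits_const hd).
  by rewrite (card_porbits_const (@card_medial_node _)).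
rewrite card_medial_truncated_vertices card_truncated_vertices -/(face_sum n _).
rewrite !natrM !natrX.
have n3 : 3 ^+ n != 0 :> R by rewrite expf_eq0 pnatr_eq0 andbF.
by rewrite /v_oct; field.
Qed.

Lemma nu_bar_medial_truncated n : nu_bar R (medial_truncated_hexagonal n) = 2 * v_oct R.
Proof.
have hE : #|edges (medial_truncated_hexagonal n)| = (2 * #|vertices (medial_truncated_hexagonal n)|)%N.
  apply/eqP; rewrite -(@eqn_pmul2r 2) // card_edges mulnC mulnA.
  by rewrite mulnC (card_porbits_const (@card_medial_node _)).
rewrite /nu_bar hE card_medial_truncated_vertices !natrM natrX.
have n3 : 3 ^+ n != 0 :> R by rewrite expf_eq0 pnatr_eq0 andbF.
by field.
Qed.

End FaceSum.

(** * The hexagonal lattice *)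

Section HexagonalTorus.
Variables (C : numFieldType) (m : nat).
Local Notation M := m.+1.
Local Notation H := (torus_graph hexagonal_domain m).

Definition hexagonal_step (k : 'I_3) : cell M := cell_residue m (hex_vec k).

Definition hexagonal_vertex (a : bool * cell M) : vertex H :=
  torus_src hexagonal_domain ((a.1, ord0), a.2).

Lemma hexagonal_vertex_bij : bijective hexagonal_vertex.
Proof.
apply: bijective_of_inj_surj => [[b p] [b' p'] /eqP|v].
  by rewrite [_ == _]torus_srcE hexagonal_porbit /= !addr0 => /andP [/eqP -> /eqP ->].
have [[[b k] x] <-] := torus_src_surj v; exists (b, x); apply/eqP.
by rewrite [_ == _]torus_srcE hexagonal_porbit /= !addr0 !eqxx.
Qed.

Definition hexagonal_neighbor (x : bool * cell M) (k : 'I_3) : bool * cell M :=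
  (~~ x.1, if x.1 then x.2 + hexagonal_step k else x.2 - hexagonal_step k).

Lemma hexagonal_laplacian (x y : bool * cell M) :
  laplacian C (hexagonal_vertex x) (hexagonal_vertex y)
  = 3 * (x == y)%:R - \sum_(k < 3) (hexagonal_neighbor x k == y)%:R.
Proof.
have srcE (d : dart hexagonal) (z : cell M) : torus_src hexagonal_domain (d, z) = hexagonal_vertex (d.1, z).
  by apply/eqP; rewrite [_ == _]torus_srcE hexagonal_porbit /= !eqxx.
rewrite laplacianE.
transitivity (\sum_(z : bool * cell M) \sum_(k < 3)
   (z == x)%:R * ((x == y)%:R - (hexagonal_neighbor z k == y)%:R) : C).
  rewrite pair_big /= (reindex (fun a : (bool * cell M) * 'I_3 => (((a.1.1, a.2), a.1.2) : arc H))) /=; last first.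
    by exists (fun a : arc H => ((a.1.1, a.2), a.1.2)) => [[[b z] k]|[[b k] z]].
  apply: eq_bigr => -[[b z] k] _ /=.
  rewrite /tgt /= !srcE /= !(bij_eq hexagonal_vertex_bij); congr (_ * (_ - (_ == _)%:R)).
  rewrite permE /hexagonal_neighbor /hexagonal_step /=; congr (_, _).
  by case: b => //; rewrite /hex_edge_shift /= cell_residueN.
under eq_bigr => z _ do rewrite -mulr_sumr.
by rewrite sum_delta sumrB sumr_const card_ord -[_ *+ 3]mulr_natl.
Qed.

Let EA := fmx (fun (x : bool * cell M) (p : cell M) => (x == (true, p))%:R : C).
Let EB := fmx (fun (x : bool * cell M) (p : cell M) => (x == (false, p))%:R : C).
Let Q := fmx (fun p q : cell M => \sum_(k < 3) (q == p + hexagonal_step k)%:R : C).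

Lemma sum_slice (b : bool) (x : bool * cell M) (g : cell M -> C) :
  \sum_p (x == (b, p))%:R * g p = (x.1 == b)%:R * g x.2.
Proof.
case: x => a q; under eq_bigr => p _ do rewrite xpair_eqE -mulnb natrM -mulrA (eq_sym q).
by rewrite -mulr_sumr sum_delta.
Qed.

Lemma tr_fmx (U W : finType) (f : U -> W -> C) : (fmx f)^T = fmx (fun w u => f u w).
Proof. by apply/matrixP => i j; rewrite !mxE. Qed.

(** [EA] and [EB] embed the black and the white vertices, and [Q] is the adjacency from black to
    white. The perturbation lives on the black vertices only and so alters a single diagonal
    block. *)
Lemma hexagonal_matrix : fmx (fun x y =>
    laplacian C (hexagonal_vertex x) (hexagonal_vertex y) + (x.1)%:R * (y.1)%:R)
  = 3%:M + EA *m const_mx 1 *m EA^T - EA *m Q *m EB^T - EB *m Q^T *m EA^T.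
Proof.
have -> : const_mx 1 = fmx (fun _ _ : cell M => 1 : C).
  by apply/matrixP => i j; rewrite !mxE.
rewrite /EA /EB /Q !tr_fmx !fmx_mul.
apply/matrixP => i j; rewrite !mxE hexagonal_laplacian -(inj_eq enum_val_inj).
move: (enum_val i) (enum_val j) => x y {i j}.
under [X in _ = _ + X - _ - _]eq_bigr => q _ do rewrite sum_slice mulrC.
under [X in _ = _ + _ - X - _]eq_bigr => q _ do rewrite sum_slice mulrC.
under [X in _ = _ + _ - _ - X]eq_bigr => q _ do rewrite sum_slice mulrC.
rewrite !sum_slice -[_ *+ (x == y)]mulr_natr.
case: x y => [[|] p] [[|] q]; rewrite /= ?mul1r ?mul0r ?subr0 ?addr0 ?mulr1 ?sub0r.
- by rewrite big1 ?subr0 // => k _; rewrite xpair_eqE.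
- congr (_ - _); apply: eq_bigr => k _; rewrite xpair_eqE /=.
  by rewrite eq_sym.
- congr (_ - _); apply: eq_bigr => k _; rewrite xpair_eqE /=.
  by rewrite subr_eq.
- by rewrite big1 ?subr0 // => k _; rewrite xpair_eqE.
Qed.

Lemma slices : [/\ EA^T *m EA = 1%:M, EB^T *m EB = 1%:M & EB^T *m EA = 0].
Proof.
rewrite /EA /EB !tr_fmx !fmx_mul -!fmx1; split.
- apply: eq_fmx => p q; under eq_bigr => x _ do rewrite (eq_sym x (true, q)).
  under eq_bigr => x _ do rewrite eq_sym mulrC eq_sym.
  by rewrite sum_delta xpair_eqE eqxx.
- apply: eq_fmx => p q; under eq_bigr => x _ do rewrite mulrC.
  by rewrite sum_delta xpair_eqE eqxx eq_sym.
- apply/matrixP => i j; rewrite !mxE big1 // => x _.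
  by case: (eqVneq x _) => [->|_]; rewrite ?mul0r // mul1r xpair_eqE.
Qed.

End HexagonalTorus.

(** The Schur complement that eliminates the white vertices, whose diagonal block is 3. It is
    phrased with the embeddings [EA] and [EB], so the index set need not be split literally; [U] is
    the unipotent elimination step. *)
Lemma det_two_slices (F : numFieldType) n p (EA EB : 'M[F]_(n, p)) (J Q : 'M[F]_p) :
  EA^T *m EA = 1%:M -> EB^T *m EB = 1%:M -> EB^T *m EA = 0 -> n = (p + p)%N ->
  \det (3%:M + EA *m J *m EA^T - EA *m Q *m EB^T - EB *m Q^T *m EA^T)
  = \det (9%:M - Q *m Q^T + 3 *: J).
Proof.
move=> hA hB hBA np; have n3 : 3 != 0 :> F by rewrite pnatr_eq0.
set X := (X in \det X = _).
pose U := 1%:M - (- 3^-1 *: (EA *m Q)) *m EB^T.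
have detU : \det U = 1.
  by rewrite det_1subC -scalemxAr mulmxA hBA mul0mx scaler0 subr0 det1.
have EBX : EB^T *m X = 3 *: EB^T - Q^T *m EA^T.
  rewrite /X !mulmxBr mulmxDr mul_mx_scalar !mulmxA hBA hB !mul0mx mul1mx.
  by rewrite addr0 subr0.
pose Y := 3^-1 *: (EB *m Q^T - EA *m (J - 3^-1 *: (Q *m Q^T))).
have UX : U *m X = 3 *: (1%:M - Y *m EA^T).
  rewrite /U mulmxBl mul1mx -mulmxA EBX -scalemxAl mulmxBr -scalemxAr.
  rewrite scalerBr scaleNr scaleNr scalerA mulVf // scale1r opprB opprK addrC.
  rewrite /Y -scalemxAl scalerBr scalerA divff // scale1r mulmxBl opprB.
  rewrite mulmxBr mulmxBl -scalemxAr -scalemxAl !mulmxA scale_scalar_mx mulr1 /X.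
  set a := 3%:M; set b := EA *m J *m _; set c := EA *m Q *m EB^T; set d := EB *m _ *m _.
  set e := 3^-1 *: _.
  rewrite -addrA [a + b - c - d]addrAC [c + _]addrC subrK addrC.
  by rewrite [b - e - d]addrAC !addrA.
have -> : \det X = \det (U *m X) by rewrite det_mulmx detU mul1r.
rewrite UX detZ det_1subC /Y -scalemxAr mulmxBr !mulmxA hA mul1mx.
have hAB : EA^T *m EB = 0 by rewrite -[LHS]trmxK trmx_mul trmxK hBA trmx0.
rewrite hAB mul0mx sub0r scalerN opprK np exprD -mulrA -2!detZ; congr (\det _).
rewrite scalerA !scalerDr !scalerN !scalerA scale_scalar_mx.
have -> : 3 * 3 * 3^-1 = 3 :> F by field.
rewrite divff // scale1r mulr1 -natrM -addrA; congr (_ + _).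
by rewrite addrC.
Qed.

Lemma prod_enum_val (F : comPzRingType) (U : finType) (g : U -> F) :
  \prod_(i < #|U|) g (enum_val i) = \prod_u g u.
Proof.
rewrite [RHS](reindex (@enum_val U U)) //=.
by exists enum_rank => y _; [exact: enum_valK | exact: enum_rankK].
Qed.

Section HexagonalFourier.
Variables (C : numFieldType) (m : nat).
Local Notation M := m.+1.
Local Notation H := (torus_graph hexagonal_domain m).

Let Q := fmx (fun p q : cell M => \sum_(k < 3) (q == p + hexagonal_step m k)%:R : C).

Lemma hexagonal_tree_det :
  (num_spanning_trees H)%:R * M%:R ^+ 4 = \det (9%:M - Q *m Q^T + 3 *: const_mx 1).
Proof.
have [g gK Kg] := @hexagonal_vertex_bij m.
have su : \sum_(v : vertex H) ((g v).1)%:R = M%:R ^+ 2 :> C.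
  rewrite (reindex (@hexagonal_vertex m)) /=; last exact: onW_bij (@hexagonal_vertex_bij m).
  under eq_bigr => x _ do rewrite gK.
  transitivity (\sum_(b : bool) \sum_(p : cell M) b%:R : C).
    by rewrite pair_big; apply: eq_bigr => -[].
  by rewrite big_bool /= !sumr_const !mul0rn addr0 card_prod card_ord natrM expr2.
have nz : \sum_(v : vertex H) ((g v).1)%:R != 0 :> C.
  by rewrite su expf_eq0 pnatr_eq0 andbF.
have := matrix_tree (@hexagonal_vertex m (true, 0)) (fun v => ((g v).1)%:R) nz.
rewrite su -(det_fmx_bij _ (hexagonal_vertex_bij m)).
rewrite (eq_fmx (g := fun x y => laplacian C (@hexagonal_vertex m x) (@hexagonal_vertex m y)
   + (x.1)%:R * (y.1)%:R)); last by move=> x y; rewrite !gK.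
have [hA hB hBA] := slices C m.
rewrite hexagonal_matrix (det_two_slices _ _ hA hB hBA) => [->|]; first by ring.
by rewrite !card_prod card_bool mul2n addnn.
Qed.

Variable z : C.
Hypothesis zP : M.-primitive_root z.

Definition wave (q x : cell M) : C := z ^+ (q.1 * x.1 + q.2 * x.2).

Lemma waveC q x : wave q x = wave x q.
Proof. by rewrite /wave mulnC (mulnC q.2). Qed.

Lemma waveD q q' x : wave (q + q') x = wave q x * wave q' x.
Proof.
rewrite /wave !exprD !exprM /= !(prim_expr_mod zP) !exprD !exprMn.
by rewrite mulrACA.
Qed.

Lemma wave0 x : wave 0 x = 1.
Proof. by rewrite /wave !mul0n addn0 expr0. Qed.

Lemma prim_rootX_neq0 n : z ^+ n != 0.
Proof.
rewrite expf_eq0 negb_and; apply/orP; right; apply/eqP => z0.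
by have := prim_expr_order zP; rewrite z0 expr0n => /esym/eqP; rewrite oner_eq0.
Qed.

Lemma wave_neq0 q x : wave q x != 0.
Proof. exact: prim_rootX_neq0. Qed.

Lemma waveN q x : wave (- q) x = (wave q x)^-1.
Proof.
apply: (mulfI (wave_neq0 q x)); rewrite -waveD subrr wave0 divff //.
exact: wave_neq0.
Qed.

(** Orthogonality of characters: translating by some [q0] with [wave q0 x] different from 1
    multiplies the sum by that number. *)
Lemma wave_sum x : \sum_q wave q x = M%:R ^+ 2 * (x == 0)%:R.
Proof.
have [->|x0] := eqVneq x 0.
  under eq_bigr => q _ do rewrite waveC wave0.
  by rewrite sumr_const mulr1 card_prod card_ord natrM expr2.
have [q0 hq0] : exists q0, wave q0 x != 1.
  have nz (i : 'I_M) : i != 0 -> z ^+ i != 1.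
    move=> i0; rewrite -(prim_order_dvd zP) gtnNdvd ?ltn_ord // lt0n.
    by apply: contra i0 => /eqP e; apply/eqP/val_inj.
  have v1 (i : 'I_M) : i != 0 -> nat_of_ord (inord 1 : 'I_M) = 1%N.
    move=> i0; rewrite inordK //; apply: leq_ltn_trans (ltn_ord i).
    by rewrite lt0n; apply: contra i0 => /eqP e; apply/eqP/val_inj.
  case: x x0 => i j; rewrite xpair_eqE negb_and => /orP [i0|j0].
    by exists (inord 1, 0); rewrite /wave /= (v1 i i0) mul1n mul0n addn0 nz.
  by exists (0, inord 1); rewrite /wave /= (v1 j j0) mul1n mul0n add0n nz.
rewrite mulr0; apply/eqP; set S := \sum_q _.
have : S * (1 - wave q0 x) == 0.
  rewrite mulrBr mulr1 subr_eq0 {1}/S (reindex_inj (addIr q0)) /= mulr_suml.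
  by apply/eqP; apply: eq_bigr => q _; rewrite waveD.
by rewrite mulf_eq0 subr_eq0 [1 == _]eq_sym (negbTE hq0) orbF.
Qed.

Definition symbol (x : cell M) : C := \sum_(k < 3) wave (hexagonal_step m k) x.
(** The eigenvalue of the transpose of [Q]. Inverses of roots of unity stand for conjugates, which a
    general field does not offer. *)
Definition symbolN (x : cell M) : C := \sum_(k < 3) (wave (hexagonal_step m k) x)^-1.
Definition hexagonal_eigenvalue (x : cell M) : C :=
  9 - symbol x * symbolN x + 3 * (M%:R ^+ 2 * (x == 0)%:R).

Lemma hexagonal_det :
  \det (9%:M - Q *m Q^T + 3 *: const_mx 1) = \prod_x hexagonal_eigenvalue x.
Proof.
pose W := fmx wave; pose W' := fmx (fun x q : cell M => wave (- q) x).
pose D := fmx (fun x y : cell M => (x == y)%:R * hexagonal_eigenvalue x).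
have WW : W *m W' = (M%:R ^+ 2)%:M.
  rewrite fmx_mul; apply/matrixP => i j; rewrite !mxE -(inj_eq enum_val_inj).
  under eq_bigr => x _ do rewrite -waveD waveC.
  by rewrite wave_sum subr_eq0 mulr_natr.
have dW : \det W != 0.
  apply/eqP => d0; have := congr1 determinant WW.
  rewrite det_mulmx d0 mul0r det_scalar => /esym/eqP.
  by rewrite !expf_eq0 pnatr_eq0 /= !andbF.
have QW : Q *m W = fmx (fun p x => wave p x * symbol x).
  rewrite fmx_mul; apply: eq_fmx => p x.
  under eq_bigr => q _ do rewrite mulr_suml.
  rewrite exchange_big /= mulr_sumr; apply: eq_bigr => k _.
  by rewrite sum_delta waveD.
have QTW : Q^T *m W = fmx (fun p x => wave p x * symbolN x).
  rewrite tr_fmx fmx_mul; apply: eq_fmx => p x.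
  under eq_bigr => q _ do rewrite mulr_suml.
  rewrite exchange_big /= mulr_sumr; apply: eq_bigr => k _.
  under eq_bigr => q _ do rewrite -subr_eq eq_sym.
  by rewrite sum_delta waveD waveN.
have QQTW : Q *m Q^T *m W = fmx (fun p x => wave p x * (symbol x * symbolN x)).
  rewrite -mulmxA QTW; have -> : fmx (fun p x => wave p x * symbolN x)
     = W *m fmx (fun x y : cell M => (x == y)%:R * symbolN x).
    rewrite fmx_mul; apply: eq_fmx => p x.
    under eq_bigr => y _ do rewrite mulrCA.
    by rewrite sum_delta.
  rewrite mulmxA QW fmx_mul; apply: eq_fmx => p x.
  under eq_bigr => y _ do rewrite mulrCA.
  by rewrite sum_delta mulrA.
have eq1 : (9%:M - Q *m Q^T + 3 *: const_mx 1) *m W = W *m D.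
  rewrite mulmxDl mulmxBl QQTW mul_scalar_mx -scalemxAl.
  have -> : (const_mx 1 : 'M[C]_#|{: cell M}|) = fmx (fun _ _ : cell M => 1 : C).
    by apply/matrixP => i j; rewrite !mxE.
  rewrite /D !fmx_mul; apply/matrixP => i j; rewrite !mxE.
  under [X in _ = X]eq_bigr => y _ do rewrite mulrCA.
  rewrite sum_delta; under eq_bigr => y _ do rewrite mul1r.
  rewrite wave_sum /hexagonal_eigenvalue; set x := enum_val j; set p := enum_val i.
  have hw : wave p x * (x == 0)%:R = (x == 0)%:R.
    by have [->|_] := eqVneq x 0; rewrite ?mulr0 // waveC wave0 mul1r.
  by rewrite -{1}hw; ring.
apply: (mulIf dW); rewrite -det_mulmx eq1 det_mulmx mulrC; congr (_ * _).
have -> : D = diag_mx (\row_i hexagonal_eigenvalue (enum_val i)).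
  apply/matrixP => i j; rewrite !mxE (inj_eq enum_val_inj).
  by case: eqP; rewrite ?mul1r ?mulr1n ?mul0r ?mulr0n.
by rewrite det_diag; under eq_bigr => i _ do rewrite mxE; exact: prod_enum_val.
Qed.

(** The factorisation of X^M - 1 evaluated at the inverse of [x], with [x = 0] apart. *)
Lemma prim_root_prod_mul (x : C) : \prod_(k < M) (1 - x * z ^+ k) = 1 - x ^+ M.
Proof.
have [->|x0] := eqVneq x 0.
  by rewrite big1 ?expr0n ?subr0 // => k _; rewrite mul0r subr0.
have := congr1 (fun p => p.[x^-1]) (factor_Xn_sub_1 zP).
rewrite horner_prod !hornerE big_mkord => e.
have -> : \prod_(k < M) (1 - x * z ^+ k) = \prod_(k < M) (x * ('X - (z ^+ k)%:P).[x^-1]).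
  by apply: eq_bigr => k _; rewrite !hornerE mulrBr divff.
rewrite big_split /= prodr_const card_ord e mulrBr mulr1 -exprMn divff //.
by rewrite expr1n.
Qed.

Lemma prim_root_prod1 : \prod_(1 <= k < M) (1 - z ^+ k) = M%:R.
Proof.
have := factor_Xn_sub_1 zP; rewrite big_nat_recl //= expr0 subrX1 => /(mulfI _) h.
have /h {h} : 'X - 1%:P != 0 :> {poly C} by rewrite polyXsubC_eq0.
move/(congr1 (fun p => p.[1])); rewrite horner_prod horner_sum.
under eq_bigr => k _ do rewrite !hornerE.
under [X in _ = X]eq_bigr => k _ do rewrite hornerXn expr1n.
by rewrite sumr_const card_ord big_add1.
Qed.

Lemma prim_rootV (k : 'I_M) : z ^+ (- k)%R = (z ^+ k)^-1.
Proof.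
apply: (mulfI (prim_rootX_neq0 k)); rewrite divff ?prim_rootX_neq0 // -exprD -(prim_expr_mod zP) /=.
by rewrite modnDmr subnKC ?modnn // ltnW.
Qed.

Lemma hexagonal_eigenvalueE (x : cell M) : hexagonal_eigenvalue x
  = 9 - (1 + z ^+ x.1 + z ^+ x.2) * (1 + (z ^+ x.1)^-1 + (z ^+ x.2)^-1)
    + 3 * (M%:R ^+ 2 * (x == 0)%:R).
Proof.
have w k : wave (hexagonal_step m k) x
    = match val k with 0%N => 1 | 1%N => z ^+ x.1 | _ => z ^+ x.2 end.
  rewrite /hexagonal_step /hex_vec; case: k => [[|[|[|k]]] hk] //=.
  - rewrite /wave /= mul0n addn0 exprM.
    by rewrite (prim_expr_mod zP).
  - rewrite /wave /= mul0n add0n exprM.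
    by rewrite (prim_expr_mod zP).
rewrite /hexagonal_eigenvalue /symbol /symbolN !big_ord_recl !big_ord0 !w /=.
by rewrite invr1 !addr0 !addrA.
Qed.

(* For a fixed nontrivial first frequency [w] the eigenvalue is a Laurent
   polynomial of degree one in the second one; [c] is a root of the resolvent
   quadratic that splits it into two linear factors. *)
Lemma hexagonal_row_prod (i : 'I_M) (c : C) : i != 0 -> c != 0 ->
  let w := z ^+ i in
  c ^+ 2 - (6 - w - w^-1) * c + (1 + w) * (1 + w^-1) = 0 ->
  \prod_j hexagonal_eigenvalue (i, j)
  = c ^+ M * (1 - ((1 + w^-1) / c) ^+ M) * (1 - ((1 + w) / c) ^+ M).
Proof.
move=> i0 c0 w wc.
have w0 : w != 0 by exact: prim_rootX_neq0.
have e2 : \prod_(k < M) (1 - (1 + w) / c * (z ^+ k)^-1) = 1 - ((1 + w) / c) ^+ M.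
  rewrite -prim_root_prod_mul (reindex_inj (@oppr_inj 'I_M)) /=.
  by apply: eq_bigr => k _; rewrite prim_rootV invrK.
rewrite -e2 -prim_root_prod_mul -[X in c ^+ X](card_ord M) -prodr_const -!big_split /=.
apply: eq_bigr => j _; rewrite hexagonal_eigenvalueE xpair_eqE (negbTE i0) /= mulr0 mulr0 addr0.
rewrite -/w; set y := z ^+ j.
have y0 : y != 0 by exact: prim_rootX_neq0.
have e : (1 + w) * (1 + w^-1) = (6 - w - w^-1) * c - c ^+ 2.
  by apply/eqP; rewrite -subr_eq0 -wc; apply/eqP; ring.
have -> : c * (1 - (1 + w^-1) / c * y) * (1 - (1 + w) / c * y^-1)
   = c - (1 + w^-1) * y - (1 + w) * y^-1 + ((1 + w) * (1 + w^-1)) / c * (y * y^-1).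
  by field; rewrite c0 w0 y0.
rewrite e mulrBl mulfK // expr2 mulfK // divff // mulr1.
by field; rewrite w0 y0.
Qed.

Lemma prim_root_prod_pair :
  \prod_(k < M | k != 0) ((1 - z ^+ k) * (1 - (z ^+ k)^-1)) = M%:R ^+ 2.
Proof.
have p1 : \prod_(k < M | k != 0) (1 - z ^+ k) = M%:R.
  rewrite -prim_root_prod1 big_add1 /= big_mkord.
  transitivity (\prod_(i < M) if i != 0 then 1 - z ^+ i else 1); first exact: big_mkcond.
  by rewrite big_ord_recl /= mul1r.
have p2 : \prod_(k < M | k != 0) (1 - (z ^+ k)^-1) = M%:R.
  rewrite -p1 [RHS](reindex_inj (@oppr_inj 'I_M)) /=.
  by apply: eq_big => k; rewrite ?oppr_eq0 // prim_rootV.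
by rewrite big_split /= p1 p2 expr2.
Qed.

(** At first frequency zero the quadratic has the double root 2 and its two linear factors vanish at
    second frequency zero, the kernel of the Laplacian. The perturbation replaces that eigenvalue by
    3 M^2, and the powers of M cancel those of [hexagonal_tree_det]. *)
Lemma hexagonal_row0_prod : \prod_j hexagonal_eigenvalue (0, j)
  = 3 * M%:R ^+ 2 * (2 ^+ m * M%:R ^+ 2).
Proof.
rewrite (bigD1 0) //= hexagonal_eigenvalueE /= !expr0 !invr1 mulr1.
congr (_ * _); first by ring.
have e k : k != 0 -> hexagonal_eigenvalue (0, k) = 2 * (1 - z ^+ k) * (1 - (z ^+ k)^-1).
  move=> k0; rewrite hexagonal_eigenvalueE xpair_eqE (negbTE k0) andbF mulr0 mulr0 addr0.
  rewrite /= expr0 invr1.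
  have y0 : z ^+ k != 0 by exact: prim_rootX_neq0.
  by field.
rewrite (eq_bigr _ e) !big_split /=.
rewrite -mulrA -big_split /= prim_root_prod_pair; congr (_ * _).
rewrite prodr_const; congr (_ ^+ _).
by rewrite cardC1 card_ord.
Qed.

Lemma hexagonal_tree_prod (c : 'I_M -> C) :
  (forall i : 'I_M, i != 0 -> c i != 0) ->
  (forall i : 'I_M, i != 0 -> let w := z ^+ i in
     c i ^+ 2 - (6 - w - w^-1) * c i + (1 + w) * (1 + w^-1) = 0) ->
  (num_spanning_trees H)%:R = 3 * 2 ^+ m * \prod_(i < M | i != 0)
    (c i ^+ M * (1 - ((1 + (z ^+ i)^-1) / c i) ^+ M) * (1 - ((1 + z ^+ i) / c i) ^+ M)).
Proof.
move=> c0 cP; have M0 : M%:R ^+ 4 != 0 :> C by rewrite expf_eq0 pnatr_eq0 andbF.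
apply: (mulIf M0); rewrite hexagonal_tree_det hexagonal_det.
transitivity (\prod_(i < M) \prod_(j < M) hexagonal_eigenvalue (i, j)).
  by rewrite pair_big; apply: eq_bigr => -[].
rewrite (bigD1 0) //= hexagonal_row0_prod.
rewrite (eq_bigr _ (fun i i0 => hexagonal_row_prod i0 (c0 i i0) (cP i i0))).
by ring.
Qed.

End HexagonalFourier.

(* For x = |sin (a / 2)| this is the exponential of the average over b of
   ln (6 - 2 cos a - 2 cos b - 2 cos (a - b)). *)
Definition strip_growth (R : realType) (x : R) : R :=
  2 * (1 + x ^+ 2 + x * Num.sqrt (3 + x ^+ 2)).

Section HexagonalEstimate.
Variables (R : realType) (m : nat).
Local Notation M := m.+1.
Local Notation C := (complex R).
Local Notation toC := (real_complex R).

Definition half_angle (i : nat) : R := pi * i%:R / M%:R.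

Let zeta : C := Complex (cos (half_angle 1 *+ 2)) (sin (half_angle 1 *+ 2)).

Lemma half_angle1 i : half_angle i = half_angle 1 * i%:R.
Proof. by rewrite /half_angle mulr1 mulrAC. Qed.

Lemma zetaX n : zeta ^+ n = Complex (cos (half_angle n *+ 2)) (sin (half_angle n *+ 2)).
Proof.
elim: n => [|n IH].
  by rewrite expr0 /half_angle mulr0 mul0r mul0rn cos0 sin0.
have -> : half_angle n.+1 *+ 2 = half_angle 1 *+ 2 + half_angle n *+ 2.
  by rewrite -mulrnDl (half_angle1 n.+1) (half_angle1 n) -natr1 mulrDr mulr1 addrC.
rewrite exprS IH /zeta; move: (half_angle 1 *+ 2) (half_angle n *+ 2) => t u.
rewrite cosD sinD; apply/eqP; rewrite eq_complex /=.
by apply/andP; split; apply/eqP; ring.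
Qed.

Lemma zetaXV n : (zeta ^+ n)^-1 = Complex (cos (half_angle n *+ 2)) (- sin (half_angle n *+ 2)).
Proof.
set t := half_angle n *+ 2.
have e : zeta ^+ n * Complex (cos t) (- sin t) = 1.
  rewrite zetaX -/t; apply/eqP; rewrite eq_complex /=; apply/andP; split; apply/eqP.
    by rewrite mulrN opprK -!expr2 cos2Dsin2.
  by rewrite mulrN mulrC addNr.
have z0 : zeta ^+ n != 0.
  by apply/eqP => z0; move/eqP: e; rewrite z0 mul0r eq_sym oner_eq0.
by apply: (mulfI z0); rewrite divff // e.
Qed.

Lemma half_angle_itv (i : 'I_M) : 0 <= half_angle i < pi.
Proof.
rewrite /half_angle divr_ge0 ?mulr_ge0 ?pi_ge0 //=.
by rewrite ltr_pdivrMr ?ltr0n // ltr_pM2l ?pi_gt0 // ltr_nat.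
Qed.

Lemma sin_half_angle_gt0 (i : 'I_M) : i != 0 -> 0 < sin (half_angle i).
Proof.
move=> i0; apply: sin_gt0_pi; have /andP [_ ->] := half_angle_itv i.
rewrite andbT /half_angle divr_gt0 ?mulr_gt0 ?pi_gt0 ?ltr0n //.
by rewrite lt0n; apply: contra i0 => /eqP e; apply/eqP/val_inj.
Qed.

Lemma cos_double (t : R) : cos (t *+ 2) = 1 - 2 * sin t ^+ 2.
Proof. by rewrite cos_mulr2n cos2sin2; ring. Qed.

(** For 0 < i < M the half angle lies strictly between 0 and pi, so the real part 1 - 2 sin^2 of the
    power is below 1. *)
Lemma zeta_prim : M.-primitive_root zeta.
Proof.
apply/andP; split=> //; apply/forallP => i; rewrite unity_rootE.
apply/eqP; have [e|ne] := eqVneq i.+1 M.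
  rewrite e; apply/eqP; rewrite zetaX /half_angle -mulrA divff ?mulr1 ?pnatr_eq0 //.
  by rewrite cos2pi sin2pi.
apply/negbTE; rewrite zetaX eq_complex /= negb_and; apply/orP; left.
have iM : (i.+1 < M)%N by rewrite ltn_neqAle ne ltn_ord.
have := @sin_half_angle_gt0 (Ordinal iM) isT; rewrite /= => s0.
rewrite cos_double; apply/eqP; move: s0; set s := sin _ => s0.
by nra.
Qed.

Definition row_growth (i : nat) : R := strip_growth (sin (half_angle i)).

Lemma strip_growth_ge (x : R) : 0 <= x -> 2 + 2 * x ^+ 2 <= strip_growth x.
Proof.
by move=> x0; rewrite /strip_growth; have := sqrtr_ge0 (3 + x ^+ 2); nra.
Qed.

(** The resolvent quadratic at w = exp (2 i t) with x = sin t; [strip_growth] is its larger root.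
    Half angles turn the square root of the discriminant into a multiple of sin t, which is
    nonnegative on [0, pi]. *)
Lemma strip_growth_eq (x : R) :
  strip_growth x ^+ 2 - (4 + 4 * x ^+ 2) * strip_growth x + (4 - 4 * x ^+ 2) = 0.
Proof.
rewrite /strip_growth; set r := Num.sqrt _.
have r2 : r ^+ 2 = 3 + x ^+ 2 by rewrite sqr_sqrtr // addr_ge0 // sqr_ge0.
transitivity (4 * x ^+ 2 * (r ^+ 2 - (3 + x ^+ 2))); first by ring.
by rewrite r2 subrr mulr0.
Qed.

Lemma strip_growth_gt0 (x : R) : 0 <= x -> 0 < strip_growth x.
Proof. by move/strip_growth_ge; have := sqr_ge0 x; lra. Qed.

Lemma norm_complex_real (q : C) : exists2 r : R, 0 <= r & `|q| = toC r.
Proof.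
exists (Num.sqrt ((complex.Re q) ^+ 2 + (complex.Im q) ^+ 2)); first exact: sqrtr_ge0.
exact: normc_def.
Qed.

(** The two factors are complex conjugates, so their product is |1 - rho^M|^2. Since |rho| stays
    below 1 by a multiple of 1 - cos, this is bounded below uniformly in M. *)
Lemma hexagonal_row_estimate (i : 'I_M) : i != 0 ->
  exists2 d : R, (1 - cos (half_angle i *+ 2)) / 8 <= d <= 2 &
  (1 - ((1 + (zeta ^+ i)^-1) / toC (row_growth i)) ^+ M)
    * (1 - ((1 + zeta ^+ i) / toC (row_growth i)) ^+ M) = toC (d ^+ 2).
Proof.
move=> i0; set h := row_growth i; set w := zeta ^+ i; set a := cos _.
have s0 := ltW (sin_half_angle_gt0 i0).
have h0 : 0 < h by exact: strip_growth_gt0.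
have aE : a = 1 - 2 * sin (half_angle i) ^+ 2 by exact: cos_double.
have ha : 3 - a <= h.
  by apply: le_trans (strip_growth_ge s0); rewrite aE; lra.
have a1 : -1 <= a <= 1 by rewrite cos_geN1 cos_le1.
pose rho : C := (1 + w^-1) / toC h.
have conj_rho : (1 + w) / toC h = conjc rho.
  rewrite /rho (rmorphM (@conjc R)); congr (_ * _).
    rewrite /w zetaXV zetaX; apply/eqP; rewrite eq_complex /=.
    by rewrite eqxx /=; apply/eqP; ring.
  by rewrite -[RHS]/(conjc _) conjc_inv conjc_real.
have rho2 : rho * conjc rho = toC ((2 + 2 * a) / h ^+ 2).
  rewrite -conj_rho /rho mulrACA -invfM -rmorphM -expr2 fmorph_div; congr (_ / _).
  rewrite /w zetaXV zetaX; apply/eqP; rewrite eq_complex /= -/a.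
  have := cos2Dsin2 (half_angle i *+ 2); rewrite -/a; set b := sin _ => e.
  apply/andP; split; apply/eqP; last by ring.
  by rewrite (_ : 2 + 2 * a = 1 + 2 * a + (a ^+ 2 + b ^+ 2)); [ring | rewrite e; ring].
have [r r0 rE] := norm_complex_real rho.
have r2 : (r * h) ^+ 2 = 2 + 2 * a.
  have : toC (r ^+ 2) = toC ((2 + 2 * a) / h ^+ 2).
    by rewrite rmorphXn /= -rE sqr_normc rho2.
  move/complexI => e; rewrite exprMn e divfK // expf_eq0 /=.
  by rewrite (gt_eqF h0).
have rh2 : r * h <= 2.
  have rh0 : 0 <= r * h by rewrite mulr_ge0 // ltW.
  by move: r2 rh0 a1; set y := r * h; nra.
(* From |rho| h <= 2 and h >= 3 - a, since 2 <= (1 - (1 - a) / 8)(3 - a) amounts to (5 + a)(1 - a)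
   >= 0. *)
have r8 : r <= 1 - (1 - a) / 8.
  rewrite -(ler_pM2r h0); apply: le_trans rh2 _.
  have a7 : 0 <= 1 - (1 - a) / 8 by lra.
  apply: le_trans (ler_wpM2l a7 ha); nra.
have r1 : r <= 1 by lra.
pose q : C := 1 - rho ^+ M.
have [d _ dE] := norm_complex_real q.
exists d; last first.
  have -> : 1 - ((1 + w) / toC h) ^+ M = conjc q.
    by rewrite /q (rmorphB (@conjc R)) (rmorphXn (@conjc R)) (rmorph1 (@conjc R)) conj_rho.
  by rewrite rmorphXn -[_ ^+ 2]/((toC d) ^+ 2) -dE sqr_normc.
have rM : toC (r ^+ M) = `|rho ^+ M| by rewrite normrX rE rmorphXn.
apply/andP; split.
  rewrite -lecR -dE.
  apply: le_trans (lerB_dist _ _); rewrite normr1 -rM.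
  have -> : 1 - toC (r ^+ M) = toC (1 - r ^+ M) by rewrite rmorphB rmorph1.
  rewrite lecR.
  have := exprn_ile1 m r0 r1 => rm1.
  by rewrite exprS; nra.
rewrite -lecR -dE; apply: le_trans (ler_normB _ _) _; rewrite normr1 -rM.
have -> : 1 + toC (r ^+ M) = toC (1 + r ^+ M) by rewrite rmorphD rmorph1.
rewrite lecR.
by have := exprn_ile1 M r0 r1 => rm1; lra.
Qed.

Lemma zeta_sum n : zeta ^+ n + (zeta ^+ n)^-1 = toC (2 * cos (half_angle n *+ 2)).
Proof.
rewrite zetaXV zetaX; apply/eqP; rewrite eq_complex /= addrN eqxx andbT.
by apply/eqP; ring.
Qed.

Lemma zeta_pair n : (1 + zeta ^+ n) * (1 + (zeta ^+ n)^-1) = 2 + (zeta ^+ n + (zeta ^+ n)^-1).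
Proof. by have z0 := prim_rootX_neq0 zeta_prim n; field. Qed.

Theorem hexagonal_torus_trees : exists2 d : 'I_M -> R,
  forall i : 'I_M, i != 0 -> (1 - cos (half_angle i *+ 2)) / 8 <= d i <= 2 &
  (num_spanning_trees (torus_graph hexagonal_domain m))%:R
  = 3 * 2 ^+ m * \prod_(i < M | i != 0) (row_growth i ^+ M * d i ^+ 2).
Proof.
have ex (i : 'I_M) : exists d : R, i != 0 ->
  (1 - cos (half_angle i *+ 2)) / 8 <= d <= 2 /\
  (1 - ((1 + (zeta ^+ i)^-1) / toC (row_growth i)) ^+ M)
    * (1 - ((1 + zeta ^+ i) / toC (row_growth i)) ^+ M) = toC (d ^+ 2).
  have [->|i0] := eqVneq i 0; first by exists 0.
  by have [d h1 h2] := hexagonal_row_estimate i0; exists d.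
have [d dP] := choice ex; exists d; first by move=> i /dP [].
apply: (@complexI R); rewrite rmorph_nat rmorphM rmorphM rmorphXn !rmorph_nat rmorph_prod.
rewrite (hexagonal_tree_prod zeta_prim (c := fun i => toC (row_growth i))).
- congr (_ * _); apply: eq_bigr => i i0.
  by rewrite -mulrA (dP i i0).2 -(rmorphXn (real_complex R)) -rmorphM.
- move=> i i0; rewrite -(rmorph0 (real_complex R)) (inj_eq (@complexI R)).
  by rewrite gt_eqF // strip_growth_gt0 // ltW // sin_half_angle_gt0.
- move=> i i0 w; have -> : 6 - w - w^-1 = 6 - (w + w^-1) by rewrite opprD addrA.
  rewrite /w zeta_pair zeta_sum.
  set s := sin (half_angle i).
  have -> : 6 - toC (2 * cos (half_angle i *+ 2)) = toC (4 + 4 * s ^+ 2).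
    by rewrite cos_double -/s -(rmorph_nat (real_complex R) 6) -rmorphB; congr toC; ring.
  have -> : 2 + toC (2 * cos (half_angle i *+ 2)) = toC (4 - 4 * s ^+ 2).
    by rewrite cos_double -/s -(rmorph_nat (real_complex R) 2) -rmorphD; congr toC; ring.
  by rewrite -rmorphXn -rmorphM -rmorphB -rmorphD strip_growth_eq rmorph0.
Qed.

(** Single lower bounds for [d] may be of order M^-2, but their product is known exactly, so that
    together they cost only O(M) in the logarithm. *)
Lemma prod_cos : \prod_(i < M | i != 0) (2 - 2 * cos (half_angle i *+ 2)) = M%:R ^+ 2 :> R.
Proof.
apply: (@complexI R); rewrite rmorph_prod rmorphXn rmorph_nat -(prim_root_prod_pair zeta_prim).
apply: eq_bigr => i _; rewrite rmorphB -[X in _ - X]/(toC _) -zeta_sum rmorph_nat.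
have z0 := prim_rootX_neq0 zeta_prim i.
by field.
Qed.

Lemma ln_prod (I : finType) (P : pred I) (F : I -> R) :
  (forall i, P i -> 0 < F i) -> ln (\prod_(i | P i) F i) = \sum_(i | P i) ln (F i).
Proof.
move=> F0; suff [] : ln (\prod_(i | P i) F i) = \sum_(i | P i) ln (F i) /\ 0 < \prod_(i | P i) F i by [].
apply: (big_ind2 (fun x y => ln x = y /\ 0 < x)); first by rewrite ln1 ltr01.
  by move=> x1 x2 y1 y2 [<- x0] [<- y0]; rewrite lnM ?posrE ?mulr_gt0.
by move=> i /F0.
Qed.

(** What remains besides the growth factors is ln 3 + m ln 2 + 2 B, where B, the sum of the ln (d
    i), lies between -4 m ln 2 and m ln 2. *)
Lemma hexagonal_log_estimate :
  `| ln (num_spanning_trees (torus_graph hexagonal_domain m))%:R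
     - M%:R * \sum_(i < M | i != 0) ln (row_growth i) | <= 10 * M%:R.
Proof.
have [d dP ->] := hexagonal_torus_trees.
have g0 (i : 'I_M) : i != 0 -> 0 < row_growth i.
  by move=> i0; rewrite strip_growth_gt0 // ltW // sin_half_angle_gt0.
have c0 (i : 'I_M) : i != 0 -> 0 < 1 - cos (half_angle i *+ 2).
  move=> i0; rewrite cos_double; have := sin_half_angle_gt0 i0; set s := sin _ => s0.
  by have := exprn_gt0 2 s0; lra.
have d0 (i : 'I_M) : i != 0 -> 0 < d i.
  move=> i0; have /andP [h _] := dP i i0; apply: lt_le_trans h.
  by rewrite divr_gt0 // c0.
rewrite lnM ?posrE; first last.
- by apply: prodr_gt0 => i i0; rewrite mulr_gt0 ?exprn_gt0 ?g0 ?d0.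
- by rewrite mulr_gt0 ?exprn_gt0.
rewrite lnM ?posrE ?exprn_gt0 // lnXn // ln_prod; last first.
  by move=> i i0; rewrite mulr_gt0 ?exprn_gt0 ?g0 ?d0.
have -> : \sum_(i < M | i != 0) ln (row_growth i ^+ M * d i ^+ 2)
  = M%:R * \sum_(i < M | i != 0) ln (row_growth i) + 2 * \sum_(i < M | i != 0) ln (d i).
  rewrite !mulr_sumr -big_split /=; apply: eq_bigr => i i0.
  by rewrite lnM ?posrE ?exprn_gt0 ?g0 ?d0 // !lnXn ?g0 ?d0 // !mulr_natl.
set A := M%:R * _; set B := \sum_(i < M | _) ln (d i).
have ln_le (x : R) : 0 < x -> ln x <= x - 1.
  by move=> x0; have := @le_ln1Dx R (x - 1); rewrite [1 + _]addrC subrK; apply; lra.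
have l2 := ln_le 2 (ltr0n _ 2); have l3 := ln_le 3 (ltr0n _ 3).
have l2' : 0 <= ln 2 :> R by rewrite ln_ge0 // ler1n.
have l3' : 0 <= ln 3 :> R by rewrite ln_ge0 // ler1n.
have cM : #|[pred i : 'I_M | i != 0]| = m by rewrite cardC1 card_ord.
have B1 : B <= m%:R * ln 2.
  rewrite -[X in X%:R](cM) mulr_natl -sumr_const; apply: ler_sum => i i0.
  by rewrite ler_ln ?posrE ?d0 //; have /andP [] := dP i i0.
have B2 : - (m%:R * (4 * ln 2)) <= B.
  have e : \sum_(i < M | i != 0) ln ((2 - 2 * cos (half_angle i *+ 2)) / 16) =
    2 * ln M%:R - m%:R * (4 * ln 2).
    transitivity (\sum_(i < M | i != 0) (ln (2 - 2 * cos (half_angle i *+ 2)) - 4 * ln 2)).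
      apply: eq_bigr => i i0; rewrite ln_div ?posrE //; last by have := c0 i i0; lra.
      by rewrite (_ : 16 = 2 ^+ 4) ?lnXn ?mulr_natl //; ring.
    rewrite sumrB -ln_prod => [|i i0]; last by have := c0 i i0; lra.
    rewrite prod_cos lnXn ?ltr0n // mulr_natl sumr_const.
    by set k := #|_|; have -> : k = m; [exact: cM | ring].
  have : 2 * ln M%:R - m%:R * (4 * ln 2) <= B.
    rewrite -e; apply: ler_sum => i i0; rewrite ler_ln ?posrE ?d0 //.
      by have /andP [h _] := dP i i0; apply: le_trans h; lra.
    by have := c0 i i0; lra.
  have : 0 <= ln M%:R :> R by rewrite ln_ge0 // ler1n.
  lra.
have -> : ln 3 + ln 2 *+ m + (A + 2 * B) - A = ln 3 + m%:R * ln 2 + 2 * B.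
  by rewrite mulr_natl; ring.
have mE : M%:R = m%:R + 1 :> R by rewrite -natr1.
have m0 : 0 <= m%:R :> R by rewrite ler0n.
have ml : m%:R * ln 2 <= m%:R :> R by rewrite ler_piMr //; lra.
have ml' : 0 <= m%:R * ln 2 :> R by rewrite mulr_ge0.
rewrite ler_norml mE; apply/andP; split; lra.
Qed.

End HexagonalEstimate.

Import numFieldTopology.Exports numFieldNormedType.Exports.

(** * Concavity and Lipschitz continuity of the strip entropy *)

Section StripEntropy.
Variable R : realType.
Local Notation growth := (@strip_growth R).

Lemma sqrt3D_itv (x : R) : 0 <= x <= 1 -> 1 <= Num.sqrt (3 + x ^+ 2) <= 2.
Proof.
move=> x01; have := sqrtr_ge0 (3 + x ^+ 2).
have : Num.sqrt (3 + x ^+ 2) ^+ 2 = 3 + x ^+ 2 by rewrite sqr_sqrtr // addr_ge0 // sqr_ge0.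
set r := Num.sqrt _ => e r0; apply/andP; split; nra.
Qed.

Lemma strip_growth_lipschitz (x y : R) : 0 <= y -> y <= x -> x <= 1 ->
  0 <= growth x - growth y <= 10 * (x - y).
Proof.
move=> y0 yx x1; rewrite /strip_growth.
have xi : 0 <= x <= 1 by lra.
have yi : 0 <= y <= 1 by lra.
have /andP [r1 r2] := sqrt3D_itv xi; have /andP [s1 s2] := sqrt3D_itv yi.
have er : Num.sqrt (3 + x ^+ 2) ^+ 2 = 3 + x ^+ 2 by rewrite sqr_sqrtr // addr_ge0 // sqr_ge0.
have es : Num.sqrt (3 + y ^+ 2) ^+ 2 = 3 + y ^+ 2 by rewrite sqr_sqrtr // addr_ge0 // sqr_ge0.
move: er es r1 r2 s1 s2; set r := Num.sqrt _; set s := Num.sqrt _ => er es r1 r2 s1 s2.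
have e : (r - s) * (r + s) = (x - y) * (x + y) by rewrite -!subr_sqr er es; ring.
have rs : 0 <= r - s <= x - y by apply/andP; split; nra.
by apply/andP; split; nra.
Qed.

Lemma strip_growth_le (x y : R) : 0 <= y -> y <= x -> x <= 1 -> growth y <= growth x.
Proof. by move=> y0 yx x1; have := strip_growth_lipschitz y0 yx x1; lra. Qed.

(* With z = (x + y) / 2 and d = (x - y) / 2, expand both sides and bound the
   square roots at x and y by the tangent line at z. *)
Lemma strip_growth_log_concave (x y : R) : 0 <= x -> 0 <= y ->
  growth x * growth y <= growth ((x + y) / 2) ^+ 2.
Proof.
move=> x0 y0; rewrite /strip_growth.
pose z := (x + y) / 2; pose d := (x - y) / 2.
have ex : x = z + d by rewrite /z /d; field.
have ey : y = z - d by rewrite /z /d; field.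
rewrite -/z; have dz : d ^+ 2 <= z ^+ 2 by rewrite -subr_ge0 subr_sqr mulr_ge0 // -?ex -?ey; lra.
have z0 : 0 <= z by rewrite /z; lra.
have er : Num.sqrt (3 + x ^+ 2) ^+ 2 = 3 + x ^+ 2 by rewrite sqr_sqrtr // addr_ge0 // sqr_ge0.
have es : Num.sqrt (3 + y ^+ 2) ^+ 2 = 3 + y ^+ 2 by rewrite sqr_sqrtr // addr_ge0 // sqr_ge0.
have et : Num.sqrt (3 + z ^+ 2) ^+ 2 = 3 + z ^+ 2 by rewrite sqr_sqrtr // addr_ge0 // sqr_ge0.
have t0 : 0 < Num.sqrt (3 + z ^+ 2) by rewrite sqrtr_gt0 ltr_wpDr ?sqr_ge0.
have r0 := sqrtr_ge0 (3 + x ^+ 2); have s0 := sqrtr_ge0 (3 + y ^+ 2).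
move: er es et r0 s0 t0; set r := Num.sqrt _; set s := Num.sqrt _; set t := Num.sqrt _.
move=> er es et r0 s0 t0.
have hrs : r * s <= 3 + z ^+ 2 + d ^+ 2.
  have : 2 * (r * s) <= r ^+ 2 + s ^+ 2 by have := sqr_ge0 (r - s); rewrite sqrrB; lra.
  by rewrite er es ex ey; lra.
have xy0 : 0 <= x * y by rewrite mulr_ge0.
have h1 : x * y * (r * s) <= z ^+ 2 * (3 + z ^+ 2) - 3 * d ^+ 2 - d ^+ 4.
  apply: le_trans (ler_wpM2l xy0 hrs) _.
  by rewrite {1}ex {1}ey le_eqVlt; apply/orP; left; apply/eqP; ring.
have hr : r * t <= 3 + z ^+ 2 + (x ^+ 2 - z ^+ 2) / 2.
  by have := sqr_ge0 (r - t); rewrite sqrrB er et; lra.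
have hs : s * t <= 3 + z ^+ 2 + (y ^+ 2 - z ^+ 2) / 2.
  by have := sqr_ge0 (s - t); rewrite sqrrB es et; lra.
have h2 : x * r * (1 + y ^+ 2) + y * s * (1 + x ^+ 2) <= 2 * z * t * (1 + z ^+ 2).
  rewrite -(ler_pM2r t0).
  have -> : 2 * z * t * (1 + z ^+ 2) * t = 2 * z * (3 + z ^+ 2) * (1 + z ^+ 2).
    by rewrite -et; ring.
  have -> : (x * r * (1 + y ^+ 2) + y * s * (1 + x ^+ 2)) * t
    = x * (1 + y ^+ 2) * (r * t) + y * (1 + x ^+ 2) * (s * t) by ring.
  have p1 : 0 <= x * (1 + y ^+ 2) by rewrite mulr_ge0 // addr_ge0 // sqr_ge0.
  have p2 : 0 <= y * (1 + x ^+ 2) by rewrite mulr_ge0 // addr_ge0 // sqr_ge0.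
  apply: le_trans (lerD (ler_wpM2l p1 hr) (ler_wpM2l p2 hs)) _.
  rewrite ex ey -subr_ge0.
  have -> : 2 * z * (3 + z ^+ 2) * (1 + z ^+ 2) -
     ((z + d) * (1 + (z - d) ^+ 2) * (3 + z ^+ 2 + ((z + d) ^+ 2 - z ^+ 2) / 2) +
      (z - d) * (1 + (z + d) ^+ 2) * (3 + z ^+ 2 + ((z - d) ^+ 2 - z ^+ 2) / 2))
     = z * d ^+ 2 * (3 + 3 * z ^+ 2 - d ^+ 2) by field.
  by rewrite mulr_ge0 ?(mulr_ge0 z0 (sqr_ge0 d)) //; move: (sqr_ge0 z) dz; lra.
have h3 : (1 + x ^+ 2) * (1 + y ^+ 2) = (1 + z ^+ 2) ^+ 2 + 2 * d ^+ 2 - 2 * z ^+ 2 * d ^+ 2 + d ^+ 4.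
  by rewrite ex ey; ring.
have d2 := sqr_ge0 d; have z2 := sqr_ge0 z; have zd : 0 <= z ^+ 2 * d ^+ 2 by rewrite mulr_ge0.
have -> : 2 * (1 + x ^+ 2 + x * r) * (2 * (1 + y ^+ 2 + y * s)) = 4 * ((1 + x ^+ 2) * (1 + y ^+ 2)
  + x * y * (r * s) + (x * r * (1 + y ^+ 2) + y * s * (1 + x ^+ 2))) by ring.
have -> : (2 * (1 + z ^+ 2 + z * t)) ^+ 2 = 4 * ((1 + z ^+ 2) ^+ 2 + z ^+ 2 * t ^+ 2
  + 2 * z * t * (1 + z ^+ 2)) by ring.
by rewrite h3 et; lra.
Qed.

Definition strip_entropy (t : R) : R := ln (growth (sin t)).

Lemma sin_itv (t : R) : 0 <= t <= pi -> 0 <= sin t <= 1.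
Proof. by move=> /sin_ge0_pi ->; rewrite sin_le1. Qed.

(** The sine is midpoint concave on [0, pi], and the growth is increasing and midpoint
    log-concave. *)
Lemma strip_entropy_concave (c h : R) : 0 <= c - h -> c + h <= pi -> 0 <= h ->
  strip_entropy (c - h) + strip_entropy (c + h) <= 2 * strip_entropy c.
Proof.
move=> ch1 ch2 h0; rewrite /strip_entropy.
have i1 : 0 <= c - h <= pi by lra.
have i2 : 0 <= c + h <= pi by lra.
have i3 : 0 <= c <= pi by lra.
have /andP [a0 a1] := sin_itv i1; have /andP [b0 b1] := sin_itv i2; have /andP [e0 e1] := sin_itv i3.
have mid : (sin (c - h) + sin (c + h)) / 2 <= sin c.
  rewrite sinB sinD; have := cos_le1 h; set u := cos h => u1.
  rewrite (_ : _ / 2 = sin c * u); last by field.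
  by rewrite ler_piMr.
have g1 := strip_growth_gt0 a0; have g2 := strip_growth_gt0 b0; have g3 := strip_growth_gt0 e0.
rewrite -lnM ?posrE // [2 * _]mulr_natl -lnXn // ler_ln ?posrE ?exprn_gt0 //; last exact: mulr_gt0.
apply: le_trans (strip_growth_log_concave a0 b0) _.
have m0 : 0 <= (sin (c - h) + sin (c + h)) / 2 by rewrite divr_ge0 ?addr_ge0.
have gm := strip_growth_gt0 m0.
by rewrite ler_sqr ?nnegrE ?(ltW g3) ?(ltW gm) //; exact: strip_growth_le.
Qed.

Lemma sin_lipschitz (p q : R) : p <= q -> `|sin q - sin p| <= q - p.
Proof.
rewrite le_eqVlt => /predU1P [->|pq]; first by rewrite !subrr normr0.
have [|c _ ->] := @MVT R (@sin R) (@cos R) p q pq (fun x _ => is_derive_sin x).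
  by apply: continuous_subspaceT; exact: continuous_sin.
rewrite normrM (ger0_norm (x := q - p)) ?subr_ge0 ?(ltW pq) //.
by rewrite ler_piMl ?subr_ge0 ?(ltW pq) // cos_max.
Qed.

Lemma ln_lipschitz (x y : R) : 2 <= y -> y <= x -> 0 <= ln x - ln y <= (x - y) / 2.
Proof.
move=> y2 yx; have y0 : 0 < y by lra.
have x0 : 0 < x by lra.
apply/andP; split; first by rewrite subr_ge0 ler_ln ?posrE.
rewrite -ln_div ?posrE //.
have -> : x / y = 1 + (x - y) / y by rewrite mulrBl divff ?gt_eqF // addrC subrK.
apply: le_trans (le_ln1Dx _) _; first by apply: lt_le_trans (_ : 0 <= _); rewrite ?divr_ge0 //; lra.
by rewrite ler_wpM2l ?subr_ge0 // lef_pV2 ?posrE.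
Qed.

(** The constant is 10 / 2: the growth is 10-Lipschitz on [0, 1] and at least 2, where [ln] has
    slope at most 1 / 2. *)
Lemma strip_entropy_lipschitz (p q : R) : 0 <= p <= pi -> 0 <= q <= pi ->
  `|strip_entropy p - strip_entropy q| <= 5 * `|p - q|.
Proof.
move=> hp hq; have /andP [a0 a1] := sin_itv hp; have /andP [b0 b1] := sin_itv hq.
have sl : `|sin p - sin q| <= `|p - q|.
  have [pq|qp] := leP p q.
    by rewrite distrC [`|p - q|]distrC (ger0_norm (x := q - p)) ?subr_ge0 //; exact: sin_lipschitz.
  by rewrite (ger0_norm (x := p - q)) ?subr_ge0 ?(ltW qp) //; apply: sin_lipschitz; exact: ltW.
have key x y : 0 <= y -> y <= x -> x <= 1 -> `|ln (growth x) - ln (growth y)| <= 5 * (x - y).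
  move=> y0 yx x1; have /andP [l1 l2] := strip_growth_lipschitz y0 yx x1.
  have g2 : 2 <= growth y by apply: le_trans (strip_growth_ge y0); have := sqr_ge0 y; lra.
  have /andP [k1 k2] : 0 <= ln (growth x) - ln (growth y) <= (growth x - growth y) / 2.
    by apply: ln_lipschitz => //; lra.
  by rewrite ger0_norm //; lra.
rewrite /strip_entropy; apply: le_trans (_ : 5 * `|sin p - sin q| <= _); last by lra.
have [pq|qp] := leP (sin p) (sin q).
  by rewrite distrC [`|sin p - _|]distrC (ger0_norm (x := sin q - _)) ?subr_ge0 //; exact: key.
by rewrite (ger0_norm (x := sin p - _)) ?subr_ge0 ?(ltW qp) //; apply: key => //; exact: ltW.
Qed.

End StripEntropy.

Lemma sum_nat_mul (V : nmodType) (f : nat -> V) n k :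
  \sum_(0 <= l < n * k) f l = \sum_(0 <= i < n) \sum_(0 <= j < k) f (i * k + j)%N.
Proof.
elim: n => [|n ih]; first by rewrite mul0n !big_geq.
rewrite big_nat_recr //= -ih (@big_cat_nat _ _ _ (n * k)) ?leq_mul //=.
congr (_ + _); rewrite mulSn -{1}[(n * k)%N]add0n big_addn addnK.
by apply: eq_bigr => i _; rewrite addnC.
Qed.

(** * Riemann sums of Lipschitz and of concave functions *)

Section RiemannSums.
Variables (R : realType) (g : R -> R) (K : R).
Hypothesis K_ge0 : 0 <= K.
Hypothesis lip : forall x y, 0 <= x <= 1 -> 0 <= y <= 1 -> `|g x - g y| <= K * `|x - y|.

Definition left_sum n : R := (\sum_(0 <= i < n) g (i%:R / n%:R)) / n%:R.

Definition mid_sum n : R := (\sum_(0 <= i < n) g ((2 * i + 1)%:R / (2 * n)%:R)) / n%:R.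

Lemma frac_itv i n : (i <= n)%N -> 0 <= (i%:R / n%:R : R) <= 1.
Proof.
case: n => [|n] le_in; first by move: le_in; rewrite leqn0 => /eqP ->; rewrite mul0r lexx ler01.
by rewrite divr_ge0 //= ler_pdivrMr ?ltr0n // mul1r ler_nat.
Qed.

Lemma left_sum_refine n k : (0 < n)%N -> (0 < k)%N ->
  `|left_sum n - left_sum (n * k)| <= K / n%:R.
Proof.
move=> n0 k0; have n0R : 0 < n%:R :> R by rewrite ltr0n.
have k0R : 0 < k%:R :> R by rewrite ltr0n.
rewrite /left_sum sum_nat_mul.
have -> : (\sum_(0 <= i < n) g (i%:R / n%:R)) / n%:R
  = (\sum_(0 <= i < n) \sum_(0 <= j < k) g (i%:R / n%:R)) / (n * k)%:R :> R.
  under [X in _ = X / _]eq_bigr => i _ do rewrite sumr_const_nat subn0.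
  by rewrite sumrMnl -[_ *+ k]mulr_natr natrM invfM mulrACA divff ?mulr1 // gt_eqF.
rewrite -mulrBl normrM -sumrB.
rewrite [X in _ * X]ger0_norm ?invr_ge0 // ler_pdivrMr ?ltr0n ?muln_gt0 ?n0 //.
have -> : K / n%:R * (n * k)%:R = K * k%:R by rewrite natrM; field; rewrite gt_eqF.
apply: le_trans (ler_norm_sum _ _ _) _.
apply: le_trans (_ : \sum_(0 <= i < n) \sum_(0 <= j < k) K / n%:R <= _); last first.
  by rewrite !sumr_const_nat !subn0 -mulrnA -[_ *+ _]mulr_natr natrM le_eqVlt; apply/orP; left; apply/eqP; field; rewrite gt_eqF.
rewrite !big_mkord; apply: ler_sum => i _; rewrite -sumrB.
apply: le_trans (ler_norm_sum _ _ _) _.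
rewrite !big_mkord; apply: ler_sum => j _.
have lt_l : (i * k + j <= n * k)%N.
  by apply: leq_trans (_ : (i.+1 * k <= _)%N); rewrite ?leq_mul // mulSn addnC leq_add // ltnW.
apply: le_trans (lip (frac_itv _) (frac_itv lt_l)) _; first exact: ltnW.
rewrite ler_wpM2l //.
rewrite natrD !natrM (_ : _ / _ - _ = - (j%:R / k%:R / n%:R)); last first.
  by field; rewrite ?gt_eqF.
rewrite normrN ger0_norm ?divr_ge0 // ler_piMl ?invr_ge0 ?(ltW n0R) //.
by have /andP [] := frac_itv (ltnW (ltn_ord j)).
Qed.

(** The integral of [g] over [0, 1], as the supremum of the certified lower bounds; comparing two
    sums through their common refinement shows that each lower bound is below each upper one. *)
Definition riemann_limit : R :=
  sup [set x | exists2 n, (0 < n)%N & x = left_sum n - K / n%:R]%classic.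

Lemma left_sum_cross n k : (0 < n)%N -> (0 < k)%N ->
  left_sum n - K / n%:R <= left_sum k + K / k%:R.
Proof.
move=> n0 k0; have := left_sum_refine n0 k0; have := left_sum_refine k0 n0.
by rewrite mulnC !ler_norml; lra.
Qed.

Lemma left_sum_limit n : (0 < n)%N -> `|left_sum n - riemann_limit| <= K / n%:R.
Proof.
move=> n0; rewrite ler_norml; apply/andP; split.
  rewrite -lerNl opprB lerBlDl; apply: ge_sup.
    by exists (left_sum 1 - K / 1%:R), 1%N.
  by move=> _ [k k0 ->]; exact: left_sum_cross.
rewrite lerBlDr -lerBlDl; apply: ub_le_sup; last by exists n.
by exists (left_sum 1 + K / 1%:R) => _ [k k0 ->]; exact: left_sum_cross.
Qed.

Lemma le_riemann_limit (x : R) : (forall k, exists2 n, (k <= n)%N & x <= left_sum n) -> x <= riemann_limit.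
Proof.
move=> h; apply/ler_addgt0Pr => e e0.
have [n ltn le_x] := h (Num.bound (K / e)).+1.
have n0 : (0 < n)%N by apply: leq_trans ltn.
have n0R : 0 < n%:R :> R by rewrite ltr0n.
have : K / n%:R <= e.
  rewrite ler_pdivrMr // -ler_pdivrMl // [e^-1 * _]mulrC.
  have : K / e < (Num.bound (K / e))%:R by apply: archi_boundP; rewrite divr_ge0 ?(ltW e0).
  have : (Num.bound (K / e))%:R <= n%:R :> R by rewrite ler_nat ltnW.
  lra.
by have := left_sum_limit n0; rewrite ler_norml; lra.
Qed.

(** Among the 2n nodes of the fine left sum, the even ones are the coarse nodes and the odd ones the
    midpoints. *)
Lemma mid_sumE n : (0 < n)%N -> mid_sum n = 2 * left_sum (2 * n) - left_sum n.
Proof.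
move=> n0; have n0R : n%:R != 0 :> R by rewrite pnatr_eq0 -lt0n.
rewrite /left_sum [X in 2 * (X / _)](_ : _ = \sum_(0 <= i < n) g (i%:R / n%:R)
  + \sum_(0 <= i < n) g ((2 * i + 1)%:R / (2 * n)%:R)).
  by rewrite /mid_sum natrM; field.
rewrite mulnC sum_nat_mul -big_split /=; apply: eq_bigr => i _.
rewrite big_nat_recr //= big_nat1 addn0 ![(i * 2)%N]mulnC; congr (g _ + g _).
by rewrite !natrM; field.
Qed.

Lemma riemann_limit_le (x : R) : (forall k, exists2 n, (k <= n)%N & mid_sum n <= x) -> riemann_limit <= x.
Proof.
move=> h; apply/ler_addgt0Pr => e e0.
have [n ltn le_x] := h (Num.bound (2 * K / e)).+1.
have n0 : (0 < n)%N by apply: leq_trans ltn.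
have n0R : 0 < n%:R :> R by rewrite ltr0n.
have : 2 * K / n%:R <= e.
  rewrite ler_pdivrMr // -ler_pdivrMl // [e^-1 * _]mulrC.
  have : 2 * K / e < (Num.bound (2 * K / e))%:R by apply: archi_boundP; rewrite divr_ge0 ?(ltW e0) ?mulr_ge0.
  have : (Num.bound (2 * K / e))%:R <= n%:R :> R by rewrite ler_nat ltnW.
  lra.
have n20 : (0 < 2 * n)%N by rewrite muln_gt0.
have := left_sum_limit n0; have := left_sum_limit n20; rewrite !ler_norml.
move: le_x; rewrite mid_sumE // natrM invfM; set a := left_sum _; set b := left_sum _.
by rewrite -[2 * K / _]mulrA; set u := K / n%:R; rewrite [K * _](_ : _ = u / 2) /u; [lra | ring].
Qed.

Hypothesis conc : forall c h, 0 <= c - h -> c + h <= 1 -> 0 <= h -> g (c - h) + g (c + h) <= 2 * g c.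
Hypothesis g01 : g 1 = g 0.

(** As [g] agrees at the endpoints, the left sum is the trapezoidal sum, which for a concave
    function is at most the midpoint sum. *)
Lemma left_sum_double n : (0 < n)%N -> left_sum n <= left_sum (2 * n).
Proof.
move=> n0; have n0R : 0 < n%:R :> R by rewrite ltr0n.
suff : left_sum n <= mid_sum n by rewrite mid_sumE //; lra.
rewrite /left_sum /mid_sum ler_pM2r ?invr_gt0 //.
have tel : \sum_(0 <= i < n) (g (i.+1%:R / n%:R) - g (i%:R / n%:R)) = 0.
  by rewrite (telescope_sumr (fun i => g (i%:R / n%:R))) // mul0r divff ?gt_eqF // g01 subrr.
suff : 2 * (\sum_(0 <= i < n) g (i%:R / n%:R))
    + \sum_(0 <= i < n) (g (i.+1%:R / n%:R) - g (i%:R / n%:R))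
    <= 2 * \sum_(0 <= i < n) g ((2 * i + 1)%:R / (2 * n)%:R).
  by rewrite tel addr0 ler_pM2l.
rewrite !mulr_sumr -big_split /=.
rewrite !big_mkord; apply: ler_sum => i _.
have -> : 2 * g (i%:R / n%:R) + (g (i.+1%:R / n%:R) - g (i%:R / n%:R))
  = g (i%:R / n%:R) + g (i.+1%:R / n%:R) by ring.
set c := (_ + _)%:R / _.
have eh : 0 <= (2 * n)%:R^-1 :> R by rewrite invr_ge0.
have e1 : i%:R / n%:R = c - (2 * n)%:R^-1.
  by rewrite /c natrD !natrM; field; rewrite gt_eqF.
have e2 : i.+1%:R / n%:R = c + (2 * n)%:R^-1.
  by rewrite /c natrD !natrM -natr1; field; rewrite gt_eqF.
have /andP [? ?] := frac_itv (ltnW (ltn_ord i)); have /andP [? ?] := frac_itv (ltn_ord i).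
by rewrite e1 e2; apply: conc; rewrite // -?e1 -?e2.
Qed.

Lemma left_sum_le_limit n : (0 < n)%N -> left_sum n <= riemann_limit.
Proof.
move=> n0; apply: le_riemann_limit => k; exists (2 ^ k * n)%N.
  by apply: leq_trans (ltnW (ltn_expl k (isT : (1 < 2)%N))) _; rewrite leq_pmulr.
elim: k => [|k ih]; first by rewrite mul1n.
by rewrite expnS -mulnA; apply: le_trans ih _; apply: left_sum_double; rewrite muln_gt0 expn_gt0.
Qed.

(** Cutting a cell into three keeps its midpoint as a node and adds two nodes symmetric about it;
    concavity bounds their mean. Halving would lose the old nodes. *)
Lemma mid_sum_triple n : (0 < n)%N -> mid_sum (n * 3) <= mid_sum n.
Proof.
move=> n0; have n0R : 0 < n%:R :> R by rewrite ltr0n.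
rewrite /mid_sum [(n * 3)%:R]natrM invfM mulrA ler_pdivrMr // mulrAC ler_pM2r ?invr_gt0 //.
rewrite sum_nat_mul mulr_suml !big_mkord; apply: ler_sum => i _.
rewrite !big_nat_recr //= big_geq // add0r addn0.
set c := (2 * i + 1)%:R / _; set h : R := (3 * n)%:R^-1.
have h0 : 0 <= h by rewrite invr_ge0.
have -> : (2 * (i * 3) + 1)%:R / (2 * (n * 3))%:R = c - h.
  by rewrite /c /h !(natrD, natrM); field; rewrite gt_eqF.
have -> : (2 * (i * 3 + 1) + 1)%:R / (2 * (n * 3))%:R = c.
  by rewrite /c !(natrD, natrM); field; rewrite gt_eqF.
have e3 : (2 * (i * 3 + 2) + 1)%:R / (2 * (n * 3))%:R = c + h.
  by rewrite /c /h !(natrD, natrM); field; rewrite gt_eqF.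
rewrite e3; suff : g (c - h) + g (c + h) <= 2 * g c by lra.
apply: conc => //.
  rewrite (_ : c - h = (6 * i + 1)%:R / (6 * n)%:R) ?divr_ge0 //.
  by rewrite /c /h !(natrD, natrM); field; rewrite gt_eqF.
have le_in : (2 * (i * 3 + 2) + 1 <= 2 * (n * 3))%N by have := ltn_ord i; lia.
by rewrite -e3; have /andP [] := frac_itv le_in.
Qed.

Lemma limit_le_mid_sum n : (0 < n)%N -> riemann_limit <= mid_sum n.
Proof.
move=> n0; apply: riemann_limit_le => k; exists (n * 3 ^ k)%N.
  by apply: leq_trans (ltnW (ltn_expl k (isT : (1 < 3)%N))) _; rewrite leq_pmull.
elim: k => [|k ih]; first by rewrite muln1.
by rewrite expnSr mulnA; apply: le_trans ih; apply: mid_sum_triple; rewrite muln_gt0 n0 expn_gt0.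
Qed.

End RiemannSums.

(** With x = pi / 6, the relation sin x = cos (2 x) = 1 - 2 sin^2 x has a single positive
    solution. *)
Lemma sin_pi6 (R : realType) : sin (pi / 6) = 1 / 2 :> R.
Proof.
have pi0 := pi_gt0 R.
have e : sin (pi / 6) = 1 - 2 * sin (pi / 6) ^+ 2 :> R.
  have -> : 1 - 2 * sin (pi / 6) ^+ 2 = cos (pi / 6 *+ 2) :> R.
    by rewrite cos_mulr2n cos2sin2; ring.
  by rewrite -cosBpihalf -cosN mulr2n; congr cos; field.
have s0 : 0 < sin (pi / 6) :> R by apply: sin_gt0_pi; lra.
nra.
Qed.

Lemma sqr_sin_pi3 (R : realType) : sin (pi / 3) ^+ 2 = 3 / 4 :> R.
Proof.
have := cos2Dsin2 (pi / 3 : R).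
have -> : cos (pi / 3) = 1 / 2 :> R.
  by rewrite -(sin_pi6 R) -cosBpihalf -[RHS]cosN; congr cos; field.
by rewrite expr2; lra.
Qed.

(** * The hexagonal entropy and its bounds *)

Section HexagonalEntropy.
Variable R : realType.
Local Notation se := (@strip_entropy R).

Let g (x : R) : R := se (pi * x).

(* Twice the spanning tree entropy of the hexagonal lattice, which has two
   vertices per cell. *)
Definition hexagonal_entropy : R := riemann_limit g (5 * pi).

Let K_ge0 : 0 <= 5 * pi :> R.
Proof. by rewrite mulr_ge0 // pi_ge0. Qed.

Let g_lip x y : 0 <= x <= 1 -> 0 <= y <= 1 -> `|g x - g y| <= 5 * pi * `|x - y|.
Proof.
move=> /andP [x0 x1] /andP [y0 y1]; have pi0 := pi_ge0 R.
apply: le_trans (strip_entropy_lipschitz _ _) _.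
- by rewrite mulr_ge0 //= ler_piMr.
- by rewrite mulr_ge0 //= ler_piMr.
by rewrite -mulrBr normrM (ger0_norm pi0) mulrA.
Qed.

Let g_conc c h : 0 <= c - h -> c + h <= 1 -> 0 <= h -> g (c - h) + g (c + h) <= 2 * g c.
Proof.
move=> ch1 ch2 h0; have pi0 := pi_ge0 R.
rewrite /g mulrBr mulrDr; apply: strip_entropy_concave.
- by rewrite -mulrBr mulr_ge0.
- by rewrite -mulrDr ler_piMr.
- by rewrite mulr_ge0.
Qed.

Let g01 : g 1 = g 0.
Proof. by rewrite /g /strip_entropy mulr1 mulr0 sinpi sin0. Qed.

Let g0 : g 0 = ln 2.
Proof. by rewrite /g /strip_entropy mulr0 sin0 /strip_growth expr0n /= mul0r !addr0 mulr1. Qed.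

Lemma hexagonal_torus_entropy m :
  `| ln (num_spanning_trees (torus_graph hexagonal_domain m))%:R
     - m.+1%:R ^+ 2 * hexagonal_entropy | <= (11 + 5 * pi) * m.+1%:R.
Proof.
have M0 : 0 < m.+1%:R :> R by rewrite ltr0n.
have h1 := hexagonal_log_estimate R m.
have h2 := left_sum_limit K_ge0 g_lip (ltn0Sn m).
(* The term at frequency zero, equal to ln 2, belongs to the left sum but not to the product; it
   costs M ln 2 <= M, whence 11 in place of 10. *)
have e : \sum_(i < m.+1 | i != 0) ln (row_growth R m i) = m.+1%:R * left_sum g m.+1 - ln 2.
  rewrite /left_sum mulrCA divff ?gt_eqF // mulr1 big_mkord [in RHS](bigD1 ord0) //.
  rewrite (_ : g (_ / _) = ln 2) ?mul0r // addrAC subrr add0r.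
  by apply: eq_bigr => i _; rewrite /row_growth /half_angle /g /strip_entropy mulrA.
have l2 : 0 <= (ln 2 : R) <= 1.
  rewrite ln_ge0 ?ler1n //= (_ : 2 = 1 + 1 :> R) //.
  by apply: le_ln1Dx; lra.
rewrite e in h1.
have h3 : `|m.+1%:R ^+ 2 * left_sum g m.+1 - m.+1%:R ^+ 2 * hexagonal_entropy| <= 5 * pi * m.+1%:R.
  rewrite -mulrBr normrM ger0_norm ?sqr_ge0 // -ler_pdivlMl ?exprn_gt0 //.
  apply: le_trans h2 _; rewrite le_eqVlt; apply/orP; left; apply/eqP.
  by field; rewrite gt_eqF.
move: h1 h3; rewrite mulrBr mulrA -expr2 !ler_norml.
have /andP [l20 l21] := l2.
have : m.+1%:R * ln 2 <= m.+1%:R * 1 :> R by exact: ler_wpM2l (ltW M0) _ _ l21.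
have : 0 <= m.+1%:R * ln 2 :> R by exact: mulr_ge0 (ltW M0) l20.
set A := ln _%:R; set B := _ * left_sum _ _; set D := _ * ln 2; set E := _ * hexagonal_entropy.
lra.
Qed.

Let growth_pi6 : 2151 / 500 <= (strip_growth (sin (pi / 6)) : R) <= 4303 / 1000.
Proof.
rewrite sin_pi6 /strip_growth.
have r0 := sqrtr_ge0 (3 + (1 / 2) ^+ 2 : R).
have : Num.sqrt (3 + (1 / 2) ^+ 2) ^+ 2 = 3 + (1 / 2) ^+ 2 :> R.
  by rewrite sqr_sqrtr // addr_ge0 // sqr_ge0.
move: r0; set r := Num.sqrt _ => r0 e; apply/andP; split; nra.
Qed.

Let growth_pi3 : 3427 / 500 <= strip_growth (sin (pi / 3)) :> R.
Proof.
rewrite /strip_growth sqr_sin_pi3.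
have pi0 := pi_gt0 R.
have s0 : 0 < sin (pi / 3) :> R by apply: sin_gt0_pi; lra.
have r0 := sqrtr_ge0 (3 + 3 / 4 : R).
have e : Num.sqrt (3 + 3 / 4) ^+ 2 = 3 + 3 / 4 :> R by rewrite sqr_sqrtr //; lra.
have : (sin (pi / 3) * Num.sqrt (3 + 3 / 4)) ^+ 2 = 3 / 4 * (3 + 3 / 4) :> R.
  by rewrite exprMn e sqr_sin_pi3.
have : 0 <= sin (pi / 3) * Num.sqrt (3 + 3 / 4) :> R by rewrite mulr_ge0 // ltW.
set y := _ * _ => y0 ey; nra.
Qed.

Let growth_pihalf : strip_growth (sin (pi / 2)) = 8 :> R.
Proof.
rewrite sin_pihalf /strip_growth expr1n (_ : 3 + 1 = 2 ^+ 2); last by ring.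
by rewrite sqrtr_sqr ger0_norm //; ring.
Qed.

Let sin_reflect (x y : R) : x + y = pi -> sin x = sin y.
Proof. by move=> e; rewrite -[RHS]opprK -sinN -[RHS]opprK -sinDpi opprK; congr sin; lra. Qed.

(** The left sum with six nodes, paired by the symmetry of the sine: its terms are the logarithms of
    2, a, b, 8, b, a, and 16 (a b)^2 exceeds 13900. *)
Lemma hexagonal_entropy_ge : ln (139 * 100) <= 6 * hexagonal_entropy.
Proof.
have := left_sum_le_limit K_ge0 g_lip g_conc g01 (isT : (0 < 6)%N).
rewrite /left_sum !big_nat_recr //= big_geq // add0r mul0r g0 -/hexagonal_entropy.
rewrite ler_pdivrMr // [_ * 6]mulrC; apply: le_trans.
have /andP [a1 _] := growth_pi6; have b1 := growth_pi3.
have -> : g (1%:R / 6%:R) = ln (strip_growth (sin (pi / 6))) by rewrite /g /strip_entropy mul1r.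
have -> : g (2%:R / 6%:R) = ln (strip_growth (sin (pi / 3))).
  by rewrite /g /strip_entropy; congr (ln (strip_growth (sin _))); field.
have -> : g (3%:R / 6%:R) = ln 8.
  by rewrite -growth_pihalf /g /strip_entropy; congr (ln (strip_growth (sin _))); field.
have -> : g (4%:R / 6%:R) = ln (strip_growth (sin (pi / 3))).
  by rewrite /g /strip_entropy; congr (ln (strip_growth _)); apply: sin_reflect; field.
have -> : g (5%:R / 6%:R) = ln (strip_growth (sin (pi / 6))).
  by rewrite /g /strip_entropy; congr (ln (strip_growth _)); apply: sin_reflect; field.
set a := strip_growth _ in a1 *; set b := strip_growth _ in b1 *.
clearbody a b.
have a0 : 0 < a by lra.
have b0 : 0 < b by lra.
rewrite -!lnM ?posrE ?mulr_gt0 // ler_ln ?posrE ?mulr_gt0 //.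
have -> : 2 * a * b * 8 * b * a = 16 * (a * b) ^+ 2 by ring.
have : 737 / 25 <= a * b by nra.
by set y := a * b => hy; nra.
Qed.

(** The midpoint sum with the three nodes pi / 6, pi / 2, 5 pi / 6: the product 8 a^2 stays below
    148.2. *)
Lemma hexagonal_entropy_le : 3 * hexagonal_entropy <= ln (741 / 5).
Proof.
have := limit_le_mid_sum K_ge0 g_lip g_conc (isT : (0 < 3)%N).
rewrite /mid_sum !big_nat_recr //= big_geq // add0r -/hexagonal_entropy.
rewrite ler_pdivlMr // mulrC => /le_trans; apply.
have /andP [a1 a2] := growth_pi6.
have -> : g ((2 * 0 + 1)%:R / (2 * 3)%:R) = ln (strip_growth (sin (pi / 6))) by rewrite /g /strip_entropy mul1r.
have -> : g ((2 * 1 + 1)%:R / (2 * 3)%:R) = ln 8.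
  by rewrite -growth_pihalf /g /strip_entropy; congr (ln (strip_growth (sin _))); field.
have -> : g ((2 * 2 + 1)%:R / (2 * 3)%:R) = ln (strip_growth (sin (pi / 6))).
  by rewrite /g /strip_entropy; congr (ln (strip_growth _)); apply: sin_reflect; field.
set a := strip_growth _ in a1 a2 *.
clearbody a.
have a0 : 0 < a by lra.
rewrite -!lnM ?posrE ?mulr_gt0 //.
have : a * a <= 463 / 25 by nra.
have [c ec] : exists c : R, c = 741 / 5 by exists (741 / 5).
have c0 : 0 < c by lra.
rewrite -ec ler_ln ?posrE ?mulr_gt0 //; lra.
Qed.

End HexagonalEntropy.

(** * Spanning tree entropy *)

Lemma hexagonal_torus_gt0 m : (0 < num_spanning_trees (torus_graph hexagonal_domain m))%N.
Proof.
apply: leq_trans (block_le_torus _ _); apply: num_spanning_trees_gt0.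
by have [_ conn] := hexagonal_admissible; exact: conn.
Qed.

Section TorusEntropy.
Variable R : realType.

Lemma card_truncated_torus n (c : dart (truncated_hexagonal n) -> int * int) m :
  #|vertex (torus_graph c m)| = (2 * 3 ^ n * m.+1 ^ 2)%N.
Proof. by rewrite -card_truncated_vertices -(card_block_vertex c). Qed.

Lemma card_medial_torus n (c : dart (medial_truncated_hexagonal n) -> int * int) m :
  #|vertex (torus_graph c m)| = (3 * 3 ^ n * m.+1 ^ 2)%N.
Proof. by rewrite -card_medial_truncated_vertices -(card_block_vertex c). Qed.

(** Each truncation adds half the logarithm of 15 per vertex, and the 2 * 3^n vertices per cell give
    a geometric sum. The constant ln (5 / 3) per step does not depend on the size of the torus. *)
Lemma truncated_torus_entropy n : exists2 c : dart (truncated_hexagonal n) -> int * int,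
  fundamental_domain c & forall m, (0 < num_spanning_trees (torus_graph c m))%N /\
    ln (num_spanning_trees (torus_graph c m))%:R
    = ln (num_spanning_trees (torus_graph hexagonal_domain m))%:R
      + m.+1%:R ^+ 2 * ((3 ^+ n - 1) / 2 * ln 15) + n%:R * ln (5 / 3) :> R.
Proof.
elim: n => [|n [c fc ih]].
  exists hexagonal_domain; first exact: hexagonal_fundamental.
  move=> m; split; first exact: hexagonal_torus_gt0.
  by rewrite expr0 subrr !mul0r mulr0 !addr0.
have [c' [fc' _]] := truncated_hexagonal_admissible n.+1; exists c' => // m.
have [t0 e] := ih m.
have V0 : (0 < #|vertex (torus_graph c m)|)%N.
  by rewrite card_truncated_torus !muln_gt0 !expn_gt0.
have := trunc_torus_count (@truncated_hexagonal_cubic n) fc fc' V0 R.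
rewrite card_truncated_torus.
set t' := num_spanning_trees _ => h.
have t0R : 0 < (num_spanning_trees (torus_graph c m))%:R :> R by rewrite ltr0n.
have p0 : 0 < 15 ^+ (2 * 3 ^ n * m.+1 ^ 2) :> R by rewrite exprn_gt0.
have t'0 : (0 < t')%N.
  rewrite lt0n; apply/eqP => t'0; move: h; rewrite t'0 expr0n /= mulr0 => /esym/eqP.
  by rewrite gt_eqF // !mulr_gt0 // exprn_gt0.
split=> //; have t'0R : 0 < t'%:R :> R by rewrite ltr0n.
have h' : (3 * t'%:R) ^+ 2 = 15 ^+ (2 * 3 ^ n * m.+1 ^ 2)
    * (5 * (num_spanning_trees (torus_graph c m))%:R) ^+ 2 :> R.
  by move: h; set a := 15 ^+ _; set b := _%:R => h; nra.
move: (congr1 (@ln R) h'); rewrite lnXn ?mulr_gt0 // lnM ?posrE //.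
rewrite lnM ?posrE ?exprn_gt0 ?mulr_gt0 // !lnXn ?mulr_gt0 // lnM ?posrE // e.
rewrite ln_div ?posrE // -[_ *+ (_ * _)]mulr_natr !natrM !natrX -[n.+1%:R]natr1 [3 ^+ n.+1]exprS.
set u := 3 ^+ n; set v := m.+1%:R ^+ 2; set w := ln 15.
have -> : w * (2 * u * v) = 2 * (v * u * w) by ring.
have -> : v * ((u - 1) / 2 * w) = (v * u * w - v * w) / 2 by field.
have -> : v * ((3 * u - 1) / 2 * w) = (3 * (v * u * w) - v * w) / 2 by field.
lra.
Qed.

(** Any fundamental domain of the medial graph is allowed, as the definition of the entropy
    quantifies over them; the one of the truncated graph is auxiliary. *)
Lemma medial_torus_entropy n (c : dart (medial_truncated_hexagonal n) -> int * int) m :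
  fundamental_domain c -> (0 < num_spanning_trees (torus_graph c m))%N /\
    ln (num_spanning_trees (torus_graph c m))%:R
    = ln (num_spanning_trees (torus_graph hexagonal_domain m))%:R
      + m.+1%:R ^+ 2 * ((3 ^+ n - 1) / 2 * ln 15 + 3 ^+ n * ln 6)
      + (n%:R * ln (5 / 3) + ln (2 / 3)) :> R.
Proof.
move=> fc; have [c0 fc0 /(_ m) [t0 e]] := truncated_torus_entropy n.
have V0 : (0 < #|vertex (torus_graph c0 m)|)%N.
  by rewrite card_truncated_torus !muln_gt0 !expn_gt0.
have := medial_torus_count (@truncated_hexagonal_cubic n) fc0 fc V0 R.
rewrite card_truncated_torus card_medial_torus.
set t' := num_spanning_trees (torus_graph c m) => h.
have t0R : 0 < (num_spanning_trees (torus_graph c0 m))%:R :> R by rewrite ltr0n.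
have p0 k : 0 < 6 ^+ k :> R by rewrite exprn_gt0.
have t'0 : (0 < t')%N.
  rewrite lt0n; apply/eqP => t'0; move: h; rewrite t'0 mulr0 mul0r => /eqP.
  by rewrite gt_eqF // !mulr_gt0.
split=> //; have t'0R : 0 < t'%:R :> R by rewrite ltr0n.
have {h} := congr1 (@ln R) h; set rhs := _ + (_ + ln (2 / 3)).
rewrite !lnM ?posrE ?mulr_gt0 // e !lnXn // /rhs.
rewrite [ln (2 / 3)]ln_div ?posrE // -[_ *+ (3 * _ * _)]mulr_natr -[_ *+ (2 * _ * _)]mulr_natr !natrM !natrX.
set u := 3 ^+ n; set v := m.+1%:R ^+ 2; set w := ln 15; set x := ln 6.
have -> : v * ((u - 1) / 2 * w + u * x) = v * ((u - 1) / 2 * w) + v * u * x by ring.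
have -> : x * (3 * u * v) = 3 * (v * u * x) by ring.
have -> : x * (2 * u * v) = 2 * (v * u * x) by ring.
lra.
Qed.

End TorusEntropy.

(** * From tori to the limit over blocks *)

Section EntropyLimit.
Variables (R : realType) (G : periodic_map) (c : dart G -> int * int) (E C : R).
Hypotheses (conn : forall m, connected_graph (block_graph c m.+1)) (dart0 : (0 < #|dart G|)%N).
Hypothesis vert0 : (0 < #|vertices G|)%N.
Hypothesis torusE : forall m,
  `|ln (num_spanning_trees (torus_graph c m))%:R - m.+1%:R ^+ 2 * E| <= C * m.+1%:R.

Local Notation b := ((boundary_constant c)%:R : R).
Local Notation D := (#|dart G|%:R : R).

Lemma block_torus_entropy m :
  ln (num_spanning_trees (block_graph c m.+1))%:R <= ln (num_spanning_trees (torus_graph c m))%:R :> R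
  /\ ln (num_spanning_trees (torus_graph c m))%:R <= ln (num_spanning_trees (block_graph c m.+1))%:R
    + b * m.+1%:R * ln (2 * (#|arc (block_graph c m.+1)|.+1)%:R) :> R.
Proof.
have t0 := num_spanning_trees_gt0 (@conn m); have le1 := block_le_torus c m.
have t0' := leq_trans t0 le1; have le2 := torus_le_block (@conn m) dart0.
split; first by rewrite ler_ln ?posrE ?ltr0n // ler_nat.
have : (num_spanning_trees (torus_graph c m))%:R <= (num_spanning_trees (block_graph c m.+1)
    * (2 * #|arc (block_graph c m.+1)|.+1) ^ (boundary_constant c * m.+1))%:R :> R by rewrite ler_nat.
rewrite -ler_ln ?posrE ?ltr0n ?muln_gt0 ?expn_gt0 ?t0 //.
have -> : b * m.+1%:R * ln (2 * (#|arc (block_graph c m.+1)|.+1)%:R)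
    = ln ((2 * #|arc (block_graph c m.+1)|.+1) ^ (boundary_constant c * m.+1))%:R :> R.
  by rewrite natrX lnXn ?ltr0n // -[RHS]mulr_natl !natrM.
by rewrite natrM lnM ?posrE ?ltr0n ?expn_gt0 ?t0.
Qed.

(** The logarithm of the side is traded for its square root by ln x <= x at x = sqrt (m + 1). After
    multiplication by the boundary length and division by the area this still tends to zero. *)
Lemma ln_block_arc m : ln (2 * (#|arc (block_graph c m.+1)|.+1)%:R)
  <= ln (2 * (D + 1)) + 4 * Num.sqrt m.+1%:R :> R.
Proof.
have M1 : 1 <= m.+1%:R :> R by rewrite ler1n.
have D0 : 0 <= D by [].
have s0 : 0 < Num.sqrt m.+1%:R :> R by rewrite sqrtr_gt0 ltr0n.
have eM : m.+1%:R = Num.sqrt m.+1%:R ^+ 2 :> R by rewrite sqr_sqrtr.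
apply: le_trans (_ : ln (2 * (D + 1) * Num.sqrt m.+1%:R ^+ 4) <= _).
  have p : 0 < 2 * (D + 1) * Num.sqrt m.+1%:R ^+ 4 by rewrite !mulr_gt0 ?exprn_gt0 // ltr_wpDl.
  rewrite ler_ln ?posrE ?mulr_gt0 // -mulrA ler_wpM2l // -natr1.
  have -> : Num.sqrt m.+1%:R ^+ 4 = m.+1%:R ^+ 2 :> R by rewrite [in RHS]eM -exprM.
  have : #|arc (block_graph c m.+1)|%:R <= D * m.+1%:R ^+ 2 :> R.
    by rewrite -natrX -natrM ler_nat card_block_arc.
  by rewrite mulrDl mul1r; nra.
rewrite lnM ?posrE ?exprn_gt0 ?mulr_gt0 ?ltr_wpDl // lerD2l lnXn // -[_ *+ 4]mulr_natl.
by rewrite ler_wpM2l // ltW // ln_sublinear.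
Qed.

Lemma block_entropy_bound : exists A : R, forall m,
  `|E / #|vertices G|%:R - ln (num_spanning_trees (block_graph c m.+1))%:R
    / #|vertex (block_graph c m.+1)|%:R| <= A / Num.sqrt m.+1%:R.
Proof.
have V0 : 0 < #|vertices G|%:R :> R by rewrite ltr0n.
exists ((C + b * `|ln (2 * (D + 1))| + 4 * b) / #|vertices G|%:R) => m.
have [h1 h2] := block_torus_entropy m; have h3 := ln_block_arc m; have h4 := torusE m.
have M0 : 0 < m.+1%:R :> R by rewrite ltr0n.
have s1 : 1 <= Num.sqrt m.+1%:R :> R by rewrite -[X in X <= _]sqrtr1 ler_sqrt // ler1n.
have eM : m.+1%:R = Num.sqrt m.+1%:R ^+ 2 :> R by rewrite sqr_sqrtr.
rewrite card_block_vertex natrM natrX; move: h1 h2 h3 h4.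
set t := ln (_ (block_graph _ _))%:R; set t' := ln (_ (torus_graph _ _))%:R.
set s := Num.sqrt _ in s1 eM *; set a := ln (2 * _.+1%:R); set l := ln (2 * _).
set V := #|vertices G|%:R in V0 *; rewrite {}eM.
have b0 : 0 <= b by []; set B := b in b0 * => h1 h2 h3 h4.
have s0 : 0 < s by lra.
have s0' := ltW s0.
have -> : E / V - t / (V * (s ^+ 2) ^+ 2) = ((s ^+ 2) ^+ 2 * E - t) / (V * (s ^+ 2) ^+ 2).
  by field; rewrite !gt_eqF.
rewrite normrM [X in _ * X]ger0_norm ?invr_ge0 ?mulr_ge0 ?sqr_ge0 ?(ltW V0) //.
rewrite ler_pdivrMr ?mulr_gt0 ?exprn_gt0 //.
have -> : (C + B * `|l| + 4 * B) / V / s * (V * (s ^+ 2) ^+ 2) = (C + B * `|l| + 4 * B) * s * s ^+ 2.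
  by field; rewrite !gt_eqF.
have h5 : B * s ^+ 2 * a <= B * s ^+ 2 * (`|l| * s + 4 * s).
  rewrite ler_wpM2l ?mulr_ge0 ?sqr_ge0 //; apply: le_trans h3 _; rewrite lerD2r.
  by apply: le_trans (ler_norm _) _; rewrite ler_peMr.
have h6 : C * s ^+ 2 <= C * s * s ^+ 2.
  have C0 : 0 <= C.
    by have := le_trans (normr_ge0 _) h4; rewrite pmulr_lge0 // exprn_gt0.
  by rewrite ler_wpM2r ?sqr_ge0 // ler_peMr.
move: h4; rewrite !ler_norml => /andP [h4 h4'].
have -> : (C + B * `|l| + 4 * B) * s * s ^+ 2 = C * s * s ^+ 2 + B * s ^+ 2 * (`|l| * s + 4 * s) by ring.
have h7 : 0 <= B * s ^+ 2 * (`|l| * s + 4 * s).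
  by rewrite !mulr_ge0 ?addr_ge0 ?mulr_ge0 ?(ltW s0) ?sqr_ge0.
by apply/andP; split; lra.
Qed.

Lemma block_entropy_limit :
  ((fun m : nat => ln (num_spanning_trees (block_graph c m))%:R
                   / #|vertex (block_graph c m)|%:R : R) @ \oo --> E / #|vertices G|%:R)%classic.
Proof.
have [A hA] := block_entropy_bound; rewrite -cvg_shiftS.
apply/cvgrPdist_le => e e0; near=> m; apply: le_trans (hA m) _.
have s0 : 0 < Num.sqrt m.+1%:R :> R by rewrite sqrtr_gt0 ltr0n.
rewrite ler_pdivrMr // mulrC -ler_pdivrMr //.
apply: le_trans (ler_norm _) _; rewrite -sqrtr_sqr ler_sqrt //.
have : (A / e) ^+ 2 <= m%:R by near: m; exact: nbhs_infty_ger.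
by rewrite -natr1; lra.
Unshelve. all: by end_near. Qed.

End EntropyLimit.

Section MedialEntropy.
Variable R : realType.
Local Notation L := (hexagonal_entropy R).

Definition medial_entropy n : R :=
  (L + (3 ^+ n - 1) / 2 * ln 15 + 3 ^+ n * ln 6) / (3 * 3 ^+ n).

Lemma medial_entropyP n : is_spanning_tree_entropy (medial_truncated_hexagonal n) (medial_entropy n).
Proof.
split; first exact: medial_truncated_admissible.
move=> c [fc conn].
have -> : medial_entropy n = (L + (3 ^+ n - 1) / 2 * ln 15 + 3 ^+ n * ln 6)
    / #|vertices (medial_truncated_hexagonal n)|%:R.
  by rewrite card_medial_truncated_vertices natrM natrX.
pose K : R := n%:R * ln (5 / 3) + ln (2 / 3).
apply: (block_entropy_limit (C := 11 + 5 * pi + `|K|)).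
- by move=> m; exact: conn.
- by rewrite card_prod card_truncated_dart !muln_gt0 expn_gt0 card_bool.
- by rewrite card_medial_truncated_vertices !muln_gt0 expn_gt0.
move=> m; have [_ ->] := medial_torus_entropy R m fc.
have M1 : 1 <= m.+1%:R :> R by rewrite ler1n.
have hK : `|K| <= `|K| * m.+1%:R by rewrite ler_peMr.
have := hexagonal_torus_entropy R m; rewrite -/K; move: hK.
set t := ln _; set M := m.+1%:R; set s := `|K| * M.
set p := _ / 2 * ln 15; set q := _ * ln 6.
move=> hK h.
have -> : t + M ^+ 2 * (p + q) + K - M ^+ 2 * (L + p + q) = (t - M ^+ 2 * L) + K by ring.
by rewrite [in leRHS]mulrDl; apply: le_trans (ler_normD _ _) (lerD h hK).
Qed.

End MedialEntropy.

(** * Bipyramid volumes *)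

Section TaylorBounds.
Variable R : realType.
Implicit Types (f : R -> R) (x t : R).

(** The engine of the Taylor bounds: the derivative of each remainder is the preceding remainder, or
    one already bounded. *)
Lemma ge0_of_derive (f f' : R -> R) : f 0 = 0 -> (forall x, is_derive x (1 : R) f (f' x)) ->
  (forall x, 0 <= x -> 0 <= f' x) -> forall t, 0 <= t -> 0 <= f t.
Proof.
move=> f0 df df0 t; rewrite le_eqVlt => /predU1P [<-|t0]; first by rewrite f0.
have [|c] := @MVT R f f' 0 t t0 (fun x _ => df x).
  by apply: derivable_within_continuous => x _; have [] := df x.
rewrite in_itv /= f0 subr0 => /andP [c0 _] ->.
by rewrite mulr_ge0 ?subr_ge0 ?(ltW t0) // df0 // ltW.
Qed.

Lemma sin_le_id t : 0 <= t -> sin t <= t.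
Proof.
move=> t0; rewrite -subr_ge0.
apply: (ge0_of_derive (f := fun x => x - sin x) (f' := fun x => 1 - cos x) _ _ _ t0).
- by rewrite sin0 subrr.
- by move=> x _; rewrite subr_ge0 cos_le1.
Qed.

Lemma cos_ge_quadratic t : 0 <= t -> 1 - t ^+ 2 / 2 <= cos t.
Proof.
move=> t0; rewrite -subr_ge0.
apply: (ge0_of_derive (f := fun x => cos x - (1 - x ^+ 2 / 2)) (f' := fun x => x - sin x) _ _ _ t0).
- by rewrite cos0 expr0n /= mul0r subr0 subrr.
- by move=> x; apply: is_derive_eq; rewrite /GRing.scale /=; field.
- by move=> x x0; rewrite subr_ge0 sin_le_id.
Qed.

Lemma sin_ge_cubic t : 0 <= t -> t - t ^+ 3 / 6 <= sin t.
Proof.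
move=> t0; rewrite -subr_ge0.
apply: (ge0_of_derive (f := fun x => sin x - (x - x ^+ 3 / 6)) (f' := fun x => cos x - (1 - x ^+ 2 / 2)) _ _ _ t0).
- by rewrite sin0 expr0n /= mul0r subr0 subrr.
- by move=> x; apply: is_derive_eq; rewrite /GRing.scale /=; field.
- by move=> x x0; rewrite subr_ge0 cos_ge_quadratic.
Qed.

Lemma cos_le_quartic t : 0 <= t -> cos t <= 1 - t ^+ 2 / 2 + t ^+ 4 / 24.
Proof.
move=> t0; rewrite -subr_ge0.
apply: (ge0_of_derive (f := fun x => 1 - x ^+ 2 / 2 + x ^+ 4 / 24 - cos x)
  (f' := fun x => sin x - (x - x ^+ 3 / 6)) _ _ _ t0).
- by rewrite cos0 !expr0n /= !mul0r subr0 addr0 subrr.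
- by move=> x; apply: is_derive_eq; rewrite /GRing.scale /=; field.
- by move=> x x0; rewrite subr_ge0 sin_ge_cubic.
Qed.

Lemma sin_le_quintic t : 0 <= t -> sin t <= t - t ^+ 3 / 6 + t ^+ 5 / 120.
Proof.
move=> t0; rewrite -subr_ge0.
apply: (ge0_of_derive (f := fun x => x - x ^+ 3 / 6 + x ^+ 5 / 120 - sin x)
  (f' := fun x => 1 - x ^+ 2 / 2 + x ^+ 4 / 24 - cos x) _ _ _ t0).
- by rewrite sin0 !expr0n /= !mul0r subr0 addr0 subrr.
- by move=> x; apply: is_derive_eq; rewrite /GRing.scale /=; field.
- by move=> x x0; rewrite subr_ge0 cos_le_quartic.
Qed.

Lemma cos_ge_sextic t : 0 <= t -> 1 - t ^+ 2 / 2 + t ^+ 4 / 24 - t ^+ 6 / 720 <= cos t.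
Proof.
move=> t0; rewrite -subr_ge0; have [c ec] : exists c : R, c = 720^-1 by exists 720^-1.
rewrite -ec; apply: (ge0_of_derive (f := fun x => cos x - (1 - x ^+ 2 / 2 + x ^+ 4 / 24 - x ^+ 6 * c))
  (f' := fun x => x - x ^+ 3 / 6 + 6 * c * x ^+ 5 - sin x) _ _ _ t0).
- by rewrite cos0 !expr0n /= !mul0r !subr0 addr0 subrr.
- by move=> x; apply: is_derive_eq; rewrite /GRing.scale /=; field.
- by move=> x x0; have := sin_le_quintic x0; rewrite ec; lra.
Qed.

Lemma sin_ge_septic t : 0 <= t -> t - t ^+ 3 / 6 + t ^+ 5 / 120 - t ^+ 7 / (7 * 720) <= sin t.
Proof.
move=> t0; rewrite -subr_ge0.
have [c ec] : exists c : R, c = 120^-1 by exists 120^-1.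
have [d ed] : exists d : R, d = (7 * 720)^-1 by exists (7 * 720)^-1.
rewrite -ec -ed; apply: (ge0_of_derive (f := fun x => sin x - (x - x ^+ 3 / 6 + x ^+ 5 * c - x ^+ 7 * d))
  (f' := fun x => cos x - (1 - x ^+ 2 / 2 + 5 * c * x ^+ 4 - 7 * d * x ^+ 6)) _ _ _ t0).
- by rewrite sin0 !expr0n /= !mul0r !subr0 addr0 subrr.
- by move=> x; apply: is_derive_eq; rewrite /GRing.scale /=; field.
- by move=> x x0; have := cos_ge_sextic x0; rewrite ec ed; lra.
Qed.

Lemma expR_ge_quadratic t : 0 <= t -> 1 + t + t ^+ 2 / 2 <= expR t.
Proof.
move=> t0; rewrite -subr_ge0.
apply: (ge0_of_derive (f := fun x => expR x - (1 + x + x ^+ 2 / 2)) (f' := fun x => expR x - (1 + x)) _ _ _ t0).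
- by rewrite expR0 !expr0n /= !mul0r !addr0 subrr.
- by move=> x; apply: is_derive_eq; rewrite /GRing.scale /=; field.
- by move=> x x0; rewrite subr_ge0 expR_ge1Dx.
Qed.

(** If pi were at most 3.14, the quintic upper bound for sin (pi / 6) would fall below its value 1 /
    2. *)
Lemma pi_gt_314 : 157 / 50 < pi :> R.
Proof.
rewrite ltNge; apply/negP => pile; have pi0 := pi_gt0 R.
have t0 : 0 <= pi / 6 :> R by lra.
have := sin_le_quintic t0; rewrite sin_pi6; apply/negP; rewrite -ltNge.
have t1 : pi / 6 <= 157 / 300 :> R by lra.
move: t0 t1; set t := pi / 6 => t0 t1.
(* The cube lies above its tangent line at 13/25, a point close to 157/300. *)
have h1 : 0 <= (t - 13 / 25) ^+ 2 * (t + 26 / 25) by rewrite mulr_ge0 ?sqr_ge0 //; lra.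
have h2 : t ^+ 2 <= 274 / 1000 by nra.
have h3 : t ^+ 4 <= 751 / 10000.
  by rewrite (_ : t ^+ 4 = (t ^+ 2) ^+ 2); [have := sqr_ge0 t; nra|ring].
have h4 : t ^+ 5 <= t * (751 / 10000) by rewrite exprS ler_wpM2l.
lra.
Qed.

Lemma pi_lt_315 : pi < 63 / 20 :> R.
Proof.
rewrite ltNge; apply/negP => pile; have pi0 := pi_gt0 R.
have /andP [_ pi4] := pihalf_02 R.
have t0 : 0 <= pi / 6 :> R by lra.
have := sin_ge_cubic t0; rewrite sin_pi6; apply/negP; rewrite -ltNge.
have t1 : 21 / 40 <= pi / 6 :> R by lra.
have t2 : pi / 6 <= 2 / 3 :> R by lra.
move: t0 t1 t2; set t := pi / 6 => t0 t1 t2.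
(* This product is the difference of the values of t - t^3 / 6 at t and at 21/40; a crude bound on t
   makes the second factor positive. *)
have : 0 <= (t - 21 / 40) * (1 - (t ^+ 2 + t * (21 / 40) + (21 / 40) ^+ 2) / 6).
  by rewrite mulr_ge0 //; nra.
lra.
Qed.

Lemma ln_sin_le t : 0 < t -> t < pi -> ln (sin t) <= ln t - t ^+ 2 / 6 + t ^+ 4 / 120.
Proof.
move=> t0 tpi; have s0 : 0 < sin t by apply: sin_gt0_pi; rewrite t0.
have y0 : sin t / t - 1 <= - (t ^+ 2 / 6) + t ^+ 4 / 120.
  rewrite lerBlDr ler_pdivrMr //; apply: le_trans (sin_le_quintic (ltW t0)) _.
  by rewrite le_eqVlt; apply/orP; left; apply/eqP; field.
have h : -1 < sin t / t - 1 by rewrite ltrBrDr addNr divr_gt0.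
by have := le_ln1Dx h; rewrite (addrC 1) subrK ln_div ?posrE //; lra.
Qed.

(** With x = t^2 and y = x / 6 + x^2 / 100, it suffices that sin t times exp y is at least t. Both
    factors are bounded below by quadratics in x whose product is at least 1 up to x = 6/5, a
    threshold just above (pi / 3)^2, the largest case needed. *)
Lemma ln_sin_ge t : 0 < t -> t ^+ 2 <= 6 / 5 -> ln t - t ^+ 2 / 6 - t ^+ 4 / 100 <= ln (sin t).
Proof.
move=> t0 t2; pose x := t ^+ 2; have x0 : 0 <= x by exact: sqr_ge0.
have xx0 : 0 <= x ^+ 2 by exact: sqr_ge0.
have hs : t * (1 - x / 6 + x ^+ 2 / 125) <= sin t.
  apply: le_trans (sin_ge_septic (ltW t0)).
  have -> : t - t ^+ 3 / 6 + t ^+ 5 / 120 - t ^+ 7 / (7 * 720)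
    = t * (1 - x / 6 + x ^+ 2 / 120 - x * x ^+ 2 / (7 * 720)) by rewrite /x; field.
  rewrite ler_wpM2l ?(ltW t0) //.
  have : x * x ^+ 2 <= 6 / 5 * x ^+ 2 by rewrite ler_wpM2r.
  lra.
pose y := x / 6 + x ^+ 2 / 100.
have he : 1 + x / 6 + x ^+ 2 / 42 <= expR y.
  have y0 : 0 <= y by rewrite /y; lra.
  apply: le_trans (expR_ge_quadratic y0).
  have : x / 6 <= y by rewrite /y; lra.
  have : 0 <= (y - x / 6) * (y + x / 6) by rewrite mulr_ge0 // /y; lra.
  by rewrite /y; lra.
have hp : 1 <= (1 - x / 6 + x ^+ 2 / 125) * (1 + x / 6 + x ^+ 2 / 42).
  rewrite -subr_ge0 (_ : _ - 1 = x ^+ 2 * (1 / 42 - 1 / 36 + 1 / 125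
    + (1 / 125 - 1 / 42) / 6 * x + 1 / (42 * 125) * x ^+ 2)); last by field.
  by apply: mulr_ge0; [exact: xx0 | move: t2; rewrite -/x; lra].
have st : 0 < 1 - x / 6 + x ^+ 2 / 125 by move: t2; rewrite -/x; lra.
have e0 := expR_gt0 y.
have : t <= sin t * expR y.
  apply: le_trans (_ : t * ((1 - x / 6 + x ^+ 2 / 125) * (1 + x / 6 + x ^+ 2 / 42)) <= _).
    by rewrite ler_peMr // ltW.
  rewrite mulrA; apply: ler_pM => //; first by rewrite mulr_ge0 ?ltW.
  by move: t2; rewrite -/x; lra.
have s0 : 0 < sin t by apply: lt_le_trans hs; rewrite mulr_gt0.
rewrite -ler_ln ?posrE ?mulr_gt0 // lnM ?posrE // expRK /y /x.
rewrite -!exprM; lra.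
Qed.

End TaylorBounds.

(** * The Lobachevsky integral *)

Section Lobachevsky.
Local Open Scope classical_set_scope.
Local Open Scope ring_scope.
Variable R : realType.
Implicit Types (t a b theta : R).
Local Notation mu := (@lebesgue_measure R).

(** A primitive of the Taylor bounds of -ln (sin t); [kappa] is -1/600 for the lower bound and 1/500
    for the upper one. *)
Definition log_primitive (kappa t : R) : R :=
  t - t * ln t + t ^+ 3 / 18 + kappa * t ^+ 5.

Lemma is_derive_log_primitive kappa t : 0 < t ->
  is_derive t (1 : R) (log_primitive kappa) (- ln t + t ^+ 2 / 6 + 5 * kappa * t ^+ 4).
Proof.
move=> t0; have dln := is_derive1_ln t0; rewrite /log_primitive.
have [k ek] : exists k : R, k = 18^-1 by exists 18^-1.
by rewrite -ek; apply: is_derive_eq; rewrite /GRing.scale /= ek; field; rewrite gt_eqF.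
Qed.

Lemma derivable_log_primitive' kappa t : 0 < t ->
  derivable (fun t => - ln t + t ^+ 2 / 6 + 5 * kappa * t ^+ 4) t 1.
Proof. by move=> t0; have dln := is_derive1_ln t0; apply: ex_derive. Qed.

Lemma derivable_ln_sin t : 0 < t -> t < pi -> derivable (fun t => - ln (sin t)) t 1.
Proof.
move=> t0 tpi; have s0 : 0 < sin t by apply: sin_gt0_pi; rewrite t0.
by have dln := is_derive1_ln s0; apply: ex_derive.
Qed.

Lemma integral_log_primitive kappa a b : 0 < a -> a < b ->
  (\int[mu]_(t in `[a, b]) (- ln t + t ^+ 2 / 6 + 5 * kappa * t ^+ 4)%:E
   = (log_primitive kappa b)%:E - (log_primitive kappa a)%:E)%E.
Proof.
move=> a0 ab; have pos t : a <= t -> 0 < t by exact: lt_le_trans.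
have cF t : a <= t -> log_primitive kappa @ t --> log_primitive kappa t.
  move=> /pos /(is_derive_log_primitive kappa) [dF _].
  by apply: differentiable_continuous; apply/derivable1_diffP.
apply: continuous_FTC2 => //.
- apply: derivable_within_continuous => t; rewrite in_itv /= => /andP [/pos t0 _].
  exact: derivable_log_primitive'.
- split.
  + by move=> t; rewrite in_itv /= => /andP [/ltW/pos /(is_derive_log_primitive kappa) [dF _] _].
  + by apply: cvg_at_right_filter; exact: cF.
  + by apply: cvg_at_left_filter; apply: cF; exact: ltW.
move=> t; rewrite in_itv /= => /andP [/ltW/pos t0 _].
by rewrite derive1E; have /@derive_val -> := is_derive_log_primitive kappa t0.
Qed.

Lemma lt_pi_of_sqr_le theta : theta ^+ 2 <= 6 / 5 -> theta < pi.
Proof. by move=> t2; have := pi_gt_314 R; nra. Qed.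

Lemma integral_ln_sin_bounds a b : 0 < a -> a < b -> b ^+ 2 <= 6 / 5 ->
  ((log_primitive (- 600^-1) b - log_primitive (- 600^-1) a)%:E
    <= \int[mu]_(t in `[a, b]) (- ln (sin t))%:E
    <= (log_primitive 500^-1 b - log_primitive 500^-1 a)%:E)%E.
Proof.
move=> a0 ab b2; rewrite !EFinB -!integral_log_primitive //.
have pos t : a <= t -> 0 < t by exact: lt_le_trans.
have bpi := lt_pi_of_sqr_le b2.
have sq t : a <= t -> t <= b -> t ^+ 2 <= 6 / 5.
  by move=> /pos/ltW t0 tb; apply: le_trans b2; rewrite ler_sqr ?nnegrE // (le_trans t0).
have int1 kappa : mu.-integrable `[a, b] (EFin \o (fun t : R => - ln t + t ^+ 2 / 6 + 5 * kappa * t ^+ 4)).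
  apply: continuous_compact_integrable; first exact: segment_compact.
  apply: derivable_within_continuous => t; rewrite in_itv /= => /andP [/pos t0 _].
  exact: derivable_log_primitive'.
have int2 : mu.-integrable `[a, b] (EFin \o (fun t : R => - ln (sin t))).
  apply: continuous_compact_integrable; first exact: segment_compact.
  apply: derivable_within_continuous => t; rewrite in_itv /= => /andP [/pos t0 tb].
  by apply: derivable_ln_sin => //; exact: le_lt_trans bpi.
apply/andP; split.
- apply: le_integral (int1 _) int2 _ => // t; rewrite inE /= in_itv /= => /andP [at_ tb].
  have t0 := pos _ at_; have tpi := le_lt_trans tb bpi.
  by rewrite lee_fin; have := ln_sin_le t0 tpi; lra.
- apply: le_integral int2 (int1 _) _ => // t; rewrite inE /= in_itv /= => /andP [at_ tb].
  have t0 := pos _ at_; have t2 := sq _ at_ tb.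
  by rewrite lee_fin; have := ln_sin_ge t0 t2; lra.
Qed.

Lemma measurable_ln_sin (D : set R) : measurable_fun D (fun t : R => - ln (sin t)).
Proof.
apply: measurable_funS (_ : measurable_fun setT _) => //.
have ms : measurable_fun setT (@sin R) by apply: continuous_measurable_fun; exact: continuous_sin.
exact: measurableT_comp (@oppr_measurable R setT) (measurableT_comp (@measurable_ln R) ms).
Qed.

Lemma log_primitive_ge0 t : 0 < t -> t ^+ 2 <= 6 / 5 -> 0 <= log_primitive 500^-1 t.
Proof.
move=> t0 t2; have t11 : t <= 2 by nra.
have h : -1 < t - 1 by lra.
have := le_ln1Dx h; rewrite (addrC 1) subrK => l.
have h1 : 0 <= t * (1 - ln t) by rewrite mulr_ge0 ?(ltW t0) //; lra.
have [h3 h5] : 0 <= t ^+ 3 /\ 0 <= t ^+ 5 by split; rewrite exprn_ge0 // ltW.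
by rewrite /log_primitive; lra.
Qed.

(** Evaluating at a square lets ln (1 / s) <= 1 / s - 1 absorb the logarithm, so the contribution of
    the singular endpoint is linear in [s]. *)
Lemma log_primitive_small s : 0 < s -> s <= 1 -> log_primitive (- 600^-1) (s ^+ 2) <= 4 * s.
Proof.
move=> s0 s1; rewrite /log_primitive lnXn // mulr2n.
have h : -1 < s^-1 - 1 by rewrite ltrBrDr addNr invr_gt0.
have := le_ln1Dx h; rewrite (addrC 1) subrK lnV ?posrE // => l.
have : s ^+ 2 * - ln s <= s ^+ 2 * (s^-1 - 1) by rewrite ler_wpM2l ?sqr_ge0.
have -> : s ^+ 2 * (s^-1 - 1) = s - s ^+ 2 by field; rewrite gt_eqF.
have h2 : s ^+ 2 <= s by rewrite expr2 ler_piMl // ltW.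
have h6 : (s ^+ 2) ^+ 3 <= s.
  by rewrite -exprM exprS ler_piMr ?(ltW s0) // exprn_ile1 // ltW.
have h10 : 0 <= (s ^+ 2) ^+ 5 by rewrite exprn_ge0 // sqr_ge0.
by have := sqr_ge0 s; lra.
Qed.

Section Integral.
Variable theta : R.
Hypotheses (theta_gt0 : 0 < theta) (theta_le : theta ^+ 2 <= 6 / 5).

Local Notation I := (\int[mu]_(t in `]0%R, theta]) (- ln (sin t))%:E)%E.

Let theta_small : theta < 11 / 10.
Proof.
rewrite ltNge; apply/negP => h; have h0 : 0 <= 11 / 10 :> R by lra.
by have := ler_pM h0 h0 h h; move: theta_le; rewrite expr2; lra.
Qed.

(** This holds for every [t], as [ln] vanishes on nonpositive arguments; monotone arguments thus
    apply to the improper integral. *)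
Let f_ge0 t : (0 <= (- ln (sin t))%:E)%E.
Proof.
by rewrite lee_fin oppr_ge0 ln_le0 // sin_le1.
Qed.

Let mf (D : set R) : measurable_fun D (fun t : R => (- ln (sin t))%:E).
Proof. by apply/measurable_EFinP; exact: measurable_ln_sin. Qed.

(** Intervals exhausting the half-open one; the denominator starts at 2 so that none is
    degenerate. *)
Let F (i : nat) : set R := `[theta / i.+2%:R, theta].

Let F_lt i : 0 < theta / i.+2%:R /\ theta / i.+2%:R < theta.
Proof.
rewrite divr_gt0 //; split => //.
by rewrite ltr_pdivrMr // ltr_pMr // ltr1n.
Qed.

Let bigcup_F : \bigcup_i F i = `]0, theta]%classic.
Proof.
apply/seteqP; split=> t /=.
  move=> [i _]; rewrite /F /= !in_itv /= => /andP [h ->]; rewrite andbT.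
  by apply: lt_le_trans h; have [] := F_lt i.
rewrite in_itv /= => /andP [t0 tt]; exists (Num.bound (theta / t)) => //.
rewrite /F /= in_itv /= tt andbT ler_pdivrMr // -ler_pdivrMl // mulrC.
have : theta / t < (Num.bound (theta / t))%:R by apply: archi_boundP; rewrite divr_ge0 ?(ltW t0) ?(ltW theta_gt0).
rewrite -natr1 -natr1; lra.
Qed.

Lemma integral_ln_sin_le : (I <= (log_primitive 500^-1 theta)%:E)%E.
Proof.
have nd : nondecreasing_seq F.
  apply/nondecreasing_seqP => i; rewrite subsetEset /F => t /=; rewrite !in_itv /= => /andP [h ->].
  rewrite andbT; apply: le_trans h; rewrite ler_wpM2l ?(ltW theta_gt0) // lef_pV2 ?posrE //.
  by rewrite ler_nat.
have cv := ge0_nondecreasing_set_cvg_integral (mu := mu) nd (fun i => measurable_itv _)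
  (fun i => @mf (F i)) (fun i t _ => f_ge0 t).
rewrite -bigcup_F; apply: (cvge_le _ cv).
apply: nearW => i; have [a0 ab] := F_lt i.
have /andP [_] := integral_ln_sin_bounds a0 ab theta_le.
move/le_trans; apply; rewrite lee_fin gerBl; apply: log_primitive_ge0 => //.
by apply: le_trans theta_le; rewrite ler_sqr ?nnegrE ?(ltW a0) ?(ltW theta_gt0) ?(ltW ab).
Qed.

Lemma integral_ln_sin_ge : ((log_primitive (- 600^-1) theta)%:E <= I)%E.
Proof.
apply/lee_addgt0Pr => e e0.
(* The first bound keeps s^2 below theta, the second makes the lost contribution 4 s at most e. *)
pose s := Num.min (theta / 2) (e / 4).
have s0 : 0 < s by rewrite lt_min !divr_gt0.
have s1 : s <= theta / 2 by rewrite ge_min lexx.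
have s2 : s <= e / 4 by rewrite ge_min lexx orbT.
have a0 : 0 < s ^+ 2 by rewrite exprn_gt0.
have sl : s <= 1 by move: theta_small; lra.
have ab : s ^+ 2 < theta.
  have : s ^+ 2 <= s by rewrite expr2 ler_piMl // ltW.
  by move: theta_gt0; lra.
have /andP [h _] := integral_ln_sin_bounds a0 ab theta_le.
have := log_primitive_small s0 sl => h'.
apply: (@le_trans _ _ ((log_primitive (- 600^-1) theta - log_primitive (- 600^-1) (s ^+ 2))%:E + e%:E)%E).
  by rewrite -EFinD lee_fin; lra.
rewrite leeD2r //; apply: le_trans h _; apply: ge0_subset_integral => //.
- exact: mf.
- by move=> t; rewrite /= !in_itv /= => /andP [h ->]; rewrite andbT (lt_le_trans a0).
Qed.

(** Without the null endpoint 0, where the sine vanishes, the logarithm splits; the previous upper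
    bound makes the integral finite, so [fine] loses nothing. *)
Lemma lobachevskyE : lobachevsky theta = fine I - theta * ln 2.
Proof.
have Ifin : I \is a fin_num.
  rewrite ge0_fin_numE; first exact: le_lt_trans integral_ln_sin_le (ltry _).
  by apply: integral_ge0 => t _; exact: f_ge0.
have intf : mu.-integrable `]0, theta] (EFin \o (fun t : R => - ln (sin t))).
  apply/integrableP; split; first exact: mf.
  by rewrite integral_fin_num_abs //; exact: measurable_ln_sin.
have intc : mu.-integrable `]0, theta] (EFin \o (fun t : R => ln 2)).
  apply/integrableP; split; first exact: measurable_cst.
  rewrite integral_cst //= lebesgue_measure_itv /= lte_fin theta_gt0 -EFinB -EFinM.
  exact: ltry.
have eq_log t : t \in `]0, theta]%classic -> ln `|2 * sin t| = ln 2 - - ln (sin t).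
  rewrite inE /= in_itv /= => /andP [t0 tt]; have tpi := le_lt_trans tt (lt_pi_of_sqr_le theta_le).
  have st : 0 < sin t by apply: sin_gt0_pi; rewrite t0.
  by rewrite gtr0_norm ?mulr_gt0 // lnM ?posrE // opprK.
have inth : mu.-integrable `]0, theta] (EFin \o (fun t : R => ln `|2 * sin t|)).
  apply: eq_integrable (integrableB _ intc intf) => //= t tin.
  by rewrite eq_log // EFinB.
have e : (\int[mu]_(t in `]0, theta]) ln `|2 * sin t|
  = \int[mu]_(t in `]0, theta]) (ln 2 - - ln (sin t)))%R by exact: eq_Rintegral.
rewrite /lobachevsky -(Rintegral_itv_obnd_cbnd inth) e.
rewrite RintegralB // Rintegral_cst //= lebesgue_measure_itv /= lte_fin theta_gt0 /= ?subr0.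
by rewrite opprB /Rintegral mulrC.
Qed.

End Integral.

Lemma lobachevsky_le theta : 0 < theta -> theta ^+ 2 <= 6 / 5 ->
  lobachevsky theta <= theta * (1 - ln (2 * theta) + theta ^+ 2 / 18 + theta ^+ 4 / 500).
Proof.
move=> t0 t2; rewrite lobachevskyE // lnM ?posrE //.
have h1 := integral_ln_sin_le t0 t2; have h2 := integral_ln_sin_ge t0 t2.
move: h1 h2; case: (integral _ _ _) => [r| |] //=; rewrite !lee_fin /log_primitive.
by rewrite !exprS; lra.
Qed.

Lemma lobachevsky_ge theta : 0 < theta -> theta ^+ 2 <= 6 / 5 ->
  theta * (1 - ln (2 * theta) + theta ^+ 2 / 18 - theta ^+ 4 / 600) <= lobachevsky theta.
Proof.
move=> t0 t2; rewrite lobachevskyE // lnM ?posrE //.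
have h1 := integral_ln_sin_le t0 t2; have h2 := integral_ln_sin_ge t0 t2.
move: h1 h2; case: (integral _ _ _) => [r| |] //=; rewrite !lee_fin /log_primitive.
by rewrite !exprS; lra.
Qed.

Lemma bipyramid_angle k : (3 <= k)%N -> 0 < pi / k%:R :> R /\ (pi / k%:R) ^+ 2 <= 6 / 5 :> R.
Proof.
move=> k3; have pi0 := pi_gt0 R; have pi1 := pi_lt_315 R.
have k0 : 3 <= k%:R :> R by rewrite ler_nat.
have a0 : 0 < pi / k%:R :> R by rewrite divr_gt0 //; lra.
have a1 : pi / k%:R <= 21 / 20 :> R by rewrite ler_pdivrMr; lra.
by split=> //; rewrite expr2; have := ler_pM (ltW a0) (ltW a0) a1 a1; lra.
Qed.

Lemma vol_bipyramid_le k : (3 <= k)%N ->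
  vol_bipyramid R k <= 2 * pi * (1 - ln (2 * (pi / k%:R)) + (pi / k%:R) ^+ 2 / 18 + (pi / k%:R) ^+ 4 / 500).
Proof.
move=> k3; have [a0 a2] := bipyramid_angle k3; have := lobachevsky_le a0 a2.
have k0 : 0 < 2 * k%:R :> R by rewrite mulr_gt0 // ltr0n (leq_trans _ k3).
have e : 2 * k%:R * (pi / k%:R) = 2 * pi :> R.
  by rewrite -mulrA [k%:R * _]mulrC divfK // pnatr_eq0; case: (k) k3.
by rewrite -(ler_pM2l k0) [2 * k%:R * (_ * _)]mulrA e.
Qed.

Lemma vol_bipyramid_ge k : (3 <= k)%N ->
  2 * pi * (1 - ln (2 * (pi / k%:R)) + (pi / k%:R) ^+ 2 / 18 - (pi / k%:R) ^+ 4 / 600) <= vol_bipyramid R k.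
Proof.
move=> k3; have [a0 a2] := bipyramid_angle k3; have := lobachevsky_ge a0 a2.
have k0 : 0 < 2 * k%:R :> R by rewrite mulr_gt0 // ltr0n (leq_trans _ k3).
have e : 2 * k%:R * (pi / k%:R) = 2 * pi :> R.
  by rewrite -mulrA [k%:R * _]mulrC divfK // pnatr_eq0; case: (k) k3.
by rewrite -(ler_pM2l k0) [2 * k%:R * (_ * _)]mulrA e.
Qed.

End Lobachevsky.

(** * Numerical estimates *)

Section LogBounds.
Variable R : realType.
Implicit Types (t x : R).

Lemma expR_ge_cubic t : 0 <= t -> 1 + t + t ^+ 2 / 2 + t ^+ 3 / 6 <= expR t.
Proof.
move=> t0; rewrite -subr_ge0.
apply: (ge0_of_derive (f := fun x => expR x - (1 + x + x ^+ 2 / 2 + x ^+ 3 / 6))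
  (f' := fun x => expR x - (1 + x + x ^+ 2 / 2)) _ _ _ t0).
- by rewrite expR0 !expr0n /= !mul0r !addr0 subrr.
- by move=> x; apply: is_derive_eq; rewrite /GRing.scale /=; field.
- by move=> x x0; rewrite subr_ge0 expR_ge_quadratic.
Qed.

Lemma expRN_le_quadratic t : 0 <= t -> expR (- t) <= 1 - t + t ^+ 2 / 2.
Proof.
move=> t0; have := expR_ge_quadratic t0; have e0 := expR_gt0 t; rewrite expRN => h.
rewrite -(ler_pM2l e0) divff ?gt_eqF //.
have h1 : 0 <= 1 - t + t ^+ 2 / 2 by have := sqr_ge0 (t - 1); rewrite sqrrB expr1n; lra.
apply: le_trans (ler_wpM2r h1 h).
have : 0 <= t ^+ 4 by rewrite exprn_ge0.
have -> : (1 + t + t ^+ 2 / 2) * (1 - t + t ^+ 2 / 2) = 1 + t ^+ 4 / 4 by field.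
lra.
Qed.

Lemma expRN_ge_cubic t : 0 <= t -> 1 - t + t ^+ 2 / 2 - t ^+ 3 / 6 <= expR (- t).
Proof.
move=> t0; rewrite -subr_ge0.
apply: (ge0_of_derive (f := fun x => expR (- x) - (1 - x + x ^+ 2 / 2 - x ^+ 3 / 6))
  (f' := fun x => 1 - x + x ^+ 2 / 2 - expR (- x)) _ _ _ t0).
- by rewrite oppr0 expR0 !expr0n /= !mul0r; lra.
- move=> x; have dN := is_deriveNid x (1 : R); have dE := is_derive_expR (- x).
  have dc : is_derive x (1 : R) (fun y => expR (- y)) (expR (- x) * -1) by exact: is_derive1_comp.
  by apply: is_derive_eq; rewrite /GRing.scale /=; field.
- by move=> x x0; rewrite subr_ge0 expRN_le_quadratic.
Qed.

(** A rational certificate for a bound on a logarithm, sharp when [x] is close to 1. *)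
Lemma ln_ge_of_expRN t x : 0 <= t -> 0 < x -> 1 <= x * (1 - t + t ^+ 2 / 2 - t ^+ 3 / 6) -> t <= ln x.
Proof.
move=> t0 x0 h; have e0 := expR_gt0 (- t).
have h' : 1 <= x * expR (- t) by apply: le_trans h _; rewrite ler_pM2l // expRN_ge_cubic.
have := ln_ge0 h'; by rewrite lnM ?posrE // expRK subr_ge0.
Qed.

Lemma ln_le_of_expR t x : 0 <= t -> 0 < x -> x <= 1 + t + t ^+ 2 / 2 + t ^+ 3 / 6 -> ln x <= t.
Proof.
move=> t0 x0 h; rewrite -[leRHS]expRK ler_ln ?posrE ?expR_gt0 //.
by apply: le_trans h _; exact: expR_ge_cubic.
Qed.

(* 16/15, 25/24 and 81/80 are close to 1 and generate the same multiplicative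
   group as 2, 3 and 5. *)
Lemma ln_16_15 : 129 / 1999 <= 4 * ln 2 - ln 3 - ln 5 :> R /\ 4 * ln 2 - ln 3 - ln 5 <= 71 / 1100 :> R.
Proof.
have -> : 4 * ln 2 - ln 3 - ln 5 = ln (2 ^+ 4 / (3 * 5)) :> R.
  by rewrite ln_div ?posrE ?exprn_gt0 ?mulr_gt0 // lnXn // lnM ?posrE //; ring.
have p : 0 < 2 ^+ 4 / (3 * 5) :> R by rewrite divr_gt0 ?exprn_gt0 ?mulr_gt0.
split.
  apply: ln_ge_of_expRN => [|//|]; lra.
apply: ln_le_of_expR => [|//|]; lra.
Qed.

Lemma ln_25_24 : 2 / 49 <= 2 * ln 5 - 3 * ln 2 - ln 3 :> R /\ 2 * ln 5 - 3 * ln 2 - ln 3 <= 49 / 1200 :> R.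
Proof.
have -> : 2 * ln 5 - 3 * ln 2 - ln 3 = ln (5 ^+ 2 / (2 ^+ 3 * 3)) :> R.
  by rewrite ln_div ?posrE ?exprn_gt0 ?mulr_gt0 ?exprn_gt0 // lnXn // lnM ?posrE ?exprn_gt0 // lnXn //; ring.
have p : 0 < 5 ^+ 2 / (2 ^+ 3 * 3) :> R by rewrite divr_gt0 ?mulr_gt0 ?exprn_gt0.
split.
  apply: ln_ge_of_expRN => [|//|]; lra.
apply: ln_le_of_expR => [|//|]; lra.
Qed.

Lemma ln_81_80 : 2 / 161 <= 4 * ln 3 - 4 * ln 2 - ln 5 :> R /\ 4 * ln 3 - 4 * ln 2 - ln 5 <= 9 / 724 :> R.
Proof.
have -> : 4 * ln 3 - 4 * ln 2 - ln 5 = ln (3 ^+ 4 / (2 ^+ 4 * 5)) :> R.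
  by rewrite ln_div ?posrE ?exprn_gt0 ?mulr_gt0 ?exprn_gt0 // lnXn // lnM ?posrE ?exprn_gt0 // lnXn //; ring.
have p : 0 < 3 ^+ 4 / (2 ^+ 4 * 5) :> R by rewrite divr_gt0 ?mulr_gt0 ?exprn_gt0.
split.
  apply: ln_ge_of_expRN => [|//|]; lra.
apply: ln_le_of_expR => [|//|]; lra.
Qed.

Lemma lnB_le (x y : R) : 0 < x -> 0 < y -> ln x - ln y <= x / y - 1.
Proof.
move=> x0 y0; rewrite -ln_div ?posrE //.
have h : -1 < x / y - 1 by rewrite ltrBrDr addNr divr_gt0.
by have := le_ln1Dx h; rewrite (addrC 1) subrK.
Qed.

Lemma ln_25_8 : ln (25 / 8) = 2 * ln 5 - 3 * ln 2 :> R.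
Proof.
have -> : 25 / 8 = 5 ^+ 2 / 2 ^+ 3 :> R by field.
by rewrite ln_div ?posrE ?exprn_gt0 // !lnXn //; ring.
Qed.

(** The fraction 25/8 is close to pi and has only the prime factors 2 and 5, so ln pi is expressed
    through ln 2 and ln 5. *)
Lemma ln_pi_bounds : 2 * ln 5 - 3 * ln 2 + 15 / 3140 <= ln pi :> R
  /\ ln pi <= 2 * ln 5 - 3 * ln 2 + 8 / 1000 :> R.
Proof.
have p1 := pi_gt_314 R; have p2 := pi_lt_315 R; have p0 := pi_gt0 R.
have q0 : 0 < 25 / 8 :> R by lra.
rewrite -ln_25_8; split.
  have := lnB_le q0 p0; have : 25 / 8 / pi <= 625 / 628 :> R by rewrite ler_pdivrMr //; lra.
  lra.
have := lnB_le p0 q0; have : pi / (25 / 8) <= 126 / 125 :> R by rewrite ler_pdivrMr //; lra.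
lra.
Qed.

End LogBounds.

Section Inequalities.
Variable R : realType.
Local Notation L := (hexagonal_entropy R).
Local Notation B := (vol_bipyramid R).

Lemma vol_bipyramid_ln_le k (c : R) : (3 <= k)%N ->
  (63 / 20 / k%:R) ^+ 2 / 18 + (63 / 20 / k%:R) ^+ 4 / 500 <= c ->
  B k <= 2 * pi * (1 - ln pi - ln 2 + c + ln k%:R).
Proof.
move=> k3 hc; have p0 := pi_gt0 R; have p1 := pi_lt_315 R.
have k0 : 0 < k%:R :> R by rewrite ltr0n (leq_trans _ k3).
apply: le_trans (vol_bipyramid_le _ k3) _; rewrite ler_wpM2l ?mulr_ge0 ?(ltW p0) //.
rewrite lnM ?posrE ?divr_gt0 // ln_div ?posrE //.
have a0 : 0 <= pi / k%:R :> R by rewrite divr_ge0 ?(ltW p0) ?(ltW k0).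
have a1 : pi / k%:R <= 63 / 20 / k%:R :> R by rewrite ler_pM2r ?invr_gt0 // ltW.
have a2 : (pi / k%:R) ^+ 2 <= (63 / 20 / k%:R) ^+ 2 :> R by apply: lerXn2r; rewrite ?nnegrE // (le_trans a0).
have a4 : (pi / k%:R) ^+ 4 <= (63 / 20 / k%:R) ^+ 4 :> R by apply: lerXn2r; rewrite ?nnegrE // (le_trans a0).
lra.
Qed.

(** The correction decreases with [k]; 64/1000 covers the triangle, where the angle is at most
    21/20. *)
Lemma bipyramid_defect_le k : (3 <= k)%N ->
  (63 / 20 / k%:R) ^+ 2 / 18 + (63 / 20 / k%:R) ^+ 4 / 500 <= 64 / 1000 :> R.
Proof.
move=> k3; have k0 : 3 <= k%:R :> R by rewrite ler_nat.
have kp : 0 < k%:R :> R by lra.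
have a0 : 0 <= 63 / 20 / k%:R :> R by rewrite divr_ge0 ?(ltW kp) //; lra.
have a1 : 63 / 20 / k%:R <= 21 / 20 :> R by rewrite ler_pdivrMr //; lra.
have a2 : (63 / 20 / k%:R) ^+ 2 <= (21 / 20) ^+ 2 :> R by apply: lerXn2r; rewrite ?nnegrE // (le_trans a0).
have a4 : (63 / 20 / k%:R) ^+ 4 <= (21 / 20) ^+ 4 :> R by apply: lerXn2r; rewrite ?nnegrE // (le_trans a0).
lra.
Qed.

Let l2 : R := ln 2.
Let l3 : R := ln 3.
Let l5 : R := ln 5.

Let ln4 : ln 4 = 2 * l2.
Proof. by rewrite (_ : 4 = 2 ^+ 2 :> R) ?lnXn // ?mulr_natl //; ring. Qed.

Let ln6 : ln 6 = l2 + l3.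
Proof. by rewrite (_ : 6 = 2 * 3 :> R) ?lnM ?posrE //; ring. Qed.

Let ln15 : ln 15 = l3 + l5.
Proof. by rewrite (_ : 15 = 3 * 5 :> R) ?lnM ?posrE //; ring. Qed.

(** The number 13900 is compared with 24^3 = 13824, which involves the primes 2 and 3 only. *)
Lemma ln_hexagonal_entropy_ge : (9 * ln 2 + 3 * ln 3 + 54 / 10000) / 6 <= L.
Proof.
have := hexagonal_entropy_ge R; set w : R := 139 * 100 => h.
have w0 : 0 < w by rewrite /w; lra.
have v0 : 0 < (2 ^+ 3 * 3) ^+ 3 :> R by rewrite exprn_gt0 // mulr_gt0 // exprn_gt0.
have := lnB_le v0 w0.
have : (2 ^+ 3 * 3) ^+ 3 / w <= 1 - 54 / 10000 by rewrite ler_pdivrMr // /w; lra.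
rewrite lnXn ?mulr_gt0 ?exprn_gt0 // lnM ?posrE ?exprn_gt0 // lnXn //.
lra.
Qed.

Lemma ln_hexagonal_entropy_le : L <= (ln 2 + ln 3 + 2 * ln 5) / 3.
Proof.
have := hexagonal_entropy_le R.
have [c ec] : exists c : R, c = 741 / 5 by exists (741 / 5).
have c0 : 0 < c by rewrite ec; lra.
have : ln c <= ln (2 * 3 * (5 * 5)) by rewrite ler_ln ?posrE ?mulr_gt0 // ec; lra.
by rewrite -ec !lnM ?posrE ?mulr_gt0 //; lra.
Qed.

Let log_facts : [/\ 129 / 1999 <= 4 * l2 - l3 - l5, 2 / 49 <= 2 * l5 - 3 * l2 - l3,
  2 / 161 <= 4 * l3 - 4 * l2 - l5, 2 * l5 - 3 * l2 + 15 / 3140 <= ln pi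
  & (9 * l2 + 3 * l3 + 54 / 10000) / 6 <= L].
Proof.
split; [by have [] := ln_16_15 R | by have [] := ln_25_24 R | by have [] := ln_81_80 R
  | by have [] := ln_pi_bounds R | exact: ln_hexagonal_entropy_ge].
Qed.

Let q : R := 1 - ln pi - ln 2.

(** The case n = 0 of the lower inequality, divided by 2 pi / 3. The sides differ by about 0.01, so
    the general defect 64/1000 in the term of the hexagonal face would be too coarse. *)
Lemma lozenge_margin_hexagonal :
  2 * (q + 64 / 1000 + ln 3) + 3 * (q + 353 / 10000 + ln 4) + (q + 155 / 10000 + ln 6) < L + ln 6.
Proof. by rewrite ln4 ln6 /q; case: log_facts; rewrite -/l2 -/l3; lra. Qed.

Lemma lozenge_margin_slope : 6 / 100 <= ln 15 / 2 + ln 6 - 2 * (q + 64 / 1000 + ln 3)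
  - 3 * (q + 353 / 10000 + ln 4) - (q + 64 / 1000) - (ln 2 + 2 * ln 3) / 2.
Proof. by rewrite ln4 ln6 ln15 /q; case: log_facts; rewrite -/l2 -/l3; lra. Qed.

Lemma lozenge_margin_offset : - (12 / 100) <= L - ln 15 / 2 - ln 6 + (ln 2 + 2 * ln 3) / 2.
Proof.
rewrite ln6 ln15; have [_ a] := ln_16_15 R; have [_ b] := ln_25_24 R; have [_ c] := ln_81_80 R.
have := ln_hexagonal_entropy_ge; move: a b c; rewrite -/l2 -/l3 -/l5; lra.
Qed.

(** Multiplied by 3 * 3^n / (2 pi), the difference of the two sides is bounded below by an affine
    function of 3^n with slope at least 0.06 and constant term at least -0.12. This is positive once
    3^n >= 3 but not at n = 0, which has its own hypothesis. *)
Lemma nu_lozenge_lt_of (e3 e4 e6 : R) n :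
  (forall k, (3 <= k)%N -> B k <= 2 * pi * (q + e3 + ln k%:R)) ->
  B 4 <= 2 * pi * (q + e4 + ln 4%:R) -> B 6 <= 2 * pi * (q + e6 + ln 6%:R) ->
  2 * (q + e3 + ln 3) + 3 * (q + e4 + ln 4) + (q + e6 + ln 6) < L + ln 6 ->
  6 / 100 <= ln 15 / 2 + ln 6 - 2 * (q + e3 + ln 3) - 3 * (q + e4 + ln 4)
    - (q + e3) - (ln 2 + 2 * ln 3) / 2 ->
  nu_lozenge R (medial_truncated_hexagonal n) < 2 * pi * medial_entropy R n.
Proof.
move=> hB h4 h6 n0 X; have Y := lozenge_margin_offset; have h3 := hB 3 isT.
have T0 : 0 < 2 * pi :> R by rewrite mulr_gt0 // pi_gt0.
have u0 : 0 < 3 ^+ n :> R by rewrite exprn_gt0.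
rewrite nu_lozenge_medial_truncated /medial_entropy /v_oct.
rewrite -(ltr_pM2r (mulr_gt0 (ltr0Sn R 2) u0)) mulrDl divfK ?mulf_neq0 ?gt_eqF //.
rewrite -[ltRHS]mulrA divfK ?mulf_neq0 ?gt_eqF //.
move: T0 h3 h4 h6 hB; set T := 2 * pi => T0 h3 h4 h6 hB.
have mulT x y : x < y -> T * x < T * y by rewrite ltr_pM2l.
case: n u0 => [|n] u0.
  rewrite face_sum0 expr0 !mulr1 subrr !mul0r addr0 mul1r.
  by have := mulT _ _ n0; move: h3 h4 h6; rewrite !mulrDr; lra.
have fs : face_sum n.+1 B <= T * (q + e3) * 3 ^+ n.+1
    + T * (ln 6 + (3 ^+ n.+1 - 1) / 2 * (ln 2 + 2 * ln 3)).
  by apply: face_sum_ln_le => k k3; rewrite -mulrDr; exact: hB.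
have u3 : 3 <= 3 ^+ n.+1 :> R by rewrite exprS ler_peMr // exprn_ege1 // ler1n.
move: u0 u3 fs X Y h3 h4 {n0 h6 hB}.
set u := 3 ^+ n.+1; set b := q + e3; set b4 := q + e4.
set d := ln 2 + 2 * ln 3 => u0 u3 fs; set x := ln 15 / 2 + _ - _ - _ - _ - _ => X Y h3 h4.
have x0 : 0 <= (u - 3) * (x - 6 / 100) by rewrite mulr_ge0 ?subr_ge0.
have key : 2 * u * (b + ln 3) + (b * u + (ln 6 + (u - 1) / 2 * d)) + 3 * u * (b4 + ln 4)
    < L + (u - 1) / 2 * ln 15 + u * ln 6.
  by move: x0 X Y u3; rewrite /x; lra.
have k3 : 2 * u * B 3 <= 2 * u * (T * (b + ln 3)) by rewrite ler_wpM2l // mulr_ge0 // ltW.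
have k4 : 3 * u * B 4 <= 3 * u * (T * (b4 + ln 4)) by rewrite ler_wpM2l // mulr_ge0 // ltW.
by have := mulT _ _ key; lra.
Qed.

Let c4 : (63 / 20 / 4%:R) ^+ 2 / 18 + (63 / 20 / 4%:R) ^+ 4 / 500 <= 353 / 10000 :> R.
Proof. by rewrite (_ : 63 / 20 / 4%:R = 63 / 80 :> R); [lra | field]. Qed.

Let c6 : (63 / 20 / 6%:R) ^+ 2 / 18 + (63 / 20 / 6%:R) ^+ 4 / 500 <= 155 / 10000 :> R.
Proof. by rewrite (_ : 63 / 20 / 6%:R = 21 / 40 :> R); [lra | field]. Qed.

Lemma nu_lozenge_lt n :
  nu_lozenge R (medial_truncated_hexagonal n) < 2 * pi * medial_entropy R n.
Proof.
apply: (nu_lozenge_lt_of n _ _ _ lozenge_margin_hexagonal lozenge_margin_slope).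
- by move=> k k3; exact: vol_bipyramid_ln_le k3 (bipyramid_defect_le k3).
- exact: vol_bipyramid_ln_le c4.
- exact: vol_bipyramid_ln_le c6.
Qed.

Lemma pi4_bounds : 616 / 1000 <= (pi / 4%:R) ^+ 2 :> R /\ (pi / 4%:R) ^+ 4 <= 39 / 100 :> R.
Proof.
have q1 := pi_gt_314 R; have q2 := pi_lt_315 R.
have e1 : 0 <= 157 / 200 :> R by lra.
have e2 : 157 / 200 <= pi / 4%:R :> R by lra.
have e3 : pi / 4%:R <= 79 / 100 :> R by lra.
have e4 := le_trans e1 e2.
have : (157 / 200) ^+ 2 <= (pi / 4%:R) ^+ 2 :> R by apply: lerXn2r; rewrite ?nnegrE.
have : (pi / 4%:R) ^+ 4 <= (79 / 100) ^+ 4 :> R by apply: lerXn2r; rewrite ?nnegrE // (le_trans e4).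
by split; lra.
Qed.

(** A lower bound for [v_oct] / (2 pi), from the angle pi / 4 with its even powers replaced by
    rational bounds. *)
Let g : R := 1 - (ln 2 + (ln pi - ln 4)) + 616 / 1000 / 18 - 39 / 100 / 600.

Lemma v_oct_ge : 2 * pi * g <= v_oct R.
Proof.
have p0 := pi_gt0 R; apply: le_trans (vol_bipyramid_ge R (isT : (3 <= 4)%N)).
rewrite ler_wpM2l ?mulr_ge0 ?(ltW p0) // lnM ?posrE ?divr_gt0 // ln_div ?posrE // /g.
by have [] := pi4_bounds; set x := _ ^+ 2; set y := _ ^+ 4; lra.
Qed.

(** The upper inequality compares two affine functions of 3^n: the first part is the comparison at
    3^n = 1, the second that of the slopes. *)
Lemma v_oct_margin : L + ln 6 < 6 * g /\ ln 15 / 2 + ln 6 <= 6 * g.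
Proof.
rewrite /g ln4 ln6 ln15; have [_ p] := ln_pi_bounds R; have hL := ln_hexagonal_entropy_le.
have [_ a] := ln_16_15 R; have [_ b] := ln_25_24 R; have [_ c] := ln_81_80 R.
by move: p hL a b c; rewrite -/l2 -/l3 -/l5; split; lra.
Qed.

Lemma lt_nu_bar n :
  2 * pi * medial_entropy R n < nu_bar R (medial_truncated_hexagonal n).
Proof.
have [] := v_oct_margin; have := v_oct_ge; move: g => b h k1 k2.
have u0 : 0 < 3 ^+ n :> R by rewrite exprn_gt0.
have u1 : 1 <= 3 ^+ n :> R by rewrite exprn_ege1 // ler1n.
rewrite nu_bar_medial_truncated /medial_entropy; set u := 3 ^+ n in u0 u1 *.
have T0 : 0 < 2 * pi :> R by rewrite mulr_gt0 // pi_gt0.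
apply: lt_le_trans (_ : 2 * pi * (2 * b) <= _); last by lra.
rewrite ltr_pM2l // ltr_pdivrMr ?mulr_gt0 //.
have : (u - 1) * (ln 15 / 2 + ln 6) <= (u - 1) * (6 * b) by rewrite ler_wpM2l // subr_ge0.
lra.
Qed.

End Inequalities.

Theorem corollary15 (R : realType) (n : nat) :
  exists z : R,
    is_spanning_tree_entropy (medial_truncated_hexagonal n) z /\
    nu_lozenge R (medial_truncated_hexagonal n) < 2 * pi * z /\
    2 * pi * z < nu_bar R (medial_truncated_hexagonal n).
Proof.
exists (medial_entropy R n); split; first exact: medial_entropyP.
by split; [exact: nu_lozenge_lt | exact: lt_nu_bar].
Qed.
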